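(* Let $T>0$, let $A,C\in C([0,T];\mathbb{R}^{n\times n})$, $B,D\in C([0,T];\mathbb{R}^{n\times m})$, $G\in C([0,T];\mathbb{S}^n)$, $Q\in C([0,T]^2;\mathbb{S}^n)$, $R\in C([0,T]^2;\mathbb{S}^m)$. Assume: (i) there is a constant $\delta>0$ such that $Q(t,s)\ge 0$, $R(t,s)\ge \delta I$, $G(t)\ge 0$ for all $0\le t\le s\le T$; (ii) there are positive definite matrices $\widehat Q,\widehat R,\widehat G$ such that for all $0\le t\le r\le s\le T$, $Q(t,s)\le Q(r,s)\le\widehat Q$, $R(t,s)\le R(r,s)\le\widehat R$, $G(t)\le G(r)\le\widehat G$; (iii) $G\in C^1([0,T];\mathbb{S}^n)$, and $Q(t,s)$ and $R(t,s)$ are continuously differentiable with respect to $t$ over $\{(t,s): 0\le t\le s\le T\}$. Suppose that a function $t\mapsto P(t,t)$ in $C([0,T];\mathbb{S}^n_+)$ is a solution of the Volterra integro-differential equation $$\begin{cases}P(t,t)=\mathbb{E}\Big[\Phi(t,T)^\top G(t)\Phi(t,T)+\displaystyle\int_t^T\Phi(t,s)^\top\big(Q(t,s)+\Theta(s)^\top R(t,s)\Theta(s)\big)\Phi(t,s)\,ds\Big],\\ \Phi(t,s)=I+\displaystyle\int_t^sA_\Theta(r)\Phi(t,r)\,dr+\int_t^sC_\Theta(r)\Phi(t,r)\,dW(r),\quad 0\le t\le s\le T,\end{cases}$$ where $$\Theta(s)=-[R(s,s)+D(s)^\top P(s,s)D(s)]^{-1}[B(s)^\top P(s,s)+D(s)^\top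 P(s,s)C(s)],$$ $$A_\Theta(s)=A(s)+B(s)\Theta(s),\qquad C_\Theta(s)=C(s)+D(s)\Theta(s).$$ Then $$\sup_{t\in[0,T]}|P(t,t)|\le\big(|\widehat G|+T|\widehat Q|\big)\,e^{\int_0^T(2|A(s)|+|C(s)|^2)\,ds}.$$
   Context: $\mathbb{S}^n$ is the space of symmetric real $n\times n$ matrices, $\mathbb{S}^n_+$ the subset of positive semi-definite ones, and inequalities between symmetric matrices are in the positive semi-definite (Loewner) order. $|\cdot|$ is the Euclidean (Frobenius) norm of a matrix. $W$ is a one-dimensional standard Brownian motion on a complete filtered probability space $(\Omega,\mathcal F,\mathbb F,\mathbb P)$, $\mathbb F$ being the augmented natural filtration of $W$; $\mathbb E$ is expectation; stochastic integrals are Itô integrals. In the Volterra equation only the function of one variable $t\mapsto P(t,t)$ is unknown (together with $\Phi$, which is determined by $\Theta$ via the linear SDE); the notation $P(t,t)$ is simply the name of this function at $t$. *)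

(* Defs.v *)
From HB Require Import structures.
From mathcomp Require Import all_boot all_order all_algebra.
From mathcomp Require Import all_classical all_reals all_analysis.

Set Implicit Arguments.
Unset Strict Implicit.
Unset Printing Implicit Defensive.

Import Order.TTheory GRing.Theory Num.Theory.
Import numFieldNormedType.Exports.

Local Open Scope classical_set_scope.
Local Open Scope ring_scope.

(* The norm `|M| that MathComp-Analysis puts on matrices is the sup norm. *)
Definition frobenius (K : realType) (p q : nat) (M : 'M[K]_(p, q)) : K :=
  Num.sqrt (\sum_i \sum_j M i j ^+ 2).

Definition mx_symmetric (K : realType) (p : nat) (M : 'M[K]_p) : Prop := M^T = M.

Definition psd (K : realType) (p : nat) (M : 'M[K]_p) : Prop :=
  mx_symmetric M /\ forall x : 'cV[K]_p, 0 <= (x^T *m M *m x) 0 0.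

Definition posdef (K : realType) (p : nat) (M : 'M[K]_p) : Prop :=
  mx_symmetric M /\ forall x : 'cV[K]_p, x != 0 -> 0 < (x^T *m M *m x) 0 0.

Definition loewner_le (K : realType) (p : nat) (M N : 'M[K]_p) : Prop :=
  psd (N - M).

Definition mx_Rintegral (K : realType) (p q : nat) (D : set K)
    (M : K -> 'M[K]_(p, q)) : 'M[K]_(p, q) :=
  \matrix_(i, j) (\int[lebesgue_measure]_(s in D) M s i j)%R.

(* Limit of difference quotients within D: a one-sided derivative at an
   endpoint of an interval D, and no condition at an isolated point of D. *)
Definition mx_derivative_within (K : realType) (p q : nat) (D : set K)
    (f : K -> 'M[K]_(p, q)) (x : K) (l : 'M[K]_(p, q)) : Prop :=
  (fun y => (y - x)^-1 *: (f y - f x)) @ within D x^' --> l.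

Definition C1_on (K : realType) (p q : nat) (T : K)
    (f : K -> 'M[K]_(p, q)) : Prop :=
  exists f' : K -> 'M[K]_(p, q),
    {within `[0, T], continuous f'} /\
    forall t : K, 0 <= t <= T -> mx_derivative_within `[0, T] f t (f' t).

Definition triangle (K : realType) (T : K) : set (K * K) :=
  [set z | 0 <= z.1 /\ z.1 <= z.2 /\ z.2 <= T].

(* The horizontal section of the triangle at height s is [0, s]. *)
Definition C1_fst_on_triangle (K : realType) (p q : nat) (T : K)
    (f : K -> K -> 'M[K]_(p, q)) : Prop :=
  exists f' : K -> K -> 'M[K]_(p, q),
    {within triangle T, continuous (fun z : K * K => f' z.1 z.2)} /\
    forall t s : K, 0 <= t -> t <= s -> s <= T ->
      mx_derivative_within `[0, s] (fun u => f u s) t (f' t s).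

Definition sigma_measurable (K : realType) (Omega : Type)
    (S : set (set Omega)) (X : Omega -> K) : Prop :=
  forall B : set K, measurable B -> S (X @^-1` B).

Definition augmented_filtration (K : realType) (d : measure_display)
    (Omega : measurableType d) (Pr : probability Omega K)
    (W : K -> Omega -> K) (t : K) : set (set Omega) :=
  <<s [set E | (exists r : K, exists B : set K,
                   [/\ 0 <= r <= t, measurable B & E = W r @^-1` B])
               \/ Pr.-negligible E] >>.

Definition increment (K : realType) (Omega : Type) (W : K -> Omega -> K)
    (s t : K) (w : Omega) : K := W t w - W s w.

Definition brownian_motion (K : realType) (d : measure_display)
    (Omega : measurableType d) (Pr : probability Omega K)
    (F : K -> set (set Omega)) (W : K -> Omega -> K) : Prop :=
  [/\ forall t : K, 0 <= t ->
        measurable_fun setT (W t) /\ sigma_measurable (F t) (W t),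
      {ae Pr, forall w, W 0 w = 0},
      {ae Pr, forall w, {within `[0, +oo[, continuous (fun t => W t w)}},
      forall (s t : K) (B : set K), 0 <= s -> s < t -> measurable B ->
        Pr (increment W s t @^-1` B)
        = normal_prob 0 (Num.sqrt (t - s)) B
    & forall (s t : K) (E : set Omega) (B : set K),
        0 <= s -> s <= t -> F s E -> measurable B ->
        Pr (E `&` increment W s t @^-1` B)
        = (Pr E * Pr (increment W s t @^-1` B))%E].

Definition L2_norm2 (K : realType) (d : measure_display)
    (Omega : measurableType d) (Pr : probability Omega K) (a b : K)
    (X : K -> Omega -> K) : \bar K :=
  (\int[Pr]_w \int[lebesgue_measure]_(r in `[a, b]) ((X r w) ^+ 2)%:E)%E.

Definition L2_process (K : realType) (d : measure_display)
    (Omega : measurableType d) (Pr : probability Omega K)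
    (F : K -> set (set Omega)) (a b : K) (X : K -> Omega -> K) : Prop :=
  [/\ measurable_fun (`[a, b] `*` setT) (fun z : K * Omega => X z.1 z.2),
      forall r : K, a <= r <= b -> sigma_measurable (F r) (X r)
    & (L2_norm2 Pr a b X < +oo)%E].

(* The process equal to xi_i on ]t_i, t_{i+1}], i < N, and to 0 elsewhere. *)
Record step_process (K : realType) (Omega : Type) := StepProcess {
  step_size : nat ;
  step_pt : nat -> K ;
  step_val : nat -> Omega -> K }.

Definition step_fun (K : realType) (Omega : Type) (H : step_process K Omega)
    (r : K) (w : Omega) : K :=
  \sum_(i < step_size H | step_pt H i < r <= step_pt H i.+1) step_val H i w.

Definition step_integral (K : realType) (Omega : Type) (W : K -> Omega -> K)
    (H : step_process K Omega) (w : Omega) : K :=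
  \sum_(i < step_size H)
    step_val H i w * increment W (step_pt H i) (step_pt H i.+1) w.

Definition simple_process (K : realType) (d : measure_display)
    (Omega : measurableType d) (F : K -> set (set Omega)) (a b : K)
    (H : step_process K Omega) : Prop :=
  [/\ step_pt H 0%N = a,
      step_pt H (step_size H) = b,
      forall i, (i < step_size H)%N -> step_pt H i <= step_pt H i.+1
    & forall i, (i < step_size H)%N ->
        [/\ measurable_fun setT (step_val H i),
            sigma_measurable (F (step_pt H i)) (step_val H i)
          & exists M : K, forall w, `|step_val H i w| <= M]].

(* J is a version of the Ito integral of X over [a, b] against W, i.e. the
   L2(Pr)-limit of the integrals of simple processes that converge to X in
   L2 of the product of Lebesgue measure on [a, b] and Pr. *)
Definition ito_integral (K : realType) (d : measure_display)
    (Omega : measurableType d) (Pr : probability Omega K)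
    (F : K -> set (set Omega)) (W : K -> Omega -> K) (a b : K)
    (X : K -> Omega -> K) (J : Omega -> K) : Prop :=
  [/\ L2_process Pr F a b X,
      measurable_fun setT J
    & exists H : nat -> step_process K Omega,
      [/\ forall k, simple_process F a b (H k),
          L2_norm2 Pr a b (fun r w => step_fun (H k) r w - X r w)
            @[k --> \oo] --> (0 : \bar K)%E
        & (\int[Pr]_w ((step_integral W (H k) w - J w) ^+ 2)%:E)%E
            @[k --> \oo] --> (0 : \bar K)%E]].

(* Phi solves dPhi = A Phi ds + C Phi dW on [t, T] with Phi(t) = I. *)
Definition linear_sde_solution (K : realType) (d : measure_display)
    (Omega : measurableType d) (Pr : probability Omega K)
    (F : K -> set (set Omega)) (W : K -> Omega -> K) (n : nat) (t T : K)
    (A C : K -> 'M[K]_n) (Phi : K -> Omega -> 'M[K]_n) : Prop :=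
  [/\ forall i j, L2_process Pr F t T (fun s w => Phi s w i j),
      {ae Pr, forall w, {within `[t, T], continuous (fun s => Phi s w)}}
    & forall s : K, t <= s <= T -> exists J : Omega -> 'M[K]_n,
        (forall i j, ito_integral Pr F W t s
           (fun r w => (C r *m Phi r w) i j) (fun w => J w i j)) /\
        {ae Pr, forall w,
           Phi s w = 1%:M
             + mx_Rintegral `[t, s] (fun r => A r *m Phi r w) + J w}].

(* In the next definitions [P s] is the value denoted by P(s, s). *)
Definition feedback (K : realType) (n m : nat)
    (B D : K -> 'M[K]_(n, m)) (C : K -> 'M[K]_n) (R : K -> K -> 'M[K]_m)
    (P : K -> 'M[K]_n) (s : K) : 'M[K]_(m, n) :=
  - (invmx (R s s + (D s)^T *m P s *m D s)
     *m ((B s)^T *m P s + (D s)^T *m P s *m C s)).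

Definition volterra_solution (K : realType) (d : measure_display)
    (Omega : measurableType d) (Pr : probability Omega K)
    (F : K -> set (set Omega)) (W : K -> Omega -> K) (n m : nat) (T : K)
    (A C : K -> 'M[K]_n) (B D : K -> 'M[K]_(n, m)) (G : K -> 'M[K]_n)
    (Q : K -> K -> 'M[K]_n) (R : K -> K -> 'M[K]_m)
    (P : K -> 'M[K]_n) (Phi : K -> K -> Omega -> 'M[K]_n) : Prop :=
  let Theta := feedback B D C R P in
  let A_Theta (s : K) : 'M[K]_n := A s + B s *m Theta s in
  let C_Theta (s : K) : 'M[K]_n := C s + D s *m Theta s in
  let Y (t : K) (w : Omega) : 'M[K]_n :=
    (Phi t T w)^T *m G t *m Phi t T w
    + mx_Rintegral `[t, T] (fun s =>
        (Phi t s w)^T *m (Q t s + (Theta s)^T *m R t s *m Theta s)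
        *m Phi t s w) in
  forall t : K, 0 <= t <= T ->
    linear_sde_solution Pr F W t T A_Theta C_Theta (Phi t) /\
    forall i j, (P t i j)%:E = 'E_Pr[fun w => Y t w i j]%E.

(* Main.v *)
Require Import Defs.
From HB Require Import structures.
From mathcomp Require Import all_boot all_order all_algebra.
From mathcomp Require Import all_classical all_reals all_analysis.
From mathcomp Require Import measurable_realfun ring lra.

(* Let f(t) = |P(t,t)|. For a symmetric N >= 0 the matrix
   M_t(s) = E[Phi(t,s) N Phi(t,s)^T] solves the Lyapunov equation
   M' = A_Theta M + M A_Theta^T + C_Theta M C_Theta^T, M(t) = N, and
   <P(t,t), N> = <G(t), M_t(T)> + int_t^T <q(t,s), M_t(s)> ds with
   q(t,s) = Q(t,s) + Theta(s)^T R(t,s) Theta(s). Since G, Q(.,s) and R(.,s) are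
   increasing and the solution of the Lyapunov equation is unique,
   <P(t,t), N> <= <P(r,r), M_t(r)> + int_t^r <q(t,s), M_t(s)> ds for t < r.
   Taking N = P(t,t), the choice of Theta completes a square in the first-order
   term of the right-hand side, whence
   f(t)^2 <= f(t) f(r) + (r-t) ((2|A|+|C|^2) f(t)^2 + |Qhat| f(t) + o(1)).
   This is a differential inequality for the one-sided Dini derivative of the
   continuous function f, and f(T) = |G(T)| <= |Ghat|; conclude with Gronwall. *)

Set Implicit Arguments.
Unset Strict Implicit.
Unset Printing Implicit Defensive.

Import Order.TTheory GRing.Theory Num.Theory.
Import numFieldNormedType.Exports.

Local Open Scope classical_set_scope.
Local Open Scope ring_scope.

(** * Square-integrable functions *)

(** Each Phi(t,.) is a separate solution, and nothing given relates Phi(t,.) to Phi(r,.). A pathwise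
    flow identity would call for uniqueness in the stochastic equation and for conditioning on the
    past. Second moments obey a deterministic linear equation, so for them the flow identity costs
    only a Gronwall argument. This is why the cost is dualized, <Phi^T Y Phi, N> = <Y, Phi N Phi^T>,
    before two times are compared. P is only continuous, so P itself is never differentiated:
    <P(r,r), M_t(r)> is split into <P(r,r), N>, at most f(r) f(t) for N = P(t,t), and <P(r,r),
    M_t(r) - N>, where only M_t has to have a right derivative at t. What remains is A^T P + P A +
    C^T P C + Q(t,t), free of Theta and R; its first three terms give 2|A| + |C|^2. *)

Section square_integrable.
Context {d : measure_display} {U : measurableType d} {K : realType}.
Variable mu : {measure set U -> \bar K}.
Implicit Types X Y Z : U -> K.

(** Functions, not classes modulo null sets: the solution equations hold only almost surely, and
    [L2_ae] and [ip_ae] carry facts across such equalities. *)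
Definition L2 X : Prop :=
  measurable_fun setT X /\ mu.-integrable setT (EFin \o (fun x => X x ^+ 2)).

Definition ip X Y : K := \int[mu]_x (X x * Y x).

Lemma integrable_le (f g : U -> K) : measurable_fun setT f ->
  mu.-integrable setT (EFin \o g) -> (forall x, `|f x| <= g x) ->
  mu.-integrable setT (EFin \o f).
Proof.
move=> mf ig fg; apply: (le_integrable _ _ _ ig) => //.
  exact/measurable_EFinP.
by move=> x _ /=; rewrite lee_fin (le_trans (fg x))// ler_norm.
Qed.

Lemma integrableDE (f g : U -> K) : mu.-integrable setT (EFin \o f) ->
  mu.-integrable setT (EFin \o g) ->
  mu.-integrable setT (EFin \o (fun x => f x + g x)).
Proof. by move=> i j; apply: (integrableD measurableT i j). Qed.

Lemma integrableZE (c : K) (f : U -> K) : mu.-integrable setT (EFin \o f) ->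
  mu.-integrable setT (EFin \o (fun x => c * f x)).
Proof. by move=> i; apply: (integrableZl measurableT c i). Qed.

Lemma L2_meas X : L2 X -> measurable_fun setT X. Proof. by case. Qed.

Lemma L2_mul X Y : L2 X -> L2 Y ->
  mu.-integrable setT (EFin \o (fun x => X x * Y x)).
Proof.
move=> [mX iX] [mY iY].
apply: (@integrable_le _ (fun x => X x ^+ 2 + Y x ^+ 2)).
- exact: measurable_funM.
- exact: integrableDE.
- by move=> x; rewrite ler_norml; apply/andP; split; nra.
Qed.

Lemma L2Z (c : K) X : L2 X -> L2 (fun x => c * X x).
Proof.
move=> [mX iX]; split; first exact: measurable_funM.
rewrite (_ : (EFin \o _) = EFin \o (fun x => c ^+ 2 * X x ^+ 2)); last first.
  by apply/funext => x /=; rewrite exprMn.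
exact: integrableZE.
Qed.

Lemma L2D X Y : L2 X -> L2 Y -> L2 (fun x => X x + Y x).
Proof.
move=> [mX iX] [mY iY]; split; first exact: measurable_funD.
apply: (@integrable_le _ (fun x => 2 * X x ^+ 2 + 2 * Y x ^+ 2)).
- by apply: measurable_funX; exact: measurable_funD.
- by apply: integrableDE; exact: integrableZE.
- by move=> x; rewrite ger0_norm ?sqr_ge0//; have := sqr_ge0 (X x - Y x); lra.
Qed.

Lemma L2B X Y : L2 X -> L2 Y -> L2 (fun x => X x - Y x).
Proof.
move=> lX /(L2Z (-1)) lY; have := L2D lX lY.
by congr L2; apply/funext => x; rewrite mulN1r.
Qed.

Lemma L2_0 : L2 (fun=> 0).
Proof.
split=> //; rewrite (_ : _ \o _ = cst 0%E) ?integrable0//.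
by apply/funext => x /=; rewrite expr0n.
Qed.

Lemma L2_sum (I : Type) (r : seq I) (X : I -> U -> K) :
  (forall i, L2 (X i)) -> L2 (fun x => \sum_(i <- r) X i x).
Proof.
move=> lX; elim: r => [|i r IH].
  by under eq_fun do rewrite big_nil; exact: L2_0.
by under eq_fun do rewrite big_cons; exact: L2D.
Qed.

End square_integrable.

Ltac solve_L2 := repeat first
  [done | exact: L2_0 | apply: L2B | apply: L2D | apply: L2Z | apply: L2_sum => ?].

Section inner_product.
Context {d : measure_display} {U : measurableType d} {K : realType}.
Variable mu : {measure set U -> \bar K}.
Implicit Types X Y Z : U -> K.
Local Notation L2 := (L2 mu).
Local Notation ip := (ip mu).

Lemma ipC X Y : ip X Y = ip Y X.
Proof. by rewrite /ip; under eq_Rintegral do rewrite mulrC. Qed.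

Lemma ipDl X Y Z : L2 X -> L2 Y -> L2 Z ->
  ip (fun x => X x + Y x) Z = ip X Z + ip Y Z.
Proof.
move=> lX lY lZ; rewrite /ip -RintegralD//; [|exact: L2_mul..].
by under eq_Rintegral do rewrite mulrDl.
Qed.

Lemma ipBl X Y Z : L2 X -> L2 Y -> L2 Z ->
  ip (fun x => X x - Y x) Z = ip X Z - ip Y Z.
Proof.
move=> lX lY lZ; rewrite /ip -RintegralB//; [|exact: L2_mul..].
by under eq_Rintegral do rewrite mulrBl.
Qed.

Lemma ipZl c X Z : L2 X -> L2 Z -> ip (fun x => c * X x) Z = c * ip X Z.
Proof.
move=> lX lZ; rewrite /ip -RintegralZl//; last exact: L2_mul.
by under eq_Rintegral do rewrite -mulrA.
Qed.

Lemma ipDr X Y Z : L2 X -> L2 Y -> L2 Z ->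
  ip Z (fun x => X x + Y x) = ip Z X + ip Z Y.
Proof. by move=> lX lY lZ; rewrite ipC ipDl// !(ipC Z). Qed.

Lemma ipBr X Y Z : L2 X -> L2 Y -> L2 Z ->
  ip Z (fun x => X x - Y x) = ip Z X - ip Z Y.
Proof. by move=> lX lY lZ; rewrite ipC ipBl// !(ipC Z). Qed.

Lemma ipZr c X Z : L2 X -> L2 Z -> ip Z (fun x => c * X x) = c * ip Z X.
Proof. by move=> lX lZ; rewrite ipC ipZl// ipC. Qed.

Lemma ip_suml (I : Type) (r : seq I) (X : I -> U -> K) Z :
  (forall i, L2 (X i)) -> L2 Z ->
  ip (fun x => \sum_(i <- r) X i x) Z = \sum_(i <- r) ip (X i) Z.
Proof.
move=> lX lZ; elim: r => [|i r IH].
  rewrite big_nil /ip; under eq_Rintegral do rewrite big_nil mul0r.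
  by rewrite /Rintegral integral0.
rewrite big_cons -IH -ipDl//; last exact: L2_sum.
by congr ip; apply/funext => x; rewrite big_cons.
Qed.

Lemma ip_sumr (I : Type) (r : seq I) (X : I -> U -> K) Z :
  (forall i, L2 (X i)) -> L2 Z ->
  ip Z (fun x => \sum_(i <- r) X i x) = \sum_(i <- r) ip Z (X i).
Proof.
move=> lX lZ; rewrite ipC ip_suml//.
by apply: eq_bigr => i _; rewrite ipC.
Qed.

Lemma ip_ge0 X : 0 <= ip X X.
Proof. by apply: Rintegral_ge0 => x _; rewrite -expr2 sqr_ge0. Qed.

Lemma ip_CauchySchwarz X Y : L2 X -> L2 Y ->
  ip X Y ^+ 2 <= ip X X * ip Y Y.
Proof.
move=> lX lY; pose a := ip X X; pose b := ip X Y; pose c := ip Y Y.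
have key s t : 0 <= s ^+ 2 * a - 2 * s * t * b + t ^+ 2 * c.
  have := ip_ge0 (fun x => s * X x - t * Y x).
  rewrite ipBl ?ipBr ?ipZl ?ipZr//; try by solve_L2.
  by rewrite (ipC Y X) -/a -/b -/c => h; nra.
rewrite -/a -/b -/c; have a0 : 0 <= a := ip_ge0 X; have c0 : 0 <= c := ip_ge0 Y.
(* The two choices give a (ac - b^2) >= 0 and c (ac - b^2) >= 0, which settles every case but a = c
   = 0; there s = 1, t = b gives -2 b^2 >= 0. *)
have h1 := key b a; have h2 := key c b.
have [c0'|c0'] := eqVneq c 0; last first.
  have cp : 0 < c by rewrite lt_neqAle eq_sym c0'.
  by rewrite -(ler_pM2r cp); nra.
have [a0'|a0'] := eqVneq a 0; last first.
  have ap : 0 < a by rewrite lt_neqAle eq_sym a0'.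
  by rewrite -(ler_pM2r ap); nra.
have := key 1 b; rewrite a0' c0'; nra.
Qed.

Lemma L2_ae X Y : L2 X -> measurable_fun setT Y ->
  (\forall x \ae mu, X x = Y x) -> L2 Y.
Proof.
move=> [mX iX] mY XY; split => //.
have mY2 : measurable_fun setT (fun x => Y x ^+ 2) by exact: measurable_funX.
move/integrableP : iX => [mX2 fX]; apply/integrableP; split.
  exact/measurable_EFinP.
rewrite (ge0_ae_eq_integral (g := fun x => `|(X x ^+ 2)%:E|%E)) //.
- by apply: measurableT_comp => //; exact/measurable_EFinP.
- exact: measurableT_comp.
- by apply: filterS XY => x /= -> _.
Qed.

Lemma ip_ae X X' Y : measurable_fun setT X -> measurable_fun setT X' ->
  measurable_fun setT Y -> (\forall x \ae mu, X x = X' x) ->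
  ip X Y = ip X' Y.
Proof.
move=> mX mX' mY XX'; congr fine; apply: ae_eq_integral => //.
- by apply/measurable_EFinP; exact: measurable_funM.
- by apply/measurable_EFinP; exact: measurable_funM.
- by apply: filterS XX' => x /= ->.
Qed.

(** [ito_integral] asks only that J be measurable; its square integrability is deduced from its
    finite distance to one approximating integral. *)
Lemma L2_close X Y : L2 X -> measurable_fun setT Y ->
  (\int[mu]_x ((X x - Y x) ^+ 2)%:E < +oo)%E -> L2 Y.
Proof.
move=> lX mY XY; have mX := L2_meas lX.
have lXY : L2 (fun x => X x - Y x).
  split; first exact: measurable_funB.
  apply/integrableP; split.
    by apply/measurable_EFinP/measurable_funX; exact: measurable_funB.
  by under eq_integral do rewrite /= ger0_norm ?sqr_ge0//.
have := L2B lX lXY; congr L2; apply/funext => x; ring.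
Qed.

Lemma integral_L2 X : L2 X -> (\int[mu]_x (X x ^+ 2)%:E)%E = (ip X X)%:E.
Proof.
move=> [mX iX]; rewrite /ip /Rintegral fineK.
  by under [RHS]eq_integral do rewrite -expr2.
under eq_integral do rewrite -expr2.
exact: integrable_fin_num.
Qed.

(** Expanding around the limits leaves three error terms, each with a factor that tends to 0 in
    norm, so Cauchy-Schwarz disposes of them. *)
Lemma ip_cvg (X Y : nat -> U -> K) (X0 Y0 : U -> K) :
  (forall k, L2 (X k)) -> (forall k, L2 (Y k)) -> L2 X0 -> L2 Y0 ->
  ip (fun x => X k x - X0 x) (fun x => X k x - X0 x) @[k --> \oo] --> (0 : K) ->
  ip (fun x => Y k x - Y0 x) (fun x => Y k x - Y0 x) @[k --> \oo] --> (0 : K) ->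
  ip (X k) (Y k) @[k --> \oo] --> ip X0 Y0.
Proof.
move=> lX lY lX0 lY0 cX cY.
have sq0 (u : nat -> K) : (u k ^+ 2 @[k --> \oo] --> (0 : K)) ->
    u k @[k --> \oo] --> (0 : K).
  move=> u2; apply/norm_cvg0P.
  have -> : (fun k => `|u k|) = (fun k => Num.sqrt (u k ^+ 2)).
    by apply/funext => k; rewrite sqrtr_sqr.
  rewrite -[X in _ --> X]sqrtr0.
  by apply: continuous_cvg => //; exact: sqrt_continuous.
have small (A B : nat -> U -> K) : (forall k, L2 (A k)) -> (forall k, L2 (B k)) ->
    ip (A k) (A k) * ip (B k) (B k) @[k --> \oo] --> (0 : K) ->
    ip (A k) (B k) @[k --> \oo] --> (0 : K).
  move=> lA lB AB; apply: sq0.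
  apply: (squeeze_cvgr _ (cvg_cst 0) AB); apply: nearW => k.
  by rewrite sqr_ge0 ip_CauchySchwarz.
pose DX k x := X k x - X0 x; pose DY k x := Y k x - Y0 x.
have lDX k : L2 (DX k) by exact: L2B.
have lDY k : L2 (DY k) by exact: L2B.
have E k : ip (X k) (Y k) =
    ip (DX k) (DY k) + ip (DX k) Y0 + ip X0 (DY k) + ip X0 Y0.
  rewrite /DX /DY !ipBl ?ipBr//; try by solve_L2.
  ring.
have small1 : ip (DX k) (DY k) @[k --> \oo] --> (0 : K).
  by apply: small => //; rewrite -(mulr0 0); exact: cvgM.
have small2 : ip (DX k) Y0 @[k --> \oo] --> (0 : K).
  apply: (small _ (fun=> Y0)) => //.
  by rewrite -(mul0r (ip Y0 Y0)); apply: cvgM => //; exact: cvg_cst.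
have small3 : ip X0 (DY k) @[k --> \oo] --> (0 : K).
  apply: (small (fun=> X0)) => //.
  by rewrite -(mulr0 (ip X0 X0)); apply: cvgM => //; exact: cvg_cst.
rewrite (funext E) -[ip X0 Y0 in X in _ --> X]add0r.
apply: cvgD; last exact: cvg_cst.
rewrite -[0 in X in _ --> X]addr0; apply: cvgD => //.
by rewrite -[0 in X in _ --> X]addr0; apply: cvgD.
Qed.

End inner_product.

(** * Moments of the centered normal distribution *)

Section normal_moments.
Context {K : realType}.
Local Notation mu := (@lebesgue_measure K).
Implicit Types (r s t x : K).

(** The Radon-Nikodym derivative and the explicit density have the same integral over every
    measurable set, hence agree almost everywhere. *)
Lemma ge0_integral_normal_prob s (g : K -> \bar K) : measurable_fun setT g ->
  (forall x, 0 <= g x)%E ->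
  (\int[normal_prob 0%R s]_x g x = \int[mu]_x (g x * (normal_pdf 0 s x)%:E))%E.
Proof.
move=> mg g0; have dom := normal_prob_dominates 0 s.
rewrite -(Radon_Nikodym_SigmaFinite.change_of_variables dom)//.
have mf : measurable_fun setT (Radon_Nikodym_SigmaFinite.f (normal_prob 0 s) mu).
  exact: measurable_int (Radon_Nikodym_SigmaFinite.f_integrable dom).
have mp : measurable_fun setT (fun x => (normal_pdf 0 s x)%:E).
  by apply/measurable_EFinP; exact: measurable_normal_pdf.
apply: ae_eq_integral => //; [exact: emeasurable_funM..|].
apply: ae_eqe_mul2l; apply: integral_ae_eq => //.
  exact: Radon_Nikodym_SigmaFinite.f_integrable.
by move=> E _ mE; rewrite -Radon_Nikodym_SigmaFinite.f_integral.
Qed.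

(* [expR_ge1Dx] applied to the ratio of the two densities. Integrating it bounds
   the second moment of [normal_pdf 0 s] above for t > s and below for t < s,
   and t -> s then yields its value. *)
Lemma normal_pdf_convex s t x : 0 < s -> 0 < t ->
  normal_pdf 0 s x * (1 + x ^+ 2 / 2 * ((s ^+ 2)^-1 - (t ^+ 2)^-1))
  <= t / s * normal_pdf 0 t x.
Proof.
move=> s0 t0; rewrite !normal_pdfE ?gt_eqF// /normal_fun !subr0.
have peak (r : K) : 0 < r -> normal_peak r = r^-1 * (Num.sqrt (pi *+ 2))^-1.
  move=> r0; rewrite /normal_peak -mulrnAr sqrtrM ?sqr_ge0// sqrtr_sqr.
  by rewrite gtr0_norm// invfM.
rewrite !peak//.
have c0 : 0 < (Num.sqrt (pi *+ 2) : K)^-1.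
  by rewrite invr_gt0 sqrtr_gt0 pmulrn_lgt0// pi_gt0.
rewrite [leRHS](_ : _ = s^-1 * (Num.sqrt (pi *+ 2))^-1 *
    expR (- x ^+ 2 / (t ^+ 2 *+ 2))); last first.
  by field; rewrite !gt_eqF// -invr_gt0.
rewrite -[leLHS]mulrA (ler_pM2l (mulr_gt0 _ c0)) ?invr_gt0//.
rewrite (_ : - x ^+ 2 / (t ^+ 2 *+ 2) = - x ^+ 2 / (s ^+ 2 *+ 2) +
    x ^+ 2 / 2 * ((s ^+ 2)^-1 - (t ^+ 2)^-1)); last first.
  by field; rewrite !gt_eqF.
by rewrite expRD ler_pM2l ?expR_gt0// expR_ge1Dx.
Qed.

Lemma integrable_sqr_normal_pdf s : 0 < s ->
  mu.-integrable setT (EFin \o (fun x => x ^+ 2 * normal_pdf 0 s x)).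
Proof.
move=> s0; have s20 : 0 < 2 * s by rewrite mulr_gt0.
have cc := normal_pdf_convex _ s0 s20.
have ss : 0 < s ^+ 2 by rewrite exprn_gt0.
(* With t = 2s, [normal_pdf_convex] gives 3/8 (x^2 / s^2) p <= 2 q for the two densities p and q,
   whence the constant 16 s^2 / 3. *)
apply: (@integrable_le _ _ _ mu _ (fun x => (16 * s ^+ 2 / 3) * normal_pdf 0 (2 * s) x)).
- apply: measurable_funM; last exact: measurable_normal_pdf.
  exact: measurable_funX.
- by apply: integrableZE; exact: integrable_normal_pdf.
- move=> x; rewrite ger0_norm; last first.
    by apply: mulr_ge0; [exact: sqr_ge0|exact: normal_pdf_ge0].
  have := cc x; have := normal_pdf_ge0 0 s x; have := normal_pdf_ge0 0 (2 * s) x.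
  move: (normal_pdf 0 s x) (normal_pdf 0 (2 * s) x) => p q q0 p0.
  rewrite (_ : 2 * s / s = 2); last by field; rewrite gt_eqF.
  rewrite (_ : x ^+ 2 / 2 * _ = (3 / 8) * (x ^+ 2 / s ^+ 2)); last first.
    by field; rewrite gt_eqF.
  rewrite mulrDr mulr1 => h.
  have : 3 / 8 * (x ^+ 2 / s ^+ 2 * p) <= 2 * q by lra.
  rewrite -(ler_pM2r ss) (_ : 3 / 8 * (x ^+ 2 / s ^+ 2 * p) * s ^+ 2 =
    3 / 8 * (x ^+ 2 * p)); last by field; rewrite gt_eqF.
  by move=> ?; lra.
Qed.

Lemma Rintegral_sqr_normal_pdf s : 0 < s ->
  \int[mu]_x (x ^+ 2 * normal_pdf 0 s x) = s ^+ 2.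
Proof.
move=> s0; pose v := \int[mu]_x (x ^+ 2 * normal_pdf 0 s x).
have ss : 0 < s ^+ 2 by rewrite exprn_gt0.
have one r : \int[mu]_x normal_pdf 0 r x = 1.
  by rewrite /Rintegral integral_normal_pdf.
(* The integrated convexity inequality, multiplied by 2 s^2 t^2. Both sides vanish at t = s;
   dividing by t - s from either side and letting t tend to s gives the two bounds on v. *)
have key t : 0 < t -> v * (t ^+ 2 - s ^+ 2) <= 2 * s * t ^+ 2 * (t - s).
  move=> t0; pose c := ((s ^+ 2)^-1 - (t ^+ 2)^-1) / 2.
  have ip1 : mu.-integrable setT (EFin \o normal_pdf 0 s).
    exact: integrable_normal_pdf.
  have ip2 : mu.-integrable setT (EFin \o (fun x => c * (x ^+ 2 * normal_pdf 0 s x))).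
    by apply: integrableZE; exact: integrable_sqr_normal_pdf.
  have : 1 + c * v <= t / s.
    have -> : 1 + c * v = \int[mu]_x
        (normal_pdf 0 s x + c * (x ^+ 2 * normal_pdf 0 s x)).
      by rewrite RintegralD// one RintegralZl//; exact: integrable_sqr_normal_pdf.
    have -> : t / s = \int[mu]_x (t / s * normal_pdf 0 t x).
      by rewrite RintegralZl// ?one ?mulr1//; exact: integrable_normal_pdf.
    apply: le_Rintegral => //.
    - exact: integrableDE.
    - by apply: integrableZE; exact: integrable_normal_pdf.
    - move=> x _; apply: le_trans (normal_pdf_convex x s0 t0).
      by rewrite /c le_eqVlt; apply/orP; left; apply/eqP; ring.
  have tt : 0 < t ^+ 2 by rewrite exprn_gt0.
  have m0 : 0 < 2 * s ^+ 2 * t ^+ 2 by rewrite !mulr_gt0.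
  rewrite -(ler_pM2r m0).
  rewrite (_ : (1 + c * v) * (2 * s ^+ 2 * t ^+ 2) =
    2 * s ^+ 2 * t ^+ 2 + v * (t ^+ 2 - s ^+ 2)); last first.
    by rewrite /c; field; rewrite !gt_eqF.
  rewrite (_ : t / s * (2 * s ^+ 2 * t ^+ 2) = 2 * s * t ^+ 2 * t); last first.
    by field; rewrite gt_eqF.
  by move=> ?; nra.
rewrite -/v; apply/eqP; rewrite eq_le; apply/andP; split; apply/ler_addgt0Pr.
(* For t = s (1 + h), division leaves v (2 + h) <= 2 s^2 (1 + h)^2, so v <= s^2 (1 + h)^2. As h <=
   1, 2h + h^2 <= 3h: this is the 3 in the choice of h. *)
- move=> e e0; pose h := Order.min 1 (e / (3 * s ^+ 2)).
  have h0 : 0 < h by rewrite lt_min ltr01/= divr_gt0// mulr_gt0.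
  have h1 : h <= 1 by rewrite ge_min lexx.
  have he : 3 * s ^+ 2 * h <= e.
    rewrite mulrC -ler_pdivlMr ?mulr_gt0//; by rewrite ge_min lexx orbT.
  have t0 : 0 < s * (1 + h) by rewrite mulr_gt0// addr_gt0.
  have := key _ t0.
  rewrite (_ : v * _ = s ^+ 2 * h * (v * (2 + h))); last by ring.
  rewrite (_ : 2 * s * _ * _ = s ^+ 2 * h * (2 * s ^+ 2 * (1 + h) ^+ 2)); last by ring.
  rewrite ler_pM2l ?mulr_gt0// => k.
  have v0 : 0 <= v.
    by apply: Rintegral_ge0 => x _; apply: mulr_ge0; [exact: sqr_ge0|exact: normal_pdf_ge0].
  have k2 : v <= s ^+ 2 * (1 + h) ^+ 2 by nra.
  apply: (le_trans k2); rewrite (_ : s ^+ 2 * (1 + h) ^+ 2 =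
    s ^+ 2 + s ^+ 2 * (2 * h + h * h)); last by ring.
  rewrite lerD2l; apply: le_trans he.
  have : 0 <= s ^+ 2 * (h * (1 - h)).
    by rewrite mulr_ge0 ?sqr_ge0// mulr_ge0 ?subr_ge0// ltW.
  by move=> ?; lra.
(* Now t = s (1 - h), positive because h <= 1/2; dividing by the negative t - s reverses the
   inequality and yields s^2 (1 - h)^2 <= v. *)
- move=> e e0; pose h := Order.min (1/2) (e / (2 * s ^+ 2)).
  have h0 : 0 < h by rewrite lt_min divr_gt0//= divr_gt0// mulr_gt0.
  have h1 : h <= 1/2 by rewrite ge_min lexx.
  have he : 2 * s ^+ 2 * h <= e.
    rewrite mulrC -ler_pdivlMr ?mulr_gt0//; by rewrite ge_min lexx orbT.
  have t0 : 0 < s * (1 - h) by rewrite mulr_gt0// subr_gt0; lra.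
  have := key _ t0.
  rewrite (_ : v * _ = - (s ^+ 2 * h * (v * (2 - h)))); last by ring.
  rewrite (_ : 2 * s * _ * _ = - (s ^+ 2 * h * (2 * s ^+ 2 * (1 - h) ^+ 2))); last by ring.
  rewrite lerN2 ler_pM2l ?mulr_gt0// => k.
  have v0 : 0 <= v.
    by apply: Rintegral_ge0 => x _; apply: mulr_ge0; [exact: sqr_ge0|exact: normal_pdf_ge0].
  have : s ^+ 2 * (1 - h) ^+ 2 <= v by nra.
  rewrite (_ : s ^+ 2 * (1 - h) ^+ 2 = s ^+ 2 - 2 * s ^+ 2 * h + s ^+ 2 * h ^+ 2); last by ring.
  have : 0 <= s ^+ 2 * h ^+ 2 by rewrite mulr_ge0 ?sqr_ge0.
  by move=> *; lra.
Qed.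

Lemma L2_normal_prob s : 0 < s -> L2 (normal_prob 0 s) (fun x : K => x).
Proof.
move=> s0; split => //; apply/integrableP; split.
  exact/measurable_EFinP/measurable_funX.
rewrite ge0_integral_normal_prob//; last first.
  by apply/measurable_EFinP; apply: measurableT_comp => //; exact: measurable_funX.
have /integrableP[_] := integrable_sqr_normal_pdf s0.
congr (_ < _)%E; apply: eq_integral => x _ /=.
by rewrite normrM [`|normal_pdf _ _ _|]ger0_norm ?normal_pdf_ge0.
Qed.

Lemma normal_prob_variance s : 0 < s ->
  \int[normal_prob 0 s]_x (x ^+ 2) = s ^+ 2.
Proof.
move=> s0; rewrite -[RHS]Rintegral_sqr_normal_pdf// /Rintegral.
rewrite ge0_integral_normal_prob//.
- exact/measurable_EFinP/measurable_funX.
- by move=> x; rewrite lee_fin sqr_ge0.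
Qed.

Lemma ge0_integral_oppr (g : K -> \bar K) : measurable_fun setT g ->
  (forall x, 0 <= g x)%E ->
  (\int[mu]_x g x = \int[mu]_x g (- x)%R)%E.
Proof.
move=> mg g0.
transitivity (\int[mu]_(x in (-%R : _ -> measurableTypeR K) @^-1` setT)
  (g \o -%R) x)%E; last by rewrite preimage_setT.
rewrite -ge0_integral_pushforward//=.
by apply: eq_measure_integral => A mA _; exact/esym/lebesgue_measureN.
Qed.

Lemma integrable_normal_prob s : 0 < s ->
  (normal_prob 0 s).-integrable setT (@EFin K).
Proof.
move=> s0; have l1 : L2 (normal_prob 0 s) (cst 1 : K -> K).
  split=> //; rewrite (_ : _ \o _ = cst 1%E); first exact: finite_measure_integrable_cst.
  by apply/funext => x /=; rewrite expr1n.
have := L2_mul (L2_normal_prob s0) l1.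
by congr (integrable _ _ _); apply/funext => x /=; rewrite mulr1.
Qed.

(** The density is even, so reflection exchanges the positive and negative parts of x; their
    integrals are equal, and finite by [integrable_normal_prob]. *)
Lemma normal_prob_mean s : 0 < s -> \int[normal_prob 0 s]_x x = 0.
Proof.
move=> s0; have iE := integrable_normal_prob s0.
have mE := measurable_int _ iE.
suff E : (\int[normal_prob 0%R s]_x (@EFin K)^\+ x =
          \int[normal_prob 0%R s]_x (@EFin K)^\- x)%E.
  rewrite /Rintegral integralE E subee//.
  exact: (integrable_fin_num measurableT (integrable_funeneg measurableT iE)).
rewrite !ge0_integral_normal_prob//; [|exact: measurable_funeneg|exact: measurable_funepos].
rewrite ge0_integral_oppr.
- apply: eq_integral => x _; rewrite funeposE funenegE EFinN.
  by congr (_ * _)%E; rewrite /normal_pdf gt_eqF// /normal_fun !subr0 sqrrN.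
- apply: emeasurable_funM; first exact: measurable_funepos.
  by apply/measurable_EFinP; exact: measurable_normal_pdf.
- by move=> x; rewrite mule_ge0// ?funepos_ge0// lee_fin normal_pdf_ge0.
Qed.

End normal_moments.

(** * Products and independence *)

Section product_integral.
Context {d1 d2 : measure_display} {U1 : measurableType d1} {U2 : measurableType d2}
  {K : realType}.
Variables (m1 : {sigma_finite_measure set U1 -> \bar K})
  (m2 : {sigma_finite_measure set U2 -> \bar K}).

Lemma integrable_tensor (f : U1 -> K) (g : U2 -> K) :
  m1.-integrable setT (EFin \o f) -> m2.-integrable setT (EFin \o g) ->
  (m1 \x m2)%E.-integrable setT (EFin \o (fun z => f z.1 * g z.2)).
Proof.
move=> /integrableP[mf if1] /integrableP[mg ig].
have mf' : measurable_fun setT f by exact/measurable_EFinP.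
have mg' : measurable_fun setT g by exact/measurable_EFinP.
apply/integrable12ltyP => /=.
  apply/measurable_EFinP; apply: measurable_funM.
    exact: measurableT_comp.
  exact: measurableT_comp.
under eq_integral => x _.
  under eq_integral => y _ do rewrite normrM EFinM.
  rewrite ge0_integralZl//; last first.
    by apply/measurable_EFinP; exact: measurableT_comp.
  over.
rewrite /= ge0_integralZr//; last 2 first.
- by apply/measurable_EFinP; exact: measurableT_comp.
- exact: integral_ge0.
rewrite lte_mul_pinfty// ?integral_ge0// ge0_fin_numE//.
exact: integral_ge0.
Qed.

Lemma Rintegral_tensor (f : U1 -> K) (g : U2 -> K) :
  m1.-integrable setT (EFin \o f) -> m2.-integrable setT (EFin \o g) ->
  \int[(m1 \x m2)%E]_z (f z.1 * g z.2) = \int[m1]_x f x * \int[m2]_y g y.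
Proof.
move=> iF ig; rewrite /Rintegral.
rewrite -(integral12_prod_meas1 (integrable_tensor iF ig)) /fubini_F.
have fg := integrable_fin_num measurableT ig.
under [X in fine X = _]eq_integral => x _.
  rewrite /=; under eq_integral do rewrite EFinM.
  rewrite integralZl// -(fineK fg).
  over.
by rewrite /= integralZr// fineM// integrable_fin_num.
Qed.

End product_integral.

Section independence.
Context {d : measure_display} {U : measurableType d} {K : realType}.
Variable Pr : probability U K.

(** Factorization over rectangles identifies the joint law of (X, Y) with the product of the two
    laws; the rest is Fubini for the function xy. *)
Lemma independent_mul (X Y : U -> K) :
  measurable_fun setT X -> measurable_fun setT Y ->
  (forall A B, measurable A -> measurable B ->
     Pr (X @^-1` A `&` Y @^-1` B) = (Pr (X @^-1` A) * Pr (Y @^-1` B))%E) ->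
  Pr.-integrable setT (EFin \o X) -> Pr.-integrable setT (EFin \o Y) ->
  Pr.-integrable setT (EFin \o (fun w => X w * Y w)) /\
  \int[Pr]_w (X w * Y w) = \int[Pr]_w X w * \int[Pr]_w Y w.
Proof.
move=> mX mY XY iX iY.
pose X' : {mfun U >-> K} := mfun_Sub (mem_set mX).
pose Y' : {mfun U >-> K} := mfun_Sub (mem_set mY).
pose PX := distribution Pr X'; pose PY := distribution Pr Y'.
have mXY : measurable_fun setT (fun w => (X w, Y w)) by exact: measurable_fun_pair.
pose XY' : {mfun U >-> (K * K)%type} := mfun_Sub (mem_set mXY).
pose PXY := distribution Pr XY'.
have PE A : measurable A -> (PX \x PY)%E A = PXY A.
  apply: product_measure_unique => A1 B1 mA1 mB1.
  exact: XY.
have mE : measurable_fun setT (fun z : K * K => (z.1 * z.2)%:E).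
  by apply/measurable_EFinP; exact: measurable_funM.
have int_prod (g : K * K -> \bar K) :
    (\int[PX \x PY]_z g z = \int[PXY]_z g z)%E.
  by apply: eq_measure_integral => A mA _; exact: PE.
have iPX : PX.-integrable setT (@EFin K).
  by apply: integrable_pushforward => //; exact: EFin_measurable.
have iPY : PY.-integrable setT (@EFin K).
  by apply: integrable_pushforward => //; exact: EFin_measurable.
have iprod := integrable_tensor iPX iPY.
have iXY : Pr.-integrable setT (EFin \o (fun w => X w * Y w)).
  apply/integrableP; split; first by apply/measurable_EFinP; exact: measurable_funM.
  have /integrableP[_] := iprod; rewrite int_prod ge0_integral_distribution//.
  exact: measurableT_comp.
split => //.
transitivity (\int[(PX \x PY)%E]_z (z.1 * z.2)).
  by rewrite /Rintegral int_prod integral_distribution.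
rewrite (Rintegral_tensor iPX iPY) /Rintegral !integral_distribution//;
  exact: EFin_measurable.
Qed.

End independence.

(** * Elementary Ito integrals *)

Section sigma_measurable_theory.
Context {K : realType} {Omega : pointedType} (G : set (set Omega)).
Implicit Types X Y : Omega -> K.

(** Turns measurability for a sub-sigma-algebra of Omega into plain measurability on another
    measurable type, where the closure lemmas for measurable functions apply. *)
Lemma sigma_measurableP X : sigma_measurable <<s G >> X <->
  measurable_fun (setT : set (g_sigma_algebraType G)) (X : g_sigma_algebraType G -> K).
Proof.
split => [mX _ B mB|mX B mB]; first by rewrite setTI; exact: mX.
by rewrite -[X @^-1` B]setTI; exact: mX.
Qed.

Lemma sigma_measurableM X Y : sigma_measurable <<s G >> X ->
  sigma_measurable <<s G >> Y -> sigma_measurable <<s G >> (fun w => X w * Y w).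
Proof.
by move=> /sigma_measurableP mX /sigma_measurableP mY; apply/sigma_measurableP;
  exact: measurable_funM.
Qed.

Lemma sigma_measurableB X Y : sigma_measurable <<s G >> X ->
  sigma_measurable <<s G >> Y -> sigma_measurable <<s G >> (fun w => X w - Y w).
Proof.
by move=> /sigma_measurableP mX /sigma_measurableP mY; apply/sigma_measurableP;
  exact: measurable_funB.
Qed.

Lemma sigma_measurable_cst (c : K) : sigma_measurable <<s G >> (fun=> c).
Proof. by apply/sigma_measurableP. Qed.

End sigma_measurable_theory.

Section brownian.
Context {K : realType} {d : measure_display} {Omega : measurableType d}.
Variables (Pr : probability Omega K) (W : K -> Omega -> K).
Local Notation F := (augmented_filtration Pr W).
Hypothesis W_bm : brownian_motion Pr F W.
Local Notation inc := (increment W).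
Local Notation L2 := (L2 Pr).
Local Notation ip := (ip Pr).
Implicit Types (a b c e r s t : K) (X Y Z xi eta : Omega -> K).

Lemma filtration_mono s t : s <= t -> F s `<=` F t.
Proof.
move=> st; apply: sub_sigma_algebra2 => E.
move=> [[r [B [/andP[r0 rs] mB ->]]]|nE]; last by right.
by left; exists r, B; split; rewrite ?r0 ?(le_trans rs).
Qed.

Lemma adapted_mono s t X : s <= t -> sigma_measurable (F s) X ->
  sigma_measurable (F t) X.
Proof. by move=> st mX B mB; apply: (filtration_mono st); exact: mX. Qed.

Lemma measurable_increment s t : 0 <= s -> s <= t -> measurable_fun setT (inc s t).
Proof.
move=> s0 st; have [mW _ _ _ _] := W_bm.
by apply: measurable_funB; apply mW; rewrite // (le_trans s0).
Qed.

Lemma adapted_increment s t : 0 <= s -> s <= t -> sigma_measurable (F t) (inc s t).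
Proof.
move=> s0 st; have [mW _ _ _ _] := W_bm.
apply: sigma_measurableB; first by apply mW; rewrite (le_trans s0).
by apply: (adapted_mono st); apply mW.
Qed.

Lemma increment_self s w : inc s s w = 0. Proof. exact: subrr. Qed.

Lemma increment_add r s t w : inc r t w = inc r s w + inc s t w.
Proof. by rewrite /increment; ring. Qed.

Lemma increment_law s t (g : K -> K) : 0 <= s -> s < t ->
  measurable_fun setT g -> (normal_prob 0 (Num.sqrt (t - s))).-integrable setT (EFin \o g) ->
  Pr.-integrable setT (EFin \o (fun w => g (inc s t w))) /\
  \int[Pr]_w g (inc s t w) = \int[normal_prob 0 (Num.sqrt (t - s))]_x g x.
Proof.
move=> s0 st mg /integrableP[mEg ig]; have mi := measurable_increment s0 (ltW st).
have [_ _ _ law _] := W_bm.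
pose I' : {mfun Omega >-> measurableTypeR K} := MeasurableFun.Pack
  (MeasurableFun.Class (isMeasurableFun.Build d _ Omega (measurableTypeR K) _ mi)).
have E (h : K -> \bar K) : (\int[distribution Pr I']_x h x =
    \int[normal_prob 0%R (Num.sqrt (t - s))%R]_x h x)%E.
  by apply: eq_measure_integral => A mA _; exact: law.
have ii : Pr.-integrable setT (EFin \o (fun w => g (inc s t w))).
  apply/integrableP; split.
    by apply/measurable_EFinP; exact: (measurableT_comp mg mi).
  move: ig; rewrite -E ge0_integral_distribution//.
  exact: measurableT_comp.
split => //; rewrite /Rintegral -E integral_distribution//.
Qed.

Lemma L2_increment s t : 0 <= s -> s <= t -> L2 (inc s t).
Proof.
move=> s0; rewrite le_eqVlt => /predU1P[<-|st].
  rewrite (_ : inc s s = fun=> 0); first exact: L2_0.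
  by apply/funext => w; rewrite increment_self.
split; first exact: measurable_increment (ltW st).
have d0 : 0 < Num.sqrt (t - s) by rewrite sqrtr_gt0 subr_gt0.
by have [] := increment_law s0 st _ (L2_normal_prob d0).2.
Qed.

Lemma increment_mean s t : 0 <= s -> s <= t -> \int[Pr]_w inc s t w = 0.
Proof.
move=> s0; rewrite le_eqVlt => /predU1P[<-|st].
  under eq_Rintegral do rewrite increment_self.
  by rewrite /Rintegral integral0.
have d0 : 0 < Num.sqrt (t - s) by rewrite sqrtr_gt0 subr_gt0.
have [|_ ->] := increment_law s0 st _ (integrable_normal_prob d0) => //.
exact: normal_prob_mean.
Qed.

Lemma increment_variance s t : 0 <= s -> s <= t ->
  \int[Pr]_w (inc s t w ^+ 2) = t - s.
Proof.
move=> s0; rewrite le_eqVlt => /predU1P[<-|st].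
  under eq_Rintegral do rewrite increment_self expr0n.
  by rewrite /Rintegral integral0 subrr.
have d0 : 0 < Num.sqrt (t - s) by rewrite sqrtr_gt0 subr_gt0.
have [|_ ->] := increment_law s0 st _ (L2_normal_prob d0).2.
  exact: measurable_funX.
by rewrite normal_prob_variance// sqr_sqrtr// subr_ge0 ltW.
Qed.

Lemma increment_independent s t Z (g : K -> K) : 0 <= s -> s <= t ->
  measurable_fun setT Z -> sigma_measurable (F s) Z ->
  Pr.-integrable setT (EFin \o Z) -> measurable_fun setT g ->
  Pr.-integrable setT (EFin \o (fun w => g (inc s t w))) ->
  Pr.-integrable setT (EFin \o (fun w => Z w * g (inc s t w))) /\
  \int[Pr]_w (Z w * g (inc s t w)) = \int[Pr]_w Z w * \int[Pr]_w g (inc s t w).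
Proof.
move=> s0 st mZ aZ iZ mg ig; apply: independent_mul => //.
  exact: (measurableT_comp mg (measurable_increment s0 st)).
move=> A B mA mB; have [_ _ _ _ ind] := W_bm.
rewrite (_ : (fun w => _) @^-1` B = inc s t @^-1` (g @^-1` B))//.
apply: ind => //; first exact: aZ.
by rewrite -[_ @^-1` B]setTI; exact: mg.
Qed.

End brownian.

Section bounded_factor.
Context {d : measure_display} {U : measurableType d} {K : realType}.

Lemma L2_bounded_mul (mu : {measure set U -> \bar K}) (M : K) (xi X : U -> K) :
  measurable_fun setT xi -> (forall w, `|xi w| <= M) -> L2 mu X ->
  L2 mu (fun w => xi w * X w).
Proof.
move=> mxi bxi [mX iX]; split; first exact: measurable_funM.
apply: (@integrable_le _ _ _ _ _ (fun w => M ^+ 2 * X w ^+ 2)).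
- by apply: measurable_funX; exact: measurable_funM.
- exact: integrableZE.
- move=> w; rewrite ger0_norm ?sqr_ge0// exprMn ler_wpM2r ?sqr_ge0//.
  by rewrite -[leLHS]real_normK ?num_real// lerXn2r ?nnegrE// (le_trans _ (bxi w)).
Qed.

Lemma L2_cst (mu : probability U K) (c : K) : L2 mu (cst c).
Proof.
split=> //; rewrite (_ : _ \o _ = cst (c ^+ 2)%:E)//.
exact: finite_measure_integrable_cst.
Qed.

Lemma L2_bounded (mu : probability U K) (M : K) (xi : U -> K) :
  measurable_fun setT xi -> (forall w, `|xi w| <= M) -> L2 mu xi.
Proof.
move=> mxi bxi; have := L2_bounded_mul mxi bxi (L2_cst mu 1).
by congr (L2 mu _); apply/funext => w; rewrite mulr1.
Qed.

Lemma L2_integrable (mu : probability U K) (X : U -> K) : L2 mu X ->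
  mu.-integrable setT (EFin \o X).
Proof.
move=> lX; have := L2_mul lX (L2_cst mu 1).
by congr (integrable _ _ _); apply/funext => w /=; rewrite mulr1.
Qed.

End bounded_factor.

Section elementary_integrals.
Context {K : realType} {d : measure_display} {Omega : measurableType d}.
Variables (Pr : probability Omega K) (W : K -> Omega -> K).
Local Notation F := (augmented_filtration Pr W).
Hypothesis W_bm : brownian_motion Pr F W.
Local Notation inc := (increment W).
Local Notation L2 := (L2 Pr).
Local Notation ip := (ip Pr).
Implicit Types (a b c e r s t : K) (X Y Z xi eta : Omega -> K).

(** The conditions that [simple_process] puts on a coefficient, detached from the subdivision. *)
Definition elementary a xi : Prop :=
  [/\ measurable_fun setT xi, sigma_measurable (F a) xi
    & exists M : K, forall w, `|xi w| <= M].

Lemma elementary_mono a b xi : a <= b -> elementary a xi -> elementary b xi.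
Proof. by move=> ab [mxi axi bxi]; split=> //; exact: (adapted_mono ab). Qed.

Lemma L2_elementary a xi : elementary a xi -> L2 xi.
Proof. by move=> [mxi _ [M bxi]]; exact: (L2_bounded _ mxi bxi). Qed.

Lemma L2_elementary_mul a xi X : elementary a xi -> L2 X ->
  L2 (fun w => xi w * X w).
Proof. by move=> [mxi _ [M bxi]]; exact: (L2_bounded_mul mxi bxi). Qed.

Lemma L2_elementary_increment a xi s t : elementary a xi -> 0 <= s -> s <= t ->
  L2 (fun w => xi w * inc s t w).
Proof. by move=> exi s0 st; apply: L2_elementary_mul exi _; exact: L2_increment. Qed.

(** Z xi is integrable and known at time s, while the increment is centered and independent of the
    past. *)
Lemma ip_future s t Z xi : 0 <= s -> s <= t -> L2 Z -> sigma_measurable (F s) Z ->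
  elementary s xi -> ip Z (fun w => xi w * inc s t w) = 0.
Proof.
move=> s0 st lZ aZ exi; have [mxi axi _] := exi.
have [|||||_] := @increment_independent _ _ _ _ _ W_bm s t
    (fun w => Z w * xi w) id s0 st.
- by apply: measurable_funM => //; exact: (L2_meas lZ).
- exact: sigma_measurableM.
- by apply: L2_mul => //; exact: L2_elementary exi.
- exact: measurable_id.
- exact: L2_integrable (L2_increment W_bm s0 st).
rewrite (increment_mean W_bm)// mulr0 => E; rewrite -[RHS]E.
by apply: eq_Rintegral => w _; rewrite mulrA.
Qed.

Lemma ip_same s t xi eta : 0 <= s -> s <= t -> elementary s xi -> elementary s eta ->
  ip (fun w => xi w * inc s t w) (fun w => eta w * inc s t w) = ip xi eta * (t - s).
Proof.
move=> s0 st exi eeta; have [mxi axi _] := exi; have [meta aeta _] := eeta.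
have [|||||_] := @increment_independent _ _ _ _ _ W_bm s t
    (fun w => xi w * eta w) (fun x => x ^+ 2) s0 st.
- exact: measurable_funM.
- exact: sigma_measurableM.
- by apply: L2_mul; [exact: L2_elementary exi|exact: L2_elementary eeta].
- exact: measurable_funX.
- by have [] := L2_increment W_bm s0 st.
rewrite (increment_variance W_bm)// => <-.
by apply: eq_Rintegral => w _; ring.
Qed.

Lemma adapted_elementary_increment a s t xi : elementary s xi -> 0 <= s ->
  s <= t -> sigma_measurable (F t) (fun w => xi w * inc s t w).
Proof.
move=> [_ axi _] s0 st; apply: sigma_measurableM; first exact: adapted_mono st axi.
exact: adapted_increment.
Qed.

(** The length of the intersection of ]a, b] and ]c, e], as [ip_indic] confirms. *)
Definition overlap a b c e : K := Order.max 0 (Order.min b e - Order.max a c).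

(** For a <= c < b, cut both intervals at c and at f = min(b, e). Only the common piece ]c, f] pairs
    with itself; the other products of a piece with a later one vanish by [ip_future]. *)
Lemma ip_elementary a b c e xi eta : 0 <= a -> a <= b -> 0 <= c -> c <= e ->
  elementary a xi -> elementary c eta ->
  ip (fun w => xi w * inc a b w) (fun w => eta w * inc c e w) =
  overlap a b c e * ip xi eta.
Proof.
wlog ac : a b c e xi eta / a <= c => [hwlog|].
  have [ac|/ltW ca] := leP a c; first exact: hwlog.
  move=> a0 ab c0 ce exi eeta.
  by rewrite ipC (ipC _ xi eta) /overlap (minC b) (maxC a); exact: hwlog.
move=> a0 ab c0 ce exi eeta; rewrite /overlap (max_r ac).
have [bc|/ltW cb] := leP b c.
  rewrite max_l; last by rewrite subr_le0 ge_min bc.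
  rewrite mul0r; apply: ip_future => //; first exact: L2_elementary_increment exi _ _.
  exact: adapted_mono bc (adapted_elementary_increment _ _ _ _).
pose f := Order.min b e.
have cf : c <= f by rewrite le_min cb.
have fb : f <= b by rewrite ge_min lexx.
have fe : f <= e by rewrite ge_min lexx orbT.
have f0 : 0 <= f by rewrite (le_trans c0).
rewrite -/f max_r ?subr_ge0//.
have exc := elementary_mono ac exi; have exf := elementary_mono cf exc.
have eef := elementary_mono cf eeta.
have L s t (x : Omega -> K) : elementary f x -> 0 <= s -> s <= t -> L2 (fun w => x w * inc s t w).
  exact: L2_elementary_increment.
rewrite (_ : (fun w => xi w * inc a b w) = (fun w => xi w * inc a c w +
  (xi w * inc c f w + xi w * inc f b w))); last first.
  by apply/funext => w; rewrite (increment_add _ a c b) (increment_add _ c f b); ring.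
rewrite ipDl//; [|by apply: L|by apply: L2D; apply: L|by apply: L].
rewrite ip_future//; [|exact: L|exact: adapted_elementary_increment].
rewrite add0r (_ : (fun w => eta w * inc c e w) = (fun w => eta w * inc c f w +
  eta w * inc f e w)); last first.
  by apply/funext => w; rewrite (increment_add _ c f e); ring.
rewrite ipDl ?ipDr//; try by [apply: L|apply: L2D; apply: L].
rewrite ip_same// (ip_future _ fe)//; [|exact: L|exact: adapted_elementary_increment].
rewrite [X in _ + (X + _)]ipC (ip_future _ fb)//; [|exact: L|exact: adapted_elementary_increment].
(* The remaining product is that of the pieces ]f, b] and ]f, e]: f is b or e, so one of the two
   increments is 0. *)
rewrite addr0 add0r [X in _ + X](_ : _ = 0) ?addr0 1?mulrC//.
rewrite /ip /Rintegral integral0_eq// => w _.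
rewrite /f; case: (leP b e) => [|/ltW] be; rewrite ?(min_l be) ?(min_r be) increment_self.
  by rewrite mulr0 mul0r.
by rewrite !mulr0.
Qed.

(** The part of the increment after r is orthogonal to Z. The outer [Order.max a] shrinks the
    interval to the point a when r < a. *)
Lemma ip_stopped a b r Z xi : 0 <= a -> a <= b -> 0 <= r ->
  L2 Z -> sigma_measurable (F r) Z -> elementary a xi ->
  ip Z (fun w => xi w * inc a b w) =
  ip Z (fun w => xi w * inc a (Order.max a (Order.min b r)) w).
Proof.
move=> a0 ab r0 lZ aZ exi.
have [ra|/ltW ar] := leP r a.
  rewrite max_l; last by rewrite ge_min ra orbT.
  have aZ' := adapted_mono ra aZ.
  by rewrite !ip_future.
have [br|/ltW rb] := leP b r; first by rewrite max_r.
rewrite max_r// (_ : (fun w => xi w * inc a b w) = (fun w => xi w * inc a r w +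
  xi w * inc r b w)); last first.
  by apply/funext => w; rewrite (increment_add _ a r b); ring.
rewrite ipDr//; [|exact: L2_elementary_increment exi _ _..].
rewrite (ip_future _ rb)//; first by rewrite addr0.
exact: elementary_mono ar exi.
Qed.

End elementary_integrals.

Section tensor.
Context {d1 d2 : measure_display} {U1 : measurableType d1} {U2 : measurableType d2}
  {K : realType}.
Variables (m1 : {sigma_finite_measure set U1 -> \bar K})
  (m2 : {sigma_finite_measure set U2 -> \bar K}).

Lemma L2_tensor (f : U1 -> K) (g : U2 -> K) : L2 m1 f -> L2 m2 g ->
  L2 (m1 \x m2)%E (fun z => f z.1 * g z.2).
Proof.
move=> [mf jf] [mg jg]; split.
  apply: measurable_funM; exact: measurableT_comp.
have := integrable_tensor jf jg.
by congr (integrable _ _ _); apply/funext => z /=; rewrite exprMn.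
Qed.

Lemma ip_tensor (f f' : U1 -> K) (g g' : U2 -> K) :
  L2 m1 f -> L2 m1 f' -> L2 m2 g -> L2 m2 g' ->
  ip (m1 \x m2)%E (fun z => f z.1 * g z.2) (fun z => f' z.1 * g' z.2) =
  ip m1 f f' * ip m2 g g'.
Proof.
move=> lf lf' lg lg'.
rewrite -(Rintegral_tensor (L2_mul lf lf') (L2_mul lg lg')).
by apply: eq_Rintegral => z _; ring.
Qed.

End tensor.

Section time_space.
Context {K : realType} {d : measure_display} {Omega : measurableType d}.
Variable (Pr : probability Omega K).
Local Notation mu := (@lebesgue_measure K).
Local Notation nu := (mu \x Pr)%E.
Implicit Types (a b c e r s t : K).

Lemma indic_itvM a b c e (u : K) :
  (\1_(`]a, b]) u * \1_(`]c, e]) u : K) =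
  \1_(`]Order.max a c, Order.min b e]%classic) u.
Proof.
rewrite !indicE -natrM mulnb; congr (_%:R); congr nat_of_bool.
rewrite !mem_setE !in_itv/= gt_max le_min.
by case: (a < u); case: (u <= b); case: (c < u); case: (u <= e).
Qed.

Lemma L2_indic a b : L2 mu (\1_(`]a, b]) : measurableTypeR K -> K).
Proof.
split; first exact: measurable_indic.
rewrite (_ : _ \o _ = EFin \o \1_(`]a, b])); last first.
  by apply/funext => u /=; rewrite expr2 indic_itvM max_l// min_l.
apply: integrable_indic_itv.
Qed.

Lemma ip_indic a b c e : ip mu (\1_(`]a, b]) : measurableTypeR K -> K) (\1_(`]c, e])) =
  overlap a b c e.
Proof.
rewrite /ip; under eq_Rintegral do rewrite indic_itvM.
rewrite /Rintegral integral_indic//= setIT lebesgue_measure_itv/= lte_fin /overlap.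
case: ltP => h; first by rewrite -EFinB [RHS]max_r// subr_ge0 ltW.
by rewrite [RHS]max_l// subr_le0.
Qed.

Definition on_itv a b (X : K -> Omega -> K) : measurableTypeR K * Omega -> K :=
  (fun z => X z.1 z.2) \_ (`[a, b] `*` setT).

Lemma on_itvE a b X (u : K) w : a <= u <= b -> on_itv a b X (u, w) = X u w.
Proof. by move=> uab; rewrite /on_itv patchE mem_set//=; split => //=; rewrite in_itv. Qed.

Lemma on_itv_out a b X (u : K) w : ~~ (a <= u <= b) -> on_itv a b X (u, w) = 0.
Proof.
move=> uab; rewrite /on_itv patchE memNset//= => -[/=]; rewrite in_itv/=.
by rewrite (negbTE uab).
Qed.

Lemma measurable_on_itv a b X :
  measurable_fun (`[a, b] `*` setT) (fun z : K * Omega => X z.1 z.2) ->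
  measurable_fun setT (on_itv a b X).
Proof.
move=> mX; apply/(measurable_restrictT _ _).1 => //.
exact: measurableX.
Qed.

Lemma L2_norm2E a b X :
  measurable_fun (`[a, b] `*` setT) (fun z : K * Omega => X z.1 z.2) ->
  L2_norm2 Pr a b X = (\int[nu]_z ((on_itv a b X z) ^+ 2)%:E)%E.
Proof.
move=> /measurable_on_itv mX; rewrite /L2_norm2 fubini_tonelli2//=.
- apply: eq_integral => w _; rewrite /fubini_G [LHS]integral_mkcond.
  apply: eq_integral => u _; rewrite patchE; case: ifPn => h.
    by rewrite on_itvE//; move: h; rewrite inE/= in_itv.
  by rewrite on_itv_out ?expr0n//; move: h; rewrite notin_setE/= in_itv => /negP.
- by apply/measurable_EFinP; exact: measurable_funX.
- by move=> z; rewrite lee_fin sqr_ge0.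
Qed.

Lemma L2_on_itv (F : K -> set (set Omega)) a b X : L2_process Pr F a b X ->
  L2 nu (on_itv a b X).
Proof.
move=> [mX _]; rewrite (L2_norm2E mX) => fX; have mX' := measurable_on_itv mX.
split => //; apply/integrableP; split.
  by apply/measurable_EFinP; exact: measurable_funX.
by under eq_integral do rewrite /= ger0_norm ?sqr_ge0//.
Qed.

End time_space.

(** * Isometry for finite sums of elementary integrals *)

Section elementary_families.
Context {K : realType} {d : measure_display} {Omega : measurableType d}.
Variables (Pr : probability Omega K) (W : K -> Omega -> K).
Local Notation F := (augmented_filtration Pr W).
Hypothesis W_bm : brownian_motion Pr F W.
Local Notation mu := (@lebesgue_measure K).
Local Notation nu := (mu \x Pr)%E.
Local Notation inc := (increment W).

Definition family (I : finType) (a b : I -> K) (xi : I -> Omega -> K) : Prop :=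
  forall i, [/\ 0 <= a i, a i <= b i & elementary Pr W (a i) (xi i)].

Definition family_fun (I : finType) (a b : I -> K) (xi : I -> Omega -> K)
    (z : measurableTypeR K * Omega) : K :=
  \sum_i \1_(`]a i, b i]) z.1 * xi i z.2.

Definition family_int (I : finType) (a b : I -> K) (xi : I -> Omega -> K)
    (w : Omega) : K :=
  \sum_i xi i w * inc (a i) (b i) w.

Section one_family.
Variables (I : finType) (a b : I -> K) (xi : I -> Omega -> K).
Hypothesis fam : family a b xi.

Lemma L2_family_fun : L2 nu (family_fun a b xi).
Proof.
apply: L2_sum => i; have [_ _ ex] := fam i.
by apply: L2_tensor; [exact: L2_indic|exact: L2_elementary ex].
Qed.

Lemma L2_family_int : L2 Pr (family_int a b xi).
Proof.
apply: L2_sum => i; have [a0 ab ex] := fam i.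
exact: L2_elementary_increment ex _ _.
Qed.

Lemma ip_family_stopped r Z : 0 <= r -> L2 Pr Z -> sigma_measurable (F r) Z ->
  ip Pr Z (family_int a b xi) =
  ip Pr Z (family_int a (fun i => Order.max (a i) (Order.min (b i) r)) xi).
Proof.
move=> r0 lZ aZ; rewrite !ip_sumr//.
- by apply: eq_bigr => i _; have [a0 ab ex] := fam i; exact: ip_stopped.
- move=> i; have [a0 ab ex] := fam i; apply: L2_elementary_increment ex _ _ => //.
  by rewrite le_max lexx.
- by move=> i; have [a0 ab ex] := fam i; exact: L2_elementary_increment ex _ _.
Qed.

Lemma family_stopped r : family a (fun i => Order.max (a i) (Order.min (b i) r)) xi.
Proof. by move=> i; have [a0 ab ex] := fam i; split=> //; rewrite le_max lexx. Qed.

Lemma family_fun_stopped r (u : K) w :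
  family_fun a (fun i => Order.max (a i) (Order.min (b i) r)) xi (u, w) =
  if u <= r then family_fun a b xi (u, w) else 0.
Proof.
case: ifP => ur; [apply: eq_bigr|apply: big1] => i _ /=.
  congr (_ * _); rewrite !indicE !mem_setE !in_itv/= le_max le_min ur andbT.
  by case: (ltP (a i) u).
rewrite indicE mem_setE in_itv/= le_max le_min ur andbF orbF.
by case: (ltP (a i) u) => //; rewrite mul0r.
Qed.

End one_family.

(** Both sides are bilinear, and on a pair of terms both equal the overlap of the intervals times
    the pairing of the coefficients. *)
Lemma ip_family (I I' : finType) (a b : I -> K) (a' b' : I' -> K) xi xi' :
  family a b xi -> family a' b' xi' ->
  ip Pr (family_int a b xi) (family_int a' b' xi') =
  ip nu (family_fun a b xi) (family_fun a' b' xi').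
Proof.
move=> fam fam'.
have l i : L2 Pr (fun w => xi i w * inc (a i) (b i) w).
  by have [a0 ab ex] := fam i; exact: L2_elementary_increment ex _ _.
have l' i : L2 Pr (fun w => xi' i w * inc (a' i) (b' i) w).
  by have [a0 ab ex] := fam' i; exact: L2_elementary_increment ex _ _.
have n i : L2 nu (fun z : measurableTypeR K * Omega => \1_(`]a i, b i]) z.1 * xi i z.2).
  have [_ _ ex] := fam i.
  by apply: L2_tensor; [exact: L2_indic|exact: L2_elementary ex].
have n' i : L2 nu (fun z : measurableTypeR K * Omega => \1_(`]a' i, b' i]) z.1 * xi' i z.2).
  have [_ _ ex] := fam' i.
  by apply: L2_tensor; [exact: L2_indic|exact: L2_elementary ex].
rewrite !ip_suml//; [|exact: L2_family_fun|exact: L2_family_int].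
apply: eq_bigr => i _; rewrite !ip_sumr//; apply: eq_bigr => j _.
have [a0 ab ex] := fam i; have [a0' ab' ex'] := fam' j.
rewrite ip_elementary// (@ip_tensor _ _ _ _ _ mu Pr) ?ip_indic//.
- exact: L2_indic.
- exact: L2_indic.
- exact: L2_elementary ex.
- exact: L2_elementary ex'.
Qed.

End elementary_families.

Section simple_processes.
Context {K : realType} {d : measure_display} {Omega : measurableType d}.
Variables (Pr : probability Omega K) (W : K -> Omega -> K).
Local Notation F := (augmented_filtration Pr W).
Hypothesis W_bm : brownian_motion Pr F W.
Local Notation nu := (@lebesgue_measure K \x Pr)%E.
Variables (a b : K).
Hypothesis a0 : 0 <= a.
Variable H : step_process K Omega.
Hypothesis sH : simple_process F a b H.

Local Notation pa := (fun i : 'I_(step_size H) => step_pt H i).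
Local Notation pb := (fun i : 'I_(step_size H) => step_pt H i.+1).
Local Notation xi := (fun i : 'I_(step_size H) => step_val H i).

Lemma simple_pt i : (i <= step_size H)%N -> a <= step_pt H i <= b.
Proof.
have [p0 pN pS _] := sH; move=> iN; apply/andP; split.
  elim: i iN => [|i IH] iN; first by rewrite p0.
  by apply: le_trans (pS _ iN); apply: IH; exact: ltnW.
(* The upper bound goes by backward induction, on the distance from i to the last index. *)
have := leq_subr i (step_size H); rewrite -{2}(subKn iN).
elim: (step_size H - i)%N => [|j IH] jN; first by rewrite subn0 pN.
apply: le_trans (IH (ltnW jN)).
by rewrite -[in leRHS](subnSK jN) pS// (subnSK jN) leq_subr.
Qed.

Lemma simple_family : family Pr W pa pb xi.
Proof.
move=> i; have [_ _ pS vS] := sH; have [mv av bv] := vS i (ltn_ord i).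
split; [|exact: pS|by split].
by have /andP[+ _] := simple_pt (ltnW (ltn_ord i)); exact: le_trans.
Qed.

Lemma step_funE u w : family_fun pa pb xi (u, w) = step_fun H u w.
Proof.
rewrite /step_fun big_mkcond; apply: eq_bigr => i _ /=.
rewrite indicE mem_setE in_itv/=.
by case: ifP => _; rewrite ?mul1r ?mul0r.
Qed.

Lemma step_fun_out u w : ~~ (a <= u <= b) -> step_fun H u w = 0.
Proof.
move=> uab; rewrite /step_fun big1// => i /andP[ua ub]; case/negP: uab.
have /andP[+ _] := simple_pt (ltnW (ltn_ord i)).
have /andP[_ +] := simple_pt (ltn_ord i).
by move=> h1 h2; rewrite (le_trans h2 (ltW ua)) (le_trans ub).
Qed.

End simple_processes.

(** * Isometry and martingale property of the Ito integral *)

Section ito.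
Context {K : realType} {d : measure_display} {Omega : measurableType d}.
Variables (Pr : probability Omega K) (W : K -> Omega -> K).
Local Notation F := (augmented_filtration Pr W).
Hypothesis W_bm : brownian_motion Pr F W.
Local Notation mu := (@lebesgue_measure K).
Local Notation nu := (mu \x Pr)%E.
Implicit Types (a b c e r s t : K).

(* Families of overlapping intervals instead of subdivisions, so that stopping
   an approximation at a fixed time gives again an approximation. *)
Record approx a b (X : K -> Omega -> K) (J : Omega -> K) := Approx {
  ap_I : nat -> finType ;
  ap_a : forall k, ap_I k -> K ;
  ap_b : forall k, ap_I k -> K ;
  ap_xi : forall k, ap_I k -> Omega -> K ;
  ap_family : forall k, family Pr W (@ap_a k) (@ap_b k) (@ap_xi k) ;
  ap_fun : ip nu
     (fun z => family_fun (@ap_a k) (@ap_b k) (@ap_xi k) z - on_itv a b X z)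
     (fun z => family_fun (@ap_a k) (@ap_b k) (@ap_xi k) z - on_itv a b X z)
     @[k --> \oo] --> (0 : K) ;
  ap_int : ip Pr
     (fun w => family_int W (@ap_a k) (@ap_b k) (@ap_xi k) w - J w)
     (fun w => family_int W (@ap_a k) (@ap_b k) (@ap_xi k) w - J w)
     @[k --> \oo] --> (0 : K) }.

Arguments ap_I {a b X J}.
Arguments ap_a {a b X J}.
Arguments ap_b {a b X J}.
Arguments ap_xi {a b X J}.
Arguments ap_family {a b X J}.
Arguments ap_fun {a b X J}.
Arguments ap_int {a b X J}.

Lemma ito_approx a b X J : 0 <= a -> ito_integral Pr F W a b X J ->
  [/\ L2 nu (on_itv a b X), L2 Pr J & inhabited (approx a b X J)].
Proof.
move=> a0 [pX mJ [H [sH cX cJ]]]; have lX := L2_on_itv pX.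
have fam k := simple_family a0 (sH k).
have lI k := L2_family_int W_bm (fam k).
have lf k := L2_family_fun (fam k).
have lJ : L2 Pr J.
  have /fine_cvgP[[k _ /(_ k (leqnn k)) hk] _] := cJ.
  by apply: L2_close (lI k) mJ _; move: hk; rewrite fin_numElt => /andP[].
split => //; split.
apply: (@Approx _ _ _ _ _ _ _ _ fam).
- have E k : L2_norm2 Pr a b (fun u w => step_fun (H k) u w - X u w) =
    (ip nu (fun z => family_fun (fun i : 'I_(step_size (H k)) => step_pt (H k) i)
        (fun i => step_pt (H k) i.+1) (fun i => step_val (H k) i) z - on_itv a b X z)
     (fun z => family_fun (fun i : 'I_(step_size (H k)) => step_pt (H k) i)
        (fun i => step_pt (H k) i.+1) (fun i => step_val (H k) i) z - on_itv a b X z))%:E.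
    have EE : on_itv a b (fun u w => step_fun (H k) u w - X u w) =
       (fun z => family_fun (fun i : 'I_(step_size (H k)) => step_pt (H k) i)
        (fun i => step_pt (H k) i.+1) (fun i => step_val (H k) i) z - on_itv a b X z).
      apply/funext => -[u w]; rewrite step_funE.
      have [uab|uab] := boolP (a <= u <= b); first by rewrite !on_itvE.
      by rewrite !on_itv_out// (step_fun_out (sH k)) ?subr0.
    rewrite L2_norm2E.
      by rewrite EE integral_L2//; exact: L2B.
    apply/(measurable_restrictT _ _).2; first exact: measurableX.
    by rewrite -/(on_itv a b (fun u w => step_fun (H k) u w - X u w)) EE;
      exact: L2_meas (L2B (lf k) lX).
  by have /fine_cvgP[_] := cX; rewrite (funext E).
- have E k : (\int[Pr]_w ((step_integral W (H k) w - J w) ^+ 2)%:E)%E =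
    (ip Pr (fun w => step_integral W (H k) w - J w)
       (fun w => step_integral W (H k) w - J w))%:E.
    by rewrite integral_L2//; exact: (L2B (lI k) lJ).
  by have /fine_cvgP[_] := cJ; rewrite (funext E).
Qed.

(** [ip_cvg] passes to the limit on both sides of [ip_family]. The polarized form is the one needed,
    since different entries of the solution are multiplied. *)
Lemma ito_isometry a b a' b' X X' J J' : 0 <= a -> 0 <= a' ->
  ito_integral Pr F W a b X J -> ito_integral Pr F W a' b' X' J' ->
  ip Pr J J' = ip nu (on_itv a b X) (on_itv a' b' X').
Proof.
move=> a0 a0' /(ito_approx a0)[lX lJ [p]] /(ito_approx a0')[lX' lJ' [p']].
have c1 := ip_cvg (fun k => L2_family_int W_bm (ap_family p k))
  (fun k => L2_family_int W_bm (ap_family p' k)) lJ lJ' (ap_int p) (ap_int p').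
have c2 := ip_cvg (fun k => L2_family_fun (ap_family p k))
  (fun k => L2_family_fun (ap_family p' k)) lX lX' (ap_fun p) (ap_fun p').
apply: (cvg_unique _ c1); first exact: norm_hausdorff.
apply: cvg_trans c2; apply: near_eq_cvg; apply: nearW => k.
by rewrite (ip_family W_bm (ap_family p k) (ap_family p' k)).
Qed.

(* The approximations of the integral over [a, s], stopped at r, approximate the
   integral over [a, r]. *)
Lemma ito_martingale a r s X Z J J' : 0 <= a -> a <= r -> r <= s ->
  ito_integral Pr F W a s X J -> ito_integral Pr F W a r X J' ->
  L2 Pr Z -> sigma_measurable (F r) Z -> ip Pr Z J = ip Pr Z J'.
Proof.
move=> a0 ar rs /(ito_approx a0)[lX lJ [p]] /(ito_approx a0)[lX' lJ' [p']] lZ aZ.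
have r0 : 0 <= r by exact: le_trans ar.
pose b k i := Order.max (ap_a p k i) (Order.min (ap_b p k i) r).
have fam k := family_stopped (ap_family p k) r : family Pr W (ap_a p k) (b k) (ap_xi p k).
have lI k := L2_family_int W_bm (ap_family p k).
have lI' k := L2_family_int W_bm (ap_family p' k).
have lIr k := L2_family_int W_bm (fam k).
have lf k := L2_family_fun (ap_family p k).
have lf' k := L2_family_fun (ap_family p' k).
have lfr k := L2_family_fun (fam k).
pose e k w := family_int W (ap_a p k) (b k) (ap_xi p k) w -
  family_int W (ap_a p' k) (ap_b p' k) (ap_xi p' k) w.
have le k : L2 Pr (e k) by exact: L2B.
have crf : ip nu
     (fun z => family_fun (ap_a p k) (b k) (ap_xi p k) z - on_itv a r X z)
     (fun z => family_fun (ap_a p k) (b k) (ap_xi p k) z - on_itv a r X z)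
     @[k --> \oo] --> (0 : K).
  apply: (squeeze_cvgr _ (cvg_cst 0) (ap_fun p)); apply: nearW => k.
  rewrite ip_ge0/=; apply: le_Rintegral => //.
  - by apply: L2_mul; exact: L2B.
  - by apply: L2_mul; exact: L2B.
  - move=> [u w] _; rewrite family_fun_stopped; case: ifPn => ur.
      rewrite (_ : on_itv a r X (u, w) = on_itv a s X (u, w))//.
      have [au|au] := boolP (a <= u).
        by rewrite !on_itvE// au ?ur ?(le_trans ur).
      by rewrite !on_itv_out// (negbTE au).
    by rewrite on_itv_out ?(negbTE ur) ?andbF// subr0 mulr0 -expr2 sqr_ge0.
(* By the isometry the squared norm of [e k] is a combination of pairings of the two integrands. All
   of these tend to the squared norm of X on [a, r], with coefficients that add up to 0. *)
have ce : ip Pr (fun w => e k w - 0) (fun w => e k w - 0) @[k --> \oo] --> (0 : K).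
  have c1 := ip_cvg lfr lfr lX' lX' crf crf.
  have c2 := ip_cvg lfr lf' lX' lX' crf (ap_fun p').
  have c3 := ip_cvg lf' lf' lX' lX' (ap_fun p') (ap_fun p').
  have h := cvgD (cvgB c1 c2) (cvgB c3 c2); rewrite subrr addr0 in h.
  set f := fun k => _.
  rewrite (_ : f = fun k => ip (mu \x Pr)%E
      (family_fun (ap_a p k) (b k) (ap_xi p k)) (family_fun (ap_a p k) (b k) (ap_xi p k)) -
    ip (mu \x Pr)%E (family_fun (ap_a p k) (b k) (ap_xi p k))
      (family_fun (ap_a p' k) (ap_b p' k) (ap_xi p' k)) +
    (ip (mu \x Pr)%E (family_fun (ap_a p' k) (ap_b p' k) (ap_xi p' k))
      (family_fun (ap_a p' k) (ap_b p' k) (ap_xi p' k)) -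
    ip (mu \x Pr)%E (family_fun (ap_a p k) (b k) (ap_xi p k))
      (family_fun (ap_a p' k) (ap_b p' k) (ap_xi p' k)))); first exact: h.
  apply/funext => k; rewrite /f.
  under [X in ip _ X _]eq_fun do rewrite subr0.
  under [X in ip _ _ X]eq_fun do rewrite subr0.
  have fp := ap_family p' k.
  rewrite -(ip_family W_bm (fam k) (fam k)) -(ip_family W_bm (fam k) fp).
  rewrite -(ip_family W_bm fp fp).
  rewrite /e !ipBl ?ipBr//; try by solve_L2.
  rewrite [X in _ - _ - (X - _)]ipC.
  ring.
have cZ : ip Pr Z (e k) @[k --> \oo] --> (0 : K).
  have cc : ip Pr (fun w => Z w - Z w) (fun w => Z w - Z w) @[k --> \oo] --> (0 : K).
    rewrite (_ : ip _ _ _ = 0); first exact: cvg_cst.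
    by rewrite /ip /Rintegral integral0_eq// => w _; rewrite subrr mulr0.
  have := ip_cvg (fun=> lZ) le lZ (L2_0 Pr) cc ce.
  by rewrite (_ : ip Pr Z (fun=> 0) = 0)// /ip /Rintegral integral0_eq// => w _; rewrite mulr0.
have cc : ip Pr (fun w => Z w - Z w) (fun w => Z w - Z w) @[k --> \oo] --> (0 : K).
  rewrite (_ : ip _ _ _ = 0); first exact: cvg_cst.
  by rewrite /ip /Rintegral integral0_eq// => w _; rewrite subrr mulr0.
have c1 := ip_cvg (fun=> lZ) lI lZ lJ cc (ap_int p).
have c2 := ip_cvg (fun=> lZ) lI' lZ lJ' cc (ap_int p').
apply/eqP; rewrite -subr_eq0; apply/eqP.
apply: (cvg_unique _ (cvgB c1 c2)); first exact: norm_hausdorff.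
apply: cvg_trans cZ; apply: near_eq_cvg; apply: nearW => k /=.
by rewrite fctE (ip_family_stopped W_bm (ap_family p k) r0)// /e ipBr.
Qed.

End ito.

(** * Fubini theorems *)

Section real_fubini.
Context {d1 d2 : measure_display} {U1 : measurableType d1} {U2 : measurableType d2}
  {K : realType}.
Variables (m1 : {sigma_finite_measure set U1 -> \bar K})
  (m2 : {sigma_finite_measure set U2 -> \bar K}).
Variable g : U1 * U2 -> K.
Hypothesis ig : (m1 \x m2)%E.-integrable setT (EFin \o g).

(** An integrable extended-real function is finite almost everywhere, so the default value of [fine]
    at infinity matters only on a null set. *)
Let fineE d (U : measurableType d) (m : {measure set U -> \bar K}) (F : U -> \bar K) :
  m.-integrable setT F -> m.-integrable setT (EFin \o (fine \o F)) /\
  \int[m]_x fine (F x) = fine (\int[m]_x F x).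
Proof.
move=> iF; have mF := measurable_int _ iF.
have mfF : measurable_fun setT (EFin \o (fine \o F)).
  by apply/measurable_EFinP; exact: measurableT_comp.
split.
  apply: (le_integrable _ _ _ iF) => // x _ /=.
  by case: (F x) => [r| |] //=; rewrite ?normr0 ?leey.
congr fine; apply: ae_eq_integral => //.
have := integrable_ae measurableT iF; apply: filterS => x /= h xT.
by rewrite fineK// h.
Qed.

Lemma Rintegrable_inner1 : m1.-integrable setT (EFin \o (fun x => \int[m2]_y g (x, y))).
Proof. by have [] := fineE (integrable_fubini_F ig). Qed.

Lemma Rintegral12 : \int[m1]_x \int[m2]_y g (x, y) = \int[(m1 \x m2)%E]_z g z.
Proof.
have [_] := fineE (integrable_fubini_F ig).
by rewrite (integral12_prod_meas1 ig).
Qed.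

Let integrable_G : m2.-integrable setT (fubini_G m1 (EFin \o g)).
Proof.
apply/integrableP; split; first exact: measurable_fubini_G ig.
have mg := measurable_int _ ig.
apply: le_lt_trans ((integrable21ltyP _ _ mg).1 ig).
apply: ge0_le_integral => //.
- by apply: measurableT_comp => //; exact: measurable_fubini_G ig.
- apply: (measurable_fun_fubini_tonelli_G (abse \o (EFin \o g))) => //=.
  by apply: measurableT_comp => //; exact: mg.
- move=> y _; apply: le_abse_integral => //.
  exact: (measurableT_comp mg (pair2_measurable y)).
Qed.

Lemma Rintegrable_inner2 : m2.-integrable setT (EFin \o (fun y => \int[m1]_x g (x, y))).
Proof. by have [] := fineE integrable_G. Qed.

Lemma Rintegral21 : \int[m2]_y \int[m1]_x g (x, y) = \int[(m1 \x m2)%E]_z g z.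
Proof.
have [_] := fineE integrable_G.
by rewrite (integral21_prod_meas1 ig).
Qed.

End real_fubini.

(* [m1 \x m2] itself has no canonical sigma-finite structure: its key is taken
   by the instance for products of subprobabilities. *)
Section sigma_finite_product.
Context {d1 d2 : measure_display} {T1 : measurableType d1}
  {T2 : measurableType d2} {K : realType}.
Variables (m1 : {sigma_finite_measure set T1 -> \bar K})
  (m2 : {sigma_finite_measure set T2 -> \bar K}).

Definition sprod : set (T1 * T2) -> \bar K := (m1 \x m2)%E.

HB.instance Definition _ := Measure.copy sprod (m1 \x m2)%E.

Lemma sprod_sigma_finite : sigma_finite setT sprod.
Proof.
have /sigma_finiteP[F [TF ndF Foo]] := sigma_finiteT m1.
have /sigma_finiteP[G [TG ndG Goo]] := sigma_finiteT m2.
exists (fun n => F n `*` G n) => [|k].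
  apply/seteqP; split => [[x y] _|//].
  have [n _ Fnx] : (\bigcup_n F n) x by rewrite -TF.
  have [k _ Gky] : (\bigcup_n G n) y by rewrite -TG.
  exists (maxn n k) => //; split => /=.
    exact: (subsetPset _ _ (ndF _ _ (leq_maxl n k))).
  exact: (subsetPset _ _ (ndG _ _ (leq_maxr n k))).
have [mF Fk] := Foo k; have [mG Gk] := Goo k.
split; first exact: measurableX.
by rewrite /sprod product_measure1E// lte_mul_pinfty// ge0_fin_numE.
Qed.

HB.instance Definition _ := Measure_isSigmaFinite.Build _ _ _ sprod sprod_sigma_finite.

End sigma_finite_product.

Section triple_product.
Context {d1 d2 d3 : measure_display} {T1 : measurableType d1}
  {T2 : measurableType d2} {T3 : measurableType d3} {K : realType}.
Variables (m1 : {sigma_finite_measure set T1 -> \bar K})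
  (m2 : {sigma_finite_measure set T2 -> \bar K})
  (m3 : {sigma_finite_measure set T3 -> \bar K}).

Lemma integrable_triple (F : T1 * T2 * T3 -> K) (phi : T1 -> \bar K) (psi : T2 -> \bar K) :
  measurable_fun setT F -> (forall z, 0 <= F z) ->
  measurable_fun setT phi -> measurable_fun setT psi ->
  (forall x, 0 <= phi x)%E -> (forall y, 0 <= psi y)%E ->
  (forall x y, \int[m3]_w (F (x, y, w))%:E = phi x * psi y)%E ->
  (\int[m1]_x phi x < +oo)%E -> (\int[m2]_y psi y < +oo)%E ->
  (sprod m1 m2 \x m3)%E.-integrable setT (EFin \o F).
Proof.
move=> mF F0 mphi mpsi phi0 psi0 E fphi fpsi.
have mEF : measurable_fun setT (EFin \o F) by exact/measurable_EFinP.
have EF0 z : (0 <= (EFin \o F) z)%E by rewrite lee_fin.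
apply/integrableP; split; first exact: mEF.
rewrite (eq_integral (EFin \o F)); last first.
  by move=> z _ /=; rewrite ger0_norm.
rewrite (fubini_tonelli1 (EFin \o F) mEF EF0).
rewrite -[integral _ _ _]/(\int[(m1 \x m2)%E]_z fubini_F m3 (EFin \o F) z)%E.
rewrite (eq_integral (fun z => phi z.1 * psi z.2)%E); last first.
  by move=> [x y] _; rewrite /fubini_F/= E.
rewrite (fubini_tonelli1 (fun z => phi z.1 * psi z.2)%E); last 2 first.
- by apply: emeasurable_funM; exact: measurableT_comp.
- by move=> z; rewrite mule_ge0.
rewrite /fubini_F/=; under eq_integral do rewrite ge0_integralZl//.
rewrite ge0_integralZr//; last exact: integral_ge0.
by rewrite lte_mul_pinfty// ?integral_ge0// ge0_fin_numE ?integral_ge0.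
Qed.

Variables (f : T1 * T3 -> K) (g : T2 * T3 -> K) (p : T1 -> K) (q : T2 -> K).
Hypotheses (lf : L2 (m1 \x m3)%E f) (lg : L2 (m2 \x m3)%E g).
Hypotheses (lp : L2 m1 p) (lq : L2 m2 q).
Hypotheses (pf : forall x w, f (x, w) = p x * f (x, w)).
Hypotheses (qg : forall y w, g (y, w) = q y * g (y, w)).

Let sqfin d (T : measurableType d) (m : {measure set T -> \bar K}) h : L2 m h ->
  (\int[m]_x (h x ^+ 2)%:E < +oo)%E.
Proof.
move=> [_ /integrableP[_]]; congr (_ < _)%E; apply: eq_integral => x _ /=.
by rewrite ger0_norm ?sqr_ge0.
Qed.

(* By [pf] and [qg] the integrand is (f q) (g p), and |(f q) (g p)| is at most
   f^2 q^2 + g^2 p^2, which is integrable for the triple product; p and q will be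
   indicator functions of bounded intervals. *)
Lemma integrable_kernel3 : (m1 \x m2)%E.-integrable setT
  (EFin \o (fun z => \int[m3]_w (f (z.1, w) * g (z.2, w)))).
Proof.
have [mf _] := lf; have [mg _] := lg; have [mp _] := lp; have [mq _] := lq.
have mz1 : measurable_fun setT (fun z : T1 * T2 * T3 => z.1.1).
  exact: measurableT_comp.
have mz2 : measurable_fun setT (fun z : T1 * T2 * T3 => z.1.2).
  exact: measurableT_comp.
have mf1 : measurable_fun setT (fun z : T1 * T2 * T3 => f (z.1.1, z.2)).
  by apply: (measurableT_comp mf); exact: measurable_fun_pair.
have mg1 : measurable_fun setT (fun z : T1 * T2 * T3 => g (z.1.2, z.2)).
  by apply: (measurableT_comp mg); exact: measurable_fun_pair.
have mp1 : measurable_fun setT (fun z : T1 * T2 * T3 => p z.1.1).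
  exact: (measurableT_comp mp).
have mq1 : measurable_fun setT (fun z : T1 * T2 * T3 => q z.1.2).
  exact: (measurableT_comp mq).
have i1 : (sprod m1 m2 \x m3)%E.-integrable setT
    (EFin \o (fun z => f (z.1.1, z.2) ^+ 2 * q z.1.2 ^+ 2)).
  apply: (@integrable_triple _ (fun x => \int[m3]_w (f (x, w) ^+ 2)%:E)%E
    (fun y => (q y ^+ 2)%:E)).
  - by apply: measurable_funM; exact: measurable_funX.
  - by move=> z; rewrite mulr_ge0 ?sqr_ge0.
  - apply: (measurable_fun_fubini_tonelli_F (fun z => (f z ^+ 2)%:E)).
      by apply/measurable_EFinP; exact: measurable_funX.
    by move=> z; rewrite lee_fin sqr_ge0.
  - by apply/measurable_EFinP; exact: measurable_funX.
  - by move=> x; apply: integral_ge0 => w _; rewrite lee_fin sqr_ge0.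
  - by move=> y; rewrite lee_fin sqr_ge0.
  - move=> x y; under eq_integral do rewrite /= EFinM.
    rewrite ge0_integralZr//.
    + by apply/measurable_EFinP/measurable_funX/(measurableT_comp mf).
    + by move=> w _; rewrite lee_fin sqr_ge0.
    + by rewrite lee_fin sqr_ge0.
  - have := sqfin lf; rewrite fubini_tonelli1//.
      by apply/measurable_EFinP; exact: measurable_funX.
    by move=> z; rewrite lee_fin sqr_ge0.
  - exact: sqfin lq.
have i2 : (sprod m1 m2 \x m3)%E.-integrable setT
    (EFin \o (fun z => g (z.1.2, z.2) ^+ 2 * p z.1.1 ^+ 2)).
  apply: (@integrable_triple _ (fun x => (p x ^+ 2)%:E)
    (fun y => \int[m3]_w (g (y, w) ^+ 2)%:E)%E).
  - by apply: measurable_funM; exact: measurable_funX.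
  - by move=> z; rewrite mulr_ge0 ?sqr_ge0.
  - by apply/measurable_EFinP; exact: measurable_funX.
  - apply: (measurable_fun_fubini_tonelli_F (fun z => (g z ^+ 2)%:E)).
      by apply/measurable_EFinP; exact: measurable_funX.
    by move=> z; rewrite lee_fin sqr_ge0.
  - by move=> y; rewrite lee_fin sqr_ge0.
  - by move=> x; apply: integral_ge0 => w _; rewrite lee_fin sqr_ge0.
  - move=> x y; under eq_integral do rewrite /= mulrC EFinM.
    rewrite ge0_integralZl//.
    + by apply/measurable_EFinP/measurable_funX/(measurableT_comp mg).
    + by move=> w _; rewrite lee_fin sqr_ge0.
    + by rewrite lee_fin sqr_ge0.
  - exact: sqfin lp.
  - have := sqfin lg; rewrite fubini_tonelli1//.
      by apply/measurable_EFinP; exact: measurable_funX.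
    by move=> z; rewrite lee_fin sqr_ge0.
have ik : (sprod m1 m2 \x m3)%E.-integrable setT
    (EFin \o (fun z => f (z.1.1, z.2) * g (z.1.2, z.2))).
  apply: (@integrable_le _ _ _ _ _ (fun z => f (z.1.1, z.2) ^+ 2 * q z.1.2 ^+ 2 +
    g (z.1.2, z.2) ^+ 2 * p z.1.1 ^+ 2)).
  - exact: measurable_funM.
  - exact: integrableDE.
  move=> [[u v] w] /=; rewrite -!exprMn [f (u, w) in leLHS]pf [g (v, w) in leLHS]qg.
  move: (f (u, w)) (g (v, w)) (p u) (q v) => a b x y.
  rewrite (_ : x * a * (y * b) = (a * y) * (b * x)); last by ring.
  by move: (a * y) (b * x) => r s; rewrite ler_norml; apply/andP; split; nra.
exact: (Rintegrable_inner1 ik).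
Qed.

End triple_product.

(** * Time integrals of square-integrable processes *)

Section time_fubini.
Context {K : realType} {d : measure_display} {Omega : measurableType d}.
Variable (Pr : probability Omega K).
Local Notation mu := (@lebesgue_measure K).
Local Notation nu := (mu \x Pr)%E.
Implicit Types (a b c e r s t : K) (f g : measurableTypeR K * Omega -> K).

(** Time has infinite measure, so square integrability yields integrability only with a bounded time
    support; [bsuppE] provides the indicator of [a, b] as the second L2 factor. *)
Definition bsupp a b f := forall (u : K) w, ~~ (a <= u <= b) -> f (u, w) = 0.

Definition tint f (w : Omega) : K := \int[mu]_u f (u, w).

Lemma L2_indic_itv a b : L2 mu (\1_`[a, b] : measurableTypeR K -> K).
Proof.
split; first exact: measurable_indic.
rewrite (_ : _ \o _ = EFin \o \1_`[a, b]); first exact: integrable_indic_itv.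
by apply/funext => u /=; rewrite indicE; case: (_ \in _); rewrite ?expr1n ?expr0n.
Qed.

Lemma ip_indic_itv a b : a <= b ->
  ip mu (\1_`[a, b] : measurableTypeR K -> K) (\1_`[a, b]) = b - a.
Proof.
move=> ab; rewrite /ip.
under eq_Rintegral => u _.
  rewrite (_ : _ * _ = \1_`[a, b] u); last first.
    by rewrite indicE; case: (_ \in _); rewrite ?mulr1 ?mulr0.
  over.
rewrite /Rintegral integral_indic//= setIT lebesgue_measure_itv/= lte_fin.
case: ltP => // ba; apply/esym/eqP; rewrite subr_eq0 eq_le.
by rewrite ab ba.
Qed.

Lemma bsuppE a b f : bsupp a b f ->
  forall u w, f (u, w) = \1_`[a, b] u * f (u, w).
Proof.
move=> sf u w; rewrite indicE mem_setE in_itv/=.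
by case: (boolP (a <= u <= b)) => [_|/sf ->]; rewrite /= ?mul1r ?mulr0.
Qed.

Section one_process.
Variables (a b : K) (f : measurableTypeR K * Omega -> K).
Hypotheses (ab : a <= b) (sf : bsupp a b f) (lf : L2 nu f).

Lemma integrable_mulZ Z : L2 Pr Z ->
  nu.-integrable setT (EFin \o (fun z => f z * Z z.2)).
Proof.
move=> lZ; have := L2_mul lf (L2_tensor (L2_indic_itv a b) lZ).
congr (integrable _ _ _); apply/funext => -[u w] /=.
by rewrite mulrCA mulrA -(bsuppE sf).
Qed.

Lemma integrable_process : nu.-integrable setT (EFin \o f).
Proof.
have := integrable_mulZ (L2_cst Pr 1).
by congr (integrable _ _ _); apply/funext => z /=; rewrite mulr1.
Qed.

Lemma section_ae : {ae Pr, forall w, L2 mu (fun u : measurableTypeR K => f (u, w))}.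
Proof.
have [mf jf] := lf; apply: filterS (ae_integrable2 jf) => w h; split => //.
exact: (measurableT_comp mf (pair2_measurable w)).
Qed.

Lemma measurable_tint : measurable_fun setT (tint f).
Proof.
apply/measurable_EFinP; apply: (@measurable_int _ _ _ Pr).
exact: (Rintegrable_inner2 integrable_process).
Qed.

(** Cauchy-Schwarz in time against the indicator of [a, b] gives ([tint f])^2 <= (b - a) times the
    time integral of f^2, for almost every w because sections are square integrable only almost
    surely. *)
Lemma L2_tint : L2 Pr (tint f).
Proof.
split; first exact: measurable_tint.
have [mf jf] := lf.
have iS := integrableZE (b - a) (Rintegrable_inner2 jf).
have mt2 : measurable_fun setT (EFin \o (fun w => tint f w ^+ 2)).
  by apply/measurable_EFinP/measurable_funX; exact: measurable_tint.
have /integrableP[mS fS] := iS.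
apply/integrableP; split; first exact: mt2.
apply: le_lt_trans fS; apply: ae_ge0_le_integral; [by []|by []| |by []| |].
- exact: (measurableT_comp (@abse_measurable K setT) mt2).
- exact: (measurableT_comp (@abse_measurable K setT) mS).
apply: filterS section_ae => w lw _ /=; rewrite lee_fin ger0_norm ?sqr_ge0//.
have E : tint f w = ip mu (\1_`[a, b] : measurableTypeR K -> K) (fun u => f (u, w)).
  by apply: eq_Rintegral => u _; rewrite -(bsuppE sf).
apply: le_trans (ler_norm _).
rewrite E -(ip_indic_itv ab); apply: le_trans (ip_CauchySchwarz _ _) _ => //.
exact: L2_indic_itv.
Qed.

Lemma integrable_ip_section Z : L2 Pr Z ->
  mu.-integrable setT (EFin \o (fun u => ip Pr Z (fun w => f (u, w)))).
Proof.
move=> lZ; have := Rintegrable_inner1 (integrable_mulZ lZ).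
congr (integrable _ _ _); apply/funext => u /=; congr (_%:E).
by rewrite ipC.
Qed.

Lemma ip_tint Z : L2 Pr Z ->
  ip Pr Z (tint f) = \int[mu]_u ip Pr Z (fun w => f (u, w)).
Proof.
move=> lZ; have iZ := integrable_mulZ lZ.
transitivity (\int[Pr]_w \int[mu]_u (f (u, w) * Z w)).
  have mZ := L2_meas lZ; congr fine; apply: ae_eq_integral => //.
  - apply/measurable_EFinP/measurable_funM => //; exact: measurable_tint.
  - exact: measurable_int (Rintegrable_inner2 iZ).
  have [mf jf] := lf.
  apply: filterS (ae_integrable2 integrable_process) => w iw _ /=.
  by rewrite RintegralZr// mulrC.
rewrite (Rintegral21 iZ) -(Rintegral12 iZ).
by apply: eq_Rintegral => u _; rewrite ipC.
Qed.

End one_process.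

Section two_processes.
Variables (a b : K) (f g : measurableTypeR K * Omega -> K).
Hypotheses (sf : bsupp a b f) (lf : L2 nu f).
Hypotheses (sg : bsupp a b g) (lg : L2 nu g).

(** Allows [triangle_fubini] to be applied to the expected product of two drift integrals. *)
Lemma integrable_kernel : (mu \x mu)%E.-integrable setT
  (EFin \o (fun z => ip Pr (fun w => f (z.1, w)) (fun w => g (z.2, w)))).
Proof.
exact: (integrable_kernel3 lf lg (L2_indic_itv a b) (L2_indic_itv a b)
  (bsuppE sf) (bsuppE sg)).
Qed.

End two_processes.

Lemma measurable_le2 : measurable [set z : measurableTypeR K * measurableTypeR K | z.1 <= z.2].
Proof.
have mB : measurable_fun setT (fun z : measurableTypeR K * measurableTypeR K => z.2 - z.1).
  by apply: measurable_funB.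
rewrite (_ : mkset _ = setT `&` (fun z : measurableTypeR K * measurableTypeR K =>
  z.2 - z.1) @^-1` `[0, +oo[%classic); first exact: mB.
by apply/seteqP; split => z /=; rewrite in_itv/= andbT subr_ge0 => h; [split|case: h].
Qed.

(** The square is the union of the closed triangles u <= v and v <= u, which meet in the diagonal, a
    null set because its sections have at most one point. The second triangle is integrated in the
    opposite order, so that in both terms the inner time is the later one. *)
Lemma triangle_fubini a b (k : measurableTypeR K * measurableTypeR K -> K) :
  (mu \x mu)%E.-integrable setT (EFin \o k) ->
  \int[mu]_(u in `[a, b]) \int[mu]_(v in `[a, b]) k (u, v) =
  \int[mu]_(u in `[a, b]) \int[mu]_(v in `[u, b]) k (u, v) +
  \int[mu]_(v in `[a, b]) \int[mu]_(u in `[v, b]) k (u, v).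
Proof.
move=> ik; pose V := (measurableTypeR K * measurableTypeR K)%type.
have mk : measurable_fun setT k by apply/measurable_EFinP; exact: measurable_int ik.
pose Q : set V := `[a, b] `*` `[a, b].
pose D1 : set V := Q `&` [set z | z.1 <= z.2].
pose D2 : set V := Q `&` [set z | z.2 <= z.1].
pose D3 : set V := D1 `&` D2.
have mQ : measurable Q by exact: measurableX.
have mD1 : measurable D1 by apply: measurableI => //; exact: measurable_le2.
have mD2 : measurable D2.
  apply: measurableI => //.
  rewrite (_ : mkset _ = setT `&` (fun z : V => (z.2, z.1)) @^-1` [set z : V | z.1 <= z.2]).
    have /measurable_fun_pairP : measurable_fun setT (fun z : V => (z.2, z.1)).
      exact: measurable_fun_pair.
    by move=> _; apply: (measurable_fun_pair (@measurable_snd _ _ _ _) (@measurable_fst _ _ _ _)) => //;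
      exact: measurable_le2.
  by rewrite setTI.
have mD3 : measurable D3 by exact: measurableI.
have ikD D : measurable D -> (mu \x mu)%E.-integrable setT (EFin \o (k \_ D)).
  move=> mD; apply: (@integrable_le _ _ _ _ _ (fun z => `|k z|)).
  - exact/(measurable_restrictT _ _).1/measurable_funTS.
  - by apply: (integrable_abse ik).
  - by move=> z; rewrite patchE; case: ifP => // _; rewrite normr0.
have inQ u v : ((u, v) \in Q) = (a <= u <= b) && (a <= v <= b).
  apply/idP/idP => [/set_mem[/=]|/andP[h1 h2]]; first by rewrite !in_itv/= => -> ->.
  by apply/mem_set; split => /=; rewrite in_itv.
have inD1 u v : ((u, v) \in D1) = (a <= u <= b) && (u <= v <= b).
  rewrite in_setI inQ mem_setE -andbA; case: (boolP (a <= u <= b)) => //= /andP[au ub].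
  rewrite [X in _ && X](_ : _ = (u <= v))//; case: (leP u v) => uv; rewrite ?andbF//.
  by rewrite andbT (le_trans au uv).
have inD2 u v : ((u, v) \in D2) = (a <= v <= b) && (v <= u <= b).
  rewrite in_setI inQ mem_setE (andbC (a <= u <= b)) -andbA.
  case: (boolP (a <= v <= b)) => //= /andP[av vb].
  rewrite [X in _ && X](_ : _ = (v <= u))//; case: (leP v u) => vu; rewrite ?andbF//.
  by rewrite andbT (le_trans av vu).
have inD3 u v : ((u, v) \in D3) = ((u, v) \in D1) && ((u, v) \in D2) by exact: in_setI.
have inI x y (z : K) : (z \in (`[x, y]%classic : set K)) = (x <= z <= y).
  by rewrite mem_setE in_itv.
have E0 : \int[(mu \x mu)%E]_z (k \_ Q) z =
    \int[mu]_(u in `[a, b]) \int[mu]_(v in `[a, b]) k (u, v).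
  rewrite -(Rintegral12 (ikD _ mQ)) [RHS]Rintegral_mkcond.
  apply: eq_Rintegral => u _; rewrite patchE inI; case: ifPn => hu.
    rewrite [RHS]Rintegral_mkcond; apply: eq_Rintegral => v _; rewrite !patchE.
    by rewrite inQ hu inI.
  by rewrite /Rintegral integral0_eq// => v _; rewrite patchE inQ (negbTE hu).
have E1 : \int[(mu \x mu)%E]_z (k \_ D1) z =
    \int[mu]_(u in `[a, b]) \int[mu]_(v in `[u, b]) k (u, v).
  rewrite -(Rintegral12 (ikD _ mD1)) [RHS]Rintegral_mkcond.
  apply: eq_Rintegral => u _; rewrite patchE inI; case: ifPn => hu.
    rewrite [RHS]Rintegral_mkcond; apply: eq_Rintegral => v _; rewrite !patchE.
    by rewrite inD1 hu inI.
  by rewrite /Rintegral integral0_eq// => v _; rewrite patchE inD1 (negbTE hu).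
have E2 : \int[(mu \x mu)%E]_z (k \_ D2) z =
    \int[mu]_(v in `[a, b]) \int[mu]_(u in `[v, b]) k (u, v).
  rewrite -(Rintegral21 (ikD _ mD2)) [RHS]Rintegral_mkcond.
  apply: eq_Rintegral => v _; rewrite patchE inI; case: ifPn => hv.
    rewrite [RHS]Rintegral_mkcond; apply: eq_Rintegral => u _; rewrite !patchE.
    by rewrite inD2 hv inI.
  by rewrite /Rintegral integral0_eq// => u _; rewrite patchE inD2 (negbTE hv).
have E3 : \int[(mu \x mu)%E]_z (k \_ D3) z = 0.
  rewrite -(Rintegral12 (ikD _ mD3)) /Rintegral integral0_eq// => u _.
  congr EFin; rewrite -[RHS](Rintegral_set1 (fun v : K => if (a <= u <= b)%R then k (u, v) else 0%R) u).
  rewrite [RHS]Rintegral_mkcond; apply: eq_Rintegral => v _; rewrite !patchE in_setI inD1 inD2.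
  have -> : (v \in [set u]) = (v == u).
    by apply/idP/eqP => [/set_mem//|->]; exact/mem_set.
  case: eqVneq => [->|vu].
    by case: (boolP (a <= u <= b)) => [/andP[au ub]|_]; rewrite ?lexx ?ub.
  case: ifP => // /andP[/andP[_ /andP[uv _]] /andP[_ /andP[vu' _]]].
  by case/eqP: vu; apply/eqP; rewrite eq_le uv vu'.
rewrite -E0 -E1 -E2 -RintegralD//; [|exact: ikD..].
rewrite -[LHS]addr0 -E3 -RintegralD//; [|exact: ikD..].
apply: eq_Rintegral => -[u v] _; rewrite !patchE inQ inD3 inD1 inD2.
case: (boolP (a <= u <= b)) => /= hu; case: (boolP (a <= v <= b)) => /= hv; rewrite ?andbF ?addr0//.
- have [/andP[au ub] /andP[av vb]] := (hu, hv); rewrite ub vb !andbT.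
  by case: (ltgtP u v) => _; rewrite /= ?addr0 ?add0r.
- case: ifP => [/andP[uv vb]|]; rewrite ?addr0//.
  by case/andP: hu => au _; rewrite (le_trans au uv) vb in hv.
- case: ifP => [/andP[vu ub]|]; rewrite ?addr0//.
  by case/andP: hv => av _; rewrite (le_trans av vu) ub in hu.
Qed.

End time_fubini.

Section on_itv_theory.
Context {K : realType} {d : measure_display} {Omega : measurableType d}.
Variable (Pr : probability Omega K).
Local Notation mu := (@lebesgue_measure K).
Local Notation nu := (mu \x Pr)%E.
Implicit Types (a b c e r s t : K).

Lemma bsupp_on_itv a b (X : K -> Omega -> K) : bsupp a b (on_itv a b X).
Proof. by move=> u w; exact: on_itv_out. Qed.

Lemma on_itv_sub a b t T (X : K -> Omega -> K) : t <= a -> b <= T ->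
  on_itv a b X = (fun z => \1_`[a, b] z.1 * on_itv t T X z).
Proof.
move=> ta bT; apply/funext => -[u w] /=; rewrite indicE mem_setE in_itv/=.
case: (boolP (a <= u <= b)) => [/andP[au ub]|h]; last by rewrite on_itv_out// mul0r.
by rewrite !on_itvE ?mul1r// ?au ?ub// (le_trans ta au) (le_trans ub bT).
Qed.

Lemma L2_on_itv_sub a b t T (X : K -> Omega -> K) : t <= a -> b <= T ->
  L2 nu (on_itv t T X) -> L2 nu (on_itv a b X).
Proof.
move=> ta bT lX; rewrite (on_itv_sub _ ta bT).
apply: (@L2_bounded_mul _ _ _ _ 1 (fun z : measurableTypeR K * Omega => \1_`[a, b] z.1)) => //.
  have mi : measurable_fun setT (\1_`[a, b] : measurableTypeR K -> K).
    exact: measurable_indic.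
  exact: (measurableT_comp mi).
by move=> z; rewrite indicE; case: (_ \in _); rewrite ?normr1 ?normr0.
Qed.

Lemma L2_on_itv_mul a b (al : K -> K) (M : K) (X : K -> Omega -> K) :
  measurable_fun setT al -> (forall u, `|al u| <= M) ->
  L2 nu (on_itv a b X) -> L2 nu (on_itv a b (fun u w => al u * X u w)).
Proof.
move=> mal bal lX.
rewrite (_ : on_itv a b _ = fun z => al z.1 * on_itv a b X z).
  apply: (@L2_bounded_mul _ _ _ _ M (fun z : measurableTypeR K * Omega => al z.1)) => //.
  have mal' : measurable_fun setT (al : measurableTypeR K -> K) := mal.
  exact: (measurableT_comp mal').
apply/funext => -[u w]; case: (boolP (a <= u <= b)) => h.
  by rewrite !on_itvE.
by rewrite !on_itv_out// mulr0.
Qed.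

Lemma on_itv_sum (I : Type) (r : seq I) a b (X : I -> K -> Omega -> K) :
  on_itv a b (fun u w => \sum_(i <- r) X i u w) =
  (fun z => \sum_(i <- r) on_itv a b (X i) z).
Proof.
apply/funext => -[u w]; case: (boolP (a <= u <= b)) => h.
  by rewrite on_itvE//; apply: eq_bigr => i _; rewrite on_itvE.
by rewrite on_itv_out// big1// => i _; rewrite on_itv_out.
Qed.

Lemma tint_on_itv a b (X : K -> Omega -> K) w :
  tint (on_itv a b X) w = \int[mu]_(u in `[a, b]) X u w.
Proof.
rewrite /tint [RHS]Rintegral_mkcond; apply: eq_Rintegral => u _.
rewrite patchE mem_setE in_itv/=; case: ifPn => h; first by rewrite on_itvE.
by rewrite on_itv_out.
Qed.

Lemma Rintegral_ip_on_itv a b Z (X : K -> Omega -> K) :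
  \int[mu]_u ip Pr Z (fun w => on_itv a b X (u, w)) =
  \int[mu]_(u in `[a, b]) ip Pr Z (X u).
Proof.
rewrite [RHS]Rintegral_mkcond; apply: eq_Rintegral => u _.
rewrite patchE mem_setE in_itv/=; case: ifPn => h.
  by congr ip; apply/funext => w; rewrite on_itvE.
rewrite /ip /Rintegral integral0_eq// => w _.
by rewrite on_itv_out// mulr0.
Qed.

Lemma ip_on_itv a b (X Y : K -> Omega -> K) :
  L2 nu (on_itv a b X) -> L2 nu (on_itv a b Y) ->
  ip nu (on_itv a b X) (on_itv a b Y) = \int[mu]_(u in `[a, b]) ip Pr (X u) (Y u) /\
  mu.-integrable `[a, b] (EFin \o (fun u => ip Pr (X u) (Y u))).
Proof.
move=> lX lY; have iXY := L2_mul lX lY.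
have E u : \int[Pr]_w (on_itv a b X (u, w) * on_itv a b Y (u, w)) =
    ((fun u => ip Pr (X u) (Y u)) \_ `[a, b]) u.
  rewrite patchE mem_setE in_itv/=; case: ifPn => h.
    by apply: eq_Rintegral => w _; rewrite !on_itvE.
  by rewrite /Rintegral integral0_eq// => w _; rewrite on_itv_out// mul0r.
split.
  rewrite [LHS]/ip -(Rintegral12 iXY) [RHS]Rintegral_mkcond.
  by apply: eq_Rintegral => u _; exact: E.
apply/integrable_mkcond => //.
have := Rintegrable_inner1 iXY; congr (integrable _ _ _).
by apply/funext => u /=; rewrite E !patchE; case: ifP.
Qed.

Lemma integrable_ip_on_itv a b Z (X : K -> Omega -> K) :
  L2 nu (on_itv a b X) -> L2 Pr Z ->
  mu.-integrable `[a, b] (EFin \o (fun u => ip Pr Z (X u))).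
Proof.
move=> lX lZ; apply/integrable_mkcond => //.
have := integrable_ip_section (@bsupp_on_itv a b X) lX lZ; congr (integrable _ _ _).
apply/funext => u /=; rewrite patchE mem_setE in_itv/=; case: ifPn => h.
  by congr (_%:E); congr ip; apply/funext => w; rewrite on_itvE.
rewrite /ip /Rintegral integral0_eq// => w _.
by rewrite on_itv_out// mulr0.
Qed.

End on_itv_theory.

(** * Second moments of linear stochastic differential equations *)

(** Arranged so that no martingale part is paired with a drift: the cross terms contain whole
    solutions, and those are what conditioning can evaluate. *)
Lemma ip_decomp {d : measure_display} {U : measurableType d} {K : realType}
    (mu : {measure set U -> \bar K}) (X J Y J' : U -> K) :
  L2 mu X -> L2 mu J -> L2 mu Y -> L2 mu J' ->
  ip mu (fun w => X w + J w) (fun w => Y w + J' w) =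
  ip mu J J' + ip mu (fun w => X w + J w) Y + ip mu X (fun w => Y w + J' w) - ip mu X Y.
Proof. by move=> lX lJ lY lJ'; rewrite !ipDl ?ipDr//; try solve_L2; ring. Qed.

Lemma integrable_sumE {d : measure_display} {U : measurableType d} {K : realType}
    (mu : {measure set U -> \bar K}) (D : set U) (I : finType) (f : I -> U -> K) :
  measurable D -> (forall i, mu.-integrable D (EFin \o f i)) ->
  mu.-integrable D (EFin \o (fun v => \sum_i f i v)).
Proof.
move=> mD jf.
rewrite (_ : _ \o _ = (fun v => \sum_i (EFin \o f i) v)%E).
  by apply: integrable_sum => // i _; exact: jf.
by apply/funext => v /=; rewrite -sumEFin.
Qed.

Section linear_sde.
Context {K : realType} {d : measure_display} {Omega : measurableType d}.
Variables (Pr : probability Omega K) (W : K -> Omega -> K).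
Local Notation F := (augmented_filtration Pr W).
Hypothesis W_bm : brownian_motion Pr F W.
Local Notation mu := (@lebesgue_measure K).
Local Notation nu := (mu \x Pr)%E.
Variables (t T : K) (t0 : 0 <= t) (n : nat).
Implicit Types (r s u v : K).

Definition bounded_coef (A : K -> 'M[K]_n) : Prop :=
  (forall k c, measurable_fun setT (fun u => A u k c)) /\
  exists M : K, forall u k c, `|A u k c| <= M.

(** The equation of one column of a matrix solution, in scalar components and with deterministic
    initial value. *)
Definition vector_sde (A C : K -> 'M[K]_n) (X : 'I_n -> K -> Omega -> K)
    (x : 'I_n -> K) : Prop :=
  (forall k, L2_process Pr F t T (X k)) /\
  forall s, t <= s <= T -> exists J : 'I_n -> Omega -> K,
    (forall k, ito_integral Pr F W t s (fun r w => \sum_c C r k c * X c r w) (J k)) /\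
    (forall k, {ae Pr, forall w, X k s w =
      x k + \int[mu]_(r in `[t, s]) (\sum_c A r k c * X c r w) + J k w}).

Variables (A C : K -> 'M[K]_n).
Hypotheses (bA : bounded_coef A) (bC : bounded_coef C).

Section one_solution.
Variables (X : 'I_n -> K -> Omega -> K) (x : 'I_n -> K).
Hypothesis sX : vector_sde A C X x.

Definition drift k s := on_itv t s (fun r w => \sum_c A r k c * X c r w).

Lemma L2_sol k s : s <= T -> L2 nu (on_itv t s (X k)).
Proof.
by move=> sT; apply: (L2_on_itv_sub (lexx t) sT); have [pX _] := sX;
  exact: L2_on_itv (pX k).
Qed.

Lemma L2_coef (D : K -> 'M[K]_n) k s : bounded_coef D -> s <= T ->
  L2 nu (on_itv t s (fun r w => \sum_c D r k c * X c r w)).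
Proof.
move=> [mD [M bD]] sT; rewrite on_itv_sum; apply: L2_sum => c.
apply: (@L2_on_itv_mul _ _ _ _ _ _ (fun r => D r k c) M (X c)) => //.
exact: L2_sol.
Qed.

Lemma L2_drift k s : s <= T -> L2 nu (drift k s).
Proof. exact: L2_coef. Qed.

Lemma measurable_sol k s : t <= s <= T -> measurable_fun setT (X k s).
Proof.
move=> /andP[ts sT]; have [mX _] := L2_sol k (lexx T).
have := measurableT_comp mX (pair1_measurable (s : measurableTypeR K)).
by congr measurable_fun; apply/funext => w /=; rewrite on_itvE// ts sT.
Qed.

Lemma L2_pos_ito s J k : t <= s -> (forall k, ito_integral Pr F W t s
  (fun r w => \sum_c C r k c * X c r w) (J k)) -> L2 Pr (J k).
Proof. by move=> ts iJ; have [] := ito_approx W_bm t0 (iJ k). Qed.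

Lemma L2_decomp s J k : t <= s <= T -> (forall k, ito_integral Pr F W t s
  (fun r w => \sum_c C r k c * X c r w) (J k)) ->
  L2 Pr (fun w => x k + tint (drift k s) w + J k w).
Proof.
move=> /andP[ts sT] iJ; apply: L2D; last exact: L2_pos_ito iJ.
apply: L2D; first exact: L2_cst.
by apply: L2_tint; [exact: ts|exact: bsupp_on_itv|exact: L2_drift].
Qed.

(** The equation holds almost surely at each fixed s, so it is recorded through pairings, which do
    not see null sets. It also makes X square integrable at every s, whereas [L2_process] gives this
    only for almost every s. *)
Lemma sol_decomp s : t <= s <= T -> exists J : 'I_n -> Omega -> K,
  [/\ forall k, ito_integral Pr F W t s (fun r w => \sum_c C r k c * X c r w) (J k),
    forall k, L2 Pr (X k s)
  & forall k Z, L2 Pr Z -> ip Pr (X k s) Z =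
      ip Pr (fun w => x k + tint (drift k s) w + J k w) Z].
Proof.
move=> ts; have [_ /(_ s ts)[J [iJ eJ]]] := sX; exists J.
have eJ' k : {ae Pr, forall w, x k + tint (drift k s) w + J k w = X k s w}.
  by apply: filterS (eJ k) => w ->; rewrite tint_on_itv.
have lX k : L2 Pr (X k s).
  exact: L2_ae (L2_decomp k ts iJ) (measurable_sol k ts) (eJ' k).
split=> // k Z lZ; apply/esym; apply: ip_ae => //; last exact: L2_meas lZ.
  exact: L2_meas (L2_decomp k ts iJ).
exact: L2_meas (lX k).
Qed.

Lemma L2_sol_at k s : t <= s <= T -> L2 Pr (X k s).
Proof. by move=> /sol_decomp[J []]. Qed.

Lemma ip_coef_sum (D : K -> 'M[K]_n) k v Z : t <= v <= T -> L2 Pr Z ->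
  ip Pr Z (fun w => \sum_c D v k c * X c v w) = \sum_c D v k c * ip Pr Z (X c v).
Proof.
move=> tv lZ; rewrite ip_sumr// => [|c].
  by apply: eq_bigr => c _; rewrite ipZr//; exact: L2_sol_at.
by apply: L2Z; exact: L2_sol_at.
Qed.

Lemma ip_tint_drift k s Z : t <= s <= T -> L2 Pr Z ->
  ip Pr Z (tint (drift k s)) = \int[mu]_(v in `[t, s]) \sum_c A v k c * ip Pr Z (X c v).
Proof.
move=> /andP[ts sT] lZ.
rewrite (ip_tint (@bsupp_on_itv _ _ _ _ _ _) (L2_drift k sT) lZ) Rintegral_ip_on_itv.
apply: eq_Rintegral => v; rewrite inE/= in_itv/= => /andP[tv vs].
by rewrite ip_coef_sum// tv (le_trans vs).
Qed.

Lemma integrable_ip_coef k s Z : t <= s <= T -> L2 Pr Z ->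
  mu.-integrable `[t, s] (EFin \o (fun v => \sum_c A v k c * ip Pr Z (X c v))).
Proof.
move=> /andP[ts sT] lZ.
apply: eq_integrable (integrable_ip_on_itv (L2_drift k sT) lZ) => //.
move=> v; rewrite inE/= in_itv/= => /andP[tv vs].
by rewrite ip_coef_sum// tv (le_trans vs).
Qed.

(** By [ito_martingale] the martingale parts at s and at u have the same pairing with Z, so only the
    drift over [u, s] is left. *)
Lemma ip_sol_later k u s Z : t <= u -> u <= s -> s <= T ->
  L2 Pr Z -> sigma_measurable (F u) Z ->
  ip Pr Z (X k s) = ip Pr Z (X k u) +
    \int[mu]_(v in `[u, s]) \sum_c A v k c * ip Pr Z (X c v).
Proof.
move=> tu us sT lZ aZ; have ts := le_trans tu us; have uT := le_trans us sT.
have [|J [iJ _ eJ]] := @sol_decomp s; first by rewrite ts.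
have [|J' [iJ' _ eJ']] := @sol_decomp u; first by rewrite tu.
have lc : L2 Pr (fun=> x k) := L2_cst Pr (x k).
have lts : L2 Pr (tint (drift k s)).
  by apply: L2_tint; [exact: ts|exact: bsupp_on_itv|exact: L2_drift].
have ltu : L2 Pr (tint (drift k u)).
  by apply: L2_tint; [exact: tu|exact: bsupp_on_itv|exact: L2_drift].
have lJ := L2_pos_ito k ts iJ; have lJ' := L2_pos_ito k tu iJ'.
rewrite !(ipC _ Z) eJ// eJ'// !(ipC _ _ Z) !ipDr//; try by solve_L2.
rewrite (ito_martingale W_bm t0 tu us (iJ k) (iJ' k) lZ aZ).
rewrite !ip_tint_drift ?ts ?tu//.
have iI : mu.-integrable `[t, s] (EFin \o (fun v => \sum_c A v k c * ip Pr Z (X c v))).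
  by apply: integrable_ip_coef; rewrite ?ts.
rewrite -(@Rintegral_itv_obnd_cbnd _ u (BRight s)); last first.
  by apply: integrableS iI => //; apply: subset_itvr; rewrite bnd_simp.
rewrite -(Rintegral_itvB iI) ?bnd_simp//.
ring.
Qed.

Lemma ip_cst_sol k s : t <= s <= T ->
  ip Pr (fun=> 1) (X k s) = x k + ip Pr (fun=> 1) (tint (drift k s)).
Proof.
move=> tsT; have /andP[ts sT] := tsT; have tT := le_trans ts sT.
have [J [iJ _ eJ]] := sol_decomp tsT.
have [|J' [iJ' _ _]] := @sol_decomp t; first by rewrite lexx.
have l1 : L2 Pr (fun=> 1 : K) := L2_cst Pr 1.
have lc : L2 Pr (fun=> x k) := L2_cst Pr (x k).
have lts : L2 Pr (tint (drift k s)).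
  by apply: L2_tint; [exact: ts|exact: bsupp_on_itv|exact: L2_drift].
have lJ := L2_pos_ito k ts iJ; have lJ' := L2_pos_ito k (lexx t) iJ'.
(* The integral over the one-point interval [t, t] has norm 0 by the isometry; the martingale
   property then makes the integral over [t, s] centered. *)
have JJ0 : ip Pr (J' k) (J' k) = 0.
  rewrite (ito_isometry W_bm t0 t0 (iJ' k) (iJ' k)).
  have lCX := L2_coef k bC tT.
  have [-> _] := ip_on_itv lCX lCX.
  by rewrite set_itv1 Rintegral_set1.
have J0 : ip Pr (fun=> 1) (J k) = 0.
  rewrite (ito_martingale W_bm t0 (lexx t) ts (iJ k) (iJ' k) l1); last first.
    exact: sigma_measurable_cst.
  apply/eqP; rewrite -sqrf_eq0 eq_le sqr_ge0 andbT.
  by have := ip_CauchySchwarz l1 lJ'; rewrite JJ0 mulr0.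
rewrite ipC eJ// ipC !ipDr//; try by solve_L2.
rewrite J0 addr0; congr (_ + _).
rewrite /ip; under eq_Rintegral do rewrite mul1r.
by rewrite Rintegral_cst//= probability_setT mulr1.
Qed.

End one_solution.

Section two_solutions.
Variables (X Y : 'I_n -> K -> Omega -> K) (x y : 'I_n -> K).
Hypotheses (sX : vector_sde A C X x) (sY : vector_sde A C Y y).

Let m k l s := ip Pr (X k s) (Y l s).

Lemma integrable_moment k l : mu.-integrable `[t, T] (EFin \o m k l).
Proof. by have [] := ip_on_itv (L2_sol sX k (lexx T)) (L2_sol sY l (lexx T)). Qed.

Lemma integrable_coef_mul (D : K -> 'M[K]_n) k c (f : K -> K) s : bounded_coef D ->
  mu.-integrable `[t, s] (EFin \o f) ->
  mu.-integrable `[t, s] (EFin \o (fun v => D v k c * f v)).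
Proof.
move=> [mD [M bD]] jf; have mf := measurable_int _ jf.
have mf' : measurable_fun `[t, s] f by apply/measurable_EFinP.
have jM : mu.-integrable `[t, s] (fun v => M%:E * `|(f v)%:E|)%E.
  by apply: integrableZl => //; exact: (integrable_abse jf).
apply: (le_integrable _ _ _ jM) => //.
  apply/measurable_EFinP; apply: measurable_funM => //.
  exact: (measurable_funTS (mD k c)).
move=> v _ /=; rewrite lee_fin normrM [leRHS]normrM normr_id.
by rewrite ler_wpM2r// (le_trans (bD v k c))// ler_norm.
Qed.

Lemma adapted_drift k v : t <= v <= T ->
  sigma_measurable (F v) (fun w => \sum_c A v k c * X c v w).
Proof.
move=> tv; apply/sigma_measurableP; apply: measurable_sum => c.
have [pX _] := sX; have [_ aX _] := pX c.
by apply/sigma_measurableP; apply: sigma_measurableM; [exact: sigma_measurable_cst|exact: aX].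
Qed.

Lemma drift_at (Z : 'I_n -> K -> Omega -> K) k s u : t <= u <= s ->
  (fun w => drift Z k s (u, w)) = (fun w => \sum_c A u k c * Z c u w).
Proof. by move=> hu; apply/funext => w; rewrite /drift on_itvE. Qed.

(** The drift of X at time v is known at v, so [ip_sol_later] replaces Y at s by Y at v plus the
    drift of Y over [v, s]: the first gives moments, the second the triangular integral. *)
Lemma ip_drift_sol k l s : t <= s <= T ->
  ip Pr (tint (drift X k s)) (Y l s) =
  \int[mu]_(v in `[t, s]) (\sum_c A v k c * m c l v) +
  \int[mu]_(v in `[t, s]) \int[mu]_(u in `[v, s])
    ip Pr (fun w => drift X k s (v, w)) (fun w => drift Y l s (u, w)).
Proof.
move=> tsT; have /andP[ts sT] := tsT.
have sTv v : t <= v <= s -> t <= v <= T.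
  by move=> /andP[-> /le_trans]; exact.
have lYs := L2_sol_at sY l tsT.
have i1 : mu.-integrable `[t, s] (EFin \o (fun v => \sum_c A v k c * m c l v)).
  apply: integrable_sumE => // c; apply: integrable_coef_mul => //.
  apply: integrableS (integrable_moment c l) => //.
have i2 := integrable_ip_coef sX k tsT lYs.
rewrite ipC (ip_tint_drift sX)// -[LHS](subrKC (\int[mu]_(v in `[t, s]) (\sum_c A v k c * m c l v))).
congr (_ + _); rewrite -RintegralB//; apply: eq_Rintegral => v; rewrite inE/= in_itv/= => hv.
have /andP[tv vs] := hv; have hT := sTv v hv.
have lZ : L2 Pr (fun w => \sum_c A v k c * X c v w).
  by apply: L2_sum => c; apply: L2Z; exact: (L2_sol_at sX).
rewrite -(ip_coef_sum sX A)// ipC.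
rewrite (ip_sol_later sY l tv vs sT lZ (adapted_drift k hT)).
rewrite ipC (ip_coef_sum sX A k hT (L2_sol_at sY l hT)).
rewrite [X in X + _ - _](_ : _ = \sum_c A v k c * m c l v); last first.
  by apply: eq_bigr => c _; rewrite ipC.
rewrite addrC addKr; apply: eq_Rintegral => u; rewrite inE/= in_itv/= => /andP[vu us].
have hu : t <= u <= s by rewrite us (le_trans tv).
by rewrite !drift_at// (ip_coef_sum sY A l (sTv u hu) lZ).
Qed.

End two_solutions.

Section two_solutions.
Variables (X Y : 'I_n -> K -> Omega -> K) (x y : 'I_n -> K).
Hypotheses (sX : vector_sde A C X x) (sY : vector_sde A C Y y).

Let m k l s := ip Pr (X k s) (Y l s).

(* No product rule is used: X and Y are split into initial value, drift and
   martingale part. The isometry gives the product of the martingale parts, and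
   conditioning at the times of the drift gives the products of a drift with a
   solution, up to two triangular integrals that add up to the product of the
   drifts. *)
Theorem second_moment k l s : t <= s <= T ->
  m k l s = x k * y l + \int[mu]_(v in `[t, s])
    (\sum_c A v k c * m c l v + \sum_c A v l c * m k c v +
     \sum_c \sum_e C v k c * C v l e * m c e v).
Proof.
move=> tsT; have /andP[ts sT] := tsT.
have [J [iJ lXs eJ]] := sol_decomp sX tsT.
have [J' [iJ' lYs eJ']] := sol_decomp sY tsT.
have lJ := L2_pos_ito k ts iJ; have lJ' := L2_pos_ito l ts iJ'.
have lcx : L2 Pr (fun=> x k) := L2_cst Pr (x k).
have lcy : L2 Pr (fun=> y l) := L2_cst Pr (y l).
have l1 : L2 Pr (fun=> 1 : K) := L2_cst Pr 1.
have la : L2 Pr (tint (drift X k s)).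
  by apply: L2_tint; [exact: ts|exact: bsupp_on_itv|exact: (L2_drift sX)].
have lb : L2 Pr (tint (drift Y l s)).
  by apply: L2_tint; [exact: ts|exact: bsupp_on_itv|exact: (L2_drift sY)].
pose al := tint (drift X k s); pose be := tint (drift Y l s).
have ipc c Z : L2 Pr Z -> ip Pr (fun=> c) Z = c * ip Pr (fun=> 1) Z.
  move=> lZ; rewrite -ipZl//.
  by congr ip; apply/funext => w; rewrite mulr1.
(* The mean of X is x plus the mean of [al], and likewise for Y and [be]; hence in [ip_decomp] the
   initial values contribute xy + xy - xy and the means of the drifts cancel. *)
have mkl : m k l s = x k * y l + ip Pr (J k) (J' l) + ip Pr (X k s) be +
    ip Pr al (Y l s) - ip Pr al be.
  have ip11 : ip Pr (fun=> 1) (fun=> 1) = 1.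
    rewrite /ip; under eq_Rintegral do rewrite mulr1.
    by rewrite Rintegral_cst//= probability_setT mulr1.
  have eX : ip Pr (X k s) (fun=> 1) = x k + ip Pr (fun=> 1) al.
    by rewrite ipC (ip_cst_sol sX).
  have eY : ip Pr (fun=> 1) (Y l s) = y l + ip Pr (fun=> 1) be.
    exact: (ip_cst_sol sY).
  have e1 : m k l s = ip Pr (J k) (J' l) + ip Pr (X k s) (fun w => y l + be w) +
      ip Pr (fun w => x k + al w) (Y l s) -
      ip Pr (fun w => x k + al w) (fun w => y l + be w).
    have la' : L2 Pr (fun w => x k + al w) by solve_L2.
    have lb' : L2 Pr (fun w => y l + be w) by solve_L2.
    rewrite /m (eJ k)// ipC (eJ' l); last by solve_L2.
    rewrite ipC (ip_decomp la' lJ lb' lJ') -(eJ k)// (ipC _ _ (fun w => _ + _ + J' l w)).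
    by rewrite -(eJ' l)// (ipC _ (Y l s)).
  rewrite e1 !ipDr ?ipDl//; try by solve_L2.
  rewrite (ipC _ _ (fun=> y l)) !(ipc (y l))// !(ipc (x k))// !(ipC _ (fun=> 1) (X k s)).
  rewrite (ipC _ al (fun=> y l)) (ipc (y l))//.
  rewrite (ipC _ (fun=> 1) (fun=> y l)) (ipc (y l) (fun=> 1))// ip11 eX eY.
  move: (ip Pr (J k) (J' l)) (ip Pr (X k s) be) (ip Pr al (Y l s)) (ip Pr al be)
    (ip Pr (fun=> 1) al) (ip Pr (fun=> 1) be) => q1 q2 q3 q4 q5 q6; ring.
have tt : t <= t <= s by rewrite lexx.
have moments c e : mu.-integrable `[t, s] (EFin \o m c e).
  by apply: integrableS (integrable_moment sX sY c e) => //; apply: subset_itvl; rewrite bnd_simp.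
pose kap (z : measurableTypeR K * measurableTypeR K) :=
  ip Pr (fun w => drift X k s (z.1, w)) (fun w => drift Y l s (z.2, w)).
have ikap : (mu \x mu)%E.-integrable setT (EFin \o kap).
  exact: (integrable_kernel (@bsupp_on_itv _ _ _ _ _ _) (L2_drift sX k sT)
    (@bsupp_on_itv _ _ _ _ _ _) (L2_drift sY l sT)).
have ab : ip Pr al be = \int[mu]_(u in `[t, s]) \int[mu]_(v in `[t, s]) kap (u, v).
  rewrite ipC (ip_tint (@bsupp_on_itv _ _ _ _ _ _) (L2_drift sX k sT) lb) Rintegral_ip_on_itv.
  apply: eq_Rintegral => u; rewrite inE/= in_itv/= => hu.
  have lu : L2 Pr (fun w => \sum_c A u k c * X c u w).
    apply: L2_sum => c; apply: L2Z; apply: (L2_sol_at sX).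
    by case/andP: hu => -> /le_trans ->.
  rewrite ipC (ip_tint (@bsupp_on_itv _ _ _ _ _ _) (L2_drift sY l sT) lu) Rintegral_ip_on_itv.
  by apply: eq_Rintegral => v; rewrite inE/= in_itv/= => hv; rewrite /kap /= !drift_at.
have sTv v : t <= v <= s -> t <= v <= T.
  by move=> /andP[-> /le_trans]; exact.
have jj : ip Pr (J k) (J' l) =
    \int[mu]_(v in `[t, s]) \sum_c \sum_e C v k c * C v l e * m c e v.
  rewrite (ito_isometry W_bm t0 t0 (iJ k) (iJ' l)).
  have [-> _] := ip_on_itv (L2_coef sX k bC sT) (L2_coef sY l bC sT).
  apply: eq_Rintegral => v; rewrite inE/= in_itv/= => hv.
  have hT := sTv v hv.
  rewrite ip_suml; last 2 first.
  - by move=> c; apply: L2Z; exact: (L2_sol_at sX).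
  - by apply: L2_sum => c; apply: L2Z; exact: (L2_sol_at sY).
  apply: eq_bigr => c _; rewrite ip_sumr; last 2 first.
  - by move=> e; apply: L2Z; exact: (L2_sol_at sY).
  - by apply: L2Z; exact: (L2_sol_at sX).
  apply: eq_bigr => e _; rewrite ipZl ?ipZr ?mulrA//; try by [apply: (L2_sol_at sX)|apply: (L2_sol_at sY)].
  by apply: L2Z; exact: (L2_sol_at sY).
have i1 : mu.-integrable `[t, s] (EFin \o (fun v => \sum_c A v k c * m c l v)).
  by apply: integrable_sumE => // c; apply: integrable_coef_mul => //; exact: moments.
have i2 : mu.-integrable `[t, s] (EFin \o (fun v => \sum_c A v l c * m k c v)).
  by apply: integrable_sumE => // c; apply: integrable_coef_mul => //; exact: moments.
have i3 : mu.-integrable `[t, s] (EFin \o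
    (fun v => \sum_c \sum_e C v k c * C v l e * m c e v)).
  apply: integrable_sumE => // c; apply: integrable_sumE => // e.
  rewrite (_ : _ \o _ = EFin \o (fun v => C v k c * (C v l e * m c e v))); last first.
    by apply/funext => v /=; rewrite mulrA.
  by do 2 apply: integrable_coef_mul => //; exact: moments.
have Xb : ip Pr (X k s) be = \int[mu]_(v in `[t, s]) (\sum_c A v l c * m k c v) +
    \int[mu]_(v in `[t, s]) \int[mu]_(u in `[v, s]) kap (u, v).
  apply: (etrans (ipC _ _ _)); apply: (etrans (ip_drift_sol sY sX l k tsT)).
  apply: f_equal2.
    by apply: eq_Rintegral => v _; apply: eq_bigr => c _; congr (_ * _); exact: ipC.
  by apply: eq_Rintegral => v _; apply: eq_Rintegral => u _; exact: ipC.
have mI : measurable (`[t, s]%classic : set (measurableTypeR K)) by exact: measurable_itv.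
have i12 : mu.-integrable `[t, s] (EFin \o (fun v => \sum_c A v k c * m c l v +
    \sum_c A v l c * m k c v)).
  by apply: (integrableD mI i1 i2).
have R : \int[mu]_(v in `[t, s]) (\sum_c A v k c * m c l v + \sum_c A v l c * m k c v +
      \sum_c \sum_e C v k c * C v l e * m c e v) =
    \int[mu]_(v in `[t, s]) (\sum_c A v k c * m c l v) +
    \int[mu]_(v in `[t, s]) (\sum_c A v l c * m k c v) +
    \int[mu]_(v in `[t, s]) (\sum_c \sum_e C v k c * C v l e * m c e v).
  by rewrite (RintegralD mI i12 i3) (RintegralD mI i1 i2).
have aY : ip Pr al (Y l s) = \int[mu]_(v in `[t, s]) (\sum_c A v k c * m c l v) +
    \int[mu]_(u in `[t, s]) \int[mu]_(v in `[u, s]) kap (u, v).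
  exact: (ip_drift_sol sX sY k l tsT).
have T1 : ip Pr al be = \int[mu]_(u in `[t, s]) \int[mu]_(v in `[u, s]) kap (u, v) +
    \int[mu]_(v in `[t, s]) \int[mu]_(u in `[v, s]) kap (u, v).
  by apply: (etrans ab); exact: triangle_fubini.
rewrite R mkl jj.
move: aY Xb T1.
move: (ip Pr (X k s) be) (ip Pr al (Y l s)) (ip Pr al be)
  (\int[mu]_(v in `[t, s]) (\sum_c A v k c * m c l v))
  (\int[mu]_(v in `[t, s]) (\sum_c A v l c * m k c v))
  (\int[mu]_(v in `[t, s]) (\sum_c \sum_e C v k c * C v l e * m c e v))
  (\int[mu]_(u in `[t, s]) \int[mu]_(v in `[u, s]) kap (u, v))
  (\int[mu]_(v in `[t, s]) \int[mu]_(u in `[v, s]) kap (u, v)).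
by move=> q1 q2 q3 q4 q5 q6 q7 q8 -> -> ->; ring.
Qed.

End two_solutions.

End linear_sde.

(** * Frobenius pairing and positive semidefinite matrices *)

Section matrix_pairing.
Context {K : realType}.

Definition pair (p q : nat) (X Y : 'M[K]_(p, q)) : K := \sum_i \sum_j X i j * Y i j.

Definition form (n : nat) (X : 'M[K]_n) (x y : 'cV[K]_n) : K := (x^T *m X *m y) 0 0.

Section rectangular.
Variables (p q : nat).
Implicit Types X Y Z : 'M[K]_(p, q).

Lemma pair_trace X Y : pair X Y = \tr (X^T *m Y).
Proof.
rewrite /pair exchange_big; apply: eq_bigr => j _; rewrite mxE.
by apply: eq_bigr => i _; rewrite mxE.
Qed.

Lemma pairC X Y : pair X Y = pair Y X.
Proof. by apply: eq_bigr => i _; apply: eq_bigr => j _; rewrite mulrC. Qed.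

Lemma pairDl X Y Z : pair (X + Y) Z = pair X Z + pair Y Z.
Proof. by rewrite !pair_trace linearD/= mulmxDl mxtraceD. Qed.

Lemma pairNl X Z : pair (- X) Z = - pair X Z.
Proof. by rewrite !pair_trace linearN/= mulNmx raddfN. Qed.

Lemma pairBl X Y Z : pair (X - Y) Z = pair X Z - pair Y Z.
Proof. by rewrite pairDl pairNl. Qed.

Lemma pairDr X Y Z : pair Z (X + Y) = pair Z X + pair Z Y.
Proof. by rewrite pairC pairDl !(pairC Z). Qed.

Lemma pairNr X Z : pair Z (- X) = - pair Z X.
Proof. by rewrite pairC pairNl (pairC Z). Qed.

Lemma pairBr X Y Z : pair Z (X - Y) = pair Z X - pair Z Y.
Proof. by rewrite pairDr pairNr. Qed.

Lemma pairZl c X Z : pair (c *: X) Z = c * pair X Z.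
Proof. by rewrite !pair_trace linearZ/= -scalemxAl mxtraceZ. Qed.

Lemma pairZr c X Z : pair Z (c *: X) = c * pair Z X.
Proof. by rewrite pairC pairZl (pairC Z). Qed.

Lemma pair0l Z : pair 0 Z = 0.
Proof. by rewrite pair_trace trmx0 mul0mx mxtrace0. Qed.

Lemma pair_suml (I : Type) (r : seq I) (X : I -> 'M[K]_(p, q)) Z :
  pair (\sum_(i <- r) X i) Z = \sum_(i <- r) pair (X i) Z.
Proof.
elim: r => [|i r IH]; last by rewrite !big_cons pairDl IH.
by rewrite !big_nil pair0l.
Qed.

Lemma pair_ge0 X : 0 <= pair X X.
Proof. by do 2 apply: sumr_ge0 => ? _; rewrite -expr2 sqr_ge0. Qed.

Lemma frobenius_ge0 X : 0 <= frobenius X.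
Proof. exact: sqrtr_ge0. Qed.

Lemma sqr_frobenius X : frobenius X ^+ 2 = pair X X.
Proof. by rewrite sqr_sqrtr// pair_ge0. Qed.

Lemma pair_eq0 X : pair X X = 0 -> X = 0.
Proof.
move=> X0; apply/matrixP => i j; rewrite mxE.
have n0 i' : 0 <= \sum_j X i' j * X i' j.
  by apply: sumr_ge0 => k _; rewrite -expr2 sqr_ge0.
have h : \sum_k X i k * X i k = 0 by exact: (psumr_eq0P (fun i' _ => n0 i') X0).
have n1 k : true -> 0 <= X i k * X i k by rewrite -expr2 sqr_ge0.
have : X i j * X i j = 0 by exact: (psumr_eq0P n1 h).
by move/eqP; rewrite mulf_eq0 orbb => /eqP.
Qed.

Lemma pair_CauchySchwarz X Y : pair X Y <= frobenius X * frobenius Y.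
Proof.
have [X0|X0] := eqVneq (pair X X) 0.
  by rewrite (pair_eq0 X0) pair0l mulr_ge0 ?frobenius_ge0.
have [Y0|Y0] := eqVneq (pair Y Y) 0.
  by rewrite (pair_eq0 Y0) pairC pair0l mulr_ge0 ?frobenius_ge0.
pose a := frobenius X; pose b := frobenius Y.
have a0 : 0 < a by rewrite sqrtr_gt0 lt_neqAle eq_sym X0 pair_ge0.
have b0 : 0 < b by rewrite sqrtr_gt0 lt_neqAle eq_sym Y0 pair_ge0.
(* With a = |X| and b = |Y| this square equals 2ab (ab - <X, Y>). *)
have := pair_ge0 (b *: X - a *: Y).
rewrite pairBl !pairBr !pairZl !pairZr -!sqr_frobenius (pairC Y X) -/a -/b => h.
have ab0 : 0 < 2 * (a * b) by rewrite !mulr_gt0.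
by rewrite -(ler_pM2l ab0) -subr_ge0; apply: le_trans h _; rewrite le_eqVlt; apply/orP; left; apply/eqP; ring.
Qed.

Lemma sqr_pair X Y : pair X Y ^+ 2 <= pair X X * pair Y Y.
Proof.
rewrite -!sqr_frobenius -exprMn -[leLHS](real_normK (num_real _)) lerXn2r ?nnegrE//.
  by rewrite mulr_ge0 ?frobenius_ge0.
rewrite ler_norml pair_CauchySchwarz andbT lerNl -pairNl.
apply: le_trans (pair_CauchySchwarz _ _) _.
by rewrite /frobenius (eq_bigr (fun i => \sum_j X i j ^+ 2))// => i _;
  apply: eq_bigr => j _; rewrite mxE sqrrN.
Qed.

End rectangular.

Lemma frobenius_tr (p q : nat) (X : 'M[K]_(p, q)) : frobenius X^T = frobenius X.
Proof.
rewrite /frobenius exchange_big; congr Num.sqrt.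
by apply: eq_bigr => i _; apply: eq_bigr => j _; rewrite mxE.
Qed.

(** Cauchy-Schwarz for each entry of the product, as a row of X against a column of Y, then
    summation. *)
Lemma frobenius_mul (p q r : nat) (X : 'M[K]_(p, q)) (Y : 'M[K]_(q, r)) :
  frobenius (X *m Y) <= frobenius X * frobenius Y.
Proof.
rewrite -(ler_pXn2r (ltn0Sn 1)) ?nnegrE ?mulr_ge0 ?frobenius_ge0//.
rewrite exprMn !sqr_frobenius /pair mulr_suml; apply: ler_sum => i _.
rewrite [X in _ * X]exchange_big/= mulr_sumr; apply: ler_sum => j _.
rewrite -expr2 mxE; apply: le_trans (_ : pair (row i X) (col j Y)^T ^+ 2 <= _).
  rewrite /pair big_ord1 le_eqVlt; apply/orP; left; apply/eqP; congr (_ ^+ 2).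
  by apply: eq_bigr => k _; rewrite !mxE.
apply: le_trans (sqr_pair _ _) _; rewrite /pair !big_ord1 le_eqVlt; apply/orP; left; apply/eqP.
by congr (_ * _); apply: eq_bigr => k _; rewrite !mxE.
Qed.

Lemma pair_mulmx (p q r : nat) (X : 'M[K]_(p, q)) (Y : 'M[K]_(p, r)) (Z : 'M[K]_(r, q)) :
  pair X (Y *m Z) = pair (Y^T *m X) Z.
Proof. by rewrite !pair_trace trmx_mul trmxK mulmxA. Qed.

Lemma pair_tr (p q : nat) (X Y : 'M[K]_(p, q)) : pair X^T Y^T = pair X Y.
Proof.
by rewrite /pair exchange_big; apply: eq_bigr => i _; apply: eq_bigr => j _; rewrite !mxE.
Qed.

End matrix_pairing.

Section positive_semidefinite.
Context {K : realType}.
Variable n : nat.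
Implicit Types (X Y : 'M[K]_n) (x y v : 'cV[K]_n).

Lemma formDl X x y v : form X (x + y) v = form X x v + form X y v.
Proof. by rewrite /form linearD/= !mulmxDl mxE. Qed.

Lemma formDr X x y v : form X v (x + y) = form X v x + form X v y.
Proof. by rewrite /form mulmxDr mxE. Qed.

Lemma formZl c X x v : form X (c *: x) v = c * form X x v.
Proof. by rewrite /form linearZ/= -!scalemxAl mxE. Qed.

Lemma formZr c X x v : form X v (c *: x) = c * form X v x.
Proof. by rewrite /form -scalemxAr mxE. Qed.

Lemma form_sym X x y : X^T = X -> form X x y = form X y x.
Proof.
move=> sX; rewrite /form (_ : x^T *m X *m y = (y^T *m X *m x)^T) ?mxE//.
by rewrite !trmx_mul trmxK sX mulmxA.
Qed.

Lemma form_pair X x y : form X x y = pair X (x *m y^T).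
Proof.
rewrite /form /pair !mxE; under eq_bigr => j _.
  rewrite !mxE big_distrl/=; under eq_bigr do rewrite mxE.
  over.
rewrite exchange_big; apply: eq_bigr => i _; apply: eq_bigr => j _.
by rewrite !mxE big_ord1 mxE; ring.
Qed.

Lemma form_delta X i j : form X (delta_mx i 0) (delta_mx j 0) = X i j.
Proof. by rewrite /form trmx_delta -rowE -colE !mxE. Qed.

Lemma psd_diag0 X i k : psd X -> X i i = 0 -> X i k = 0.
Proof.
move=> [sX pX] Xii; pose e : 'cV[K]_n := delta_mx i 0; pose f : 'cV[K]_n := delta_mx k 0.
have key s : 0 <= 2 * s * X i k + X k k.
  have := pX (s *: e + f); rewrite -/(form X _ _).
  rewrite formDl !formDr !formZl !formZr (form_sym f e sX) !form_delta Xii.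
  by move=> h; nra.
apply/eqP; apply: contraT => Xik.
(* An affine function of s that is nonnegative everywhere has slope 0; this s would give it the
   value -1. *)
have := key (- (X k k + 1) / (2 * X i k)).
rewrite (_ : 2 * _ * X i k = - (X k k + 1)); first by move=> h; lra.
by field.
Qed.

(** Schur complement: the new form at y is the form of X at y - (c / [X i i]) e_i, the point that
    minimizes it along the direction e_i. *)
Lemma psd_sub_rank1 X i : psd X -> 0 < X i i ->
  psd (X - (X i i)^-1 *: (col i X *m (col i X)^T)).
Proof.
move=> [sX pX] a0; have aN : X i i != 0 by rewrite gt_eqF.
split.
  rewrite /mx_symmetric linearB/= linearZ/= trmx_mul trmxK.
  by rewrite (_ : X^T = X).
move=> y; pose e : 'cV[K]_n := delta_mx i 0; pose c := form X e y.
have := pX (y + (- (c / X i i)) *: e); rewrite -/(form X _ _) -/(form _ y y).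
rewrite formDl !formDr !formZl !formZr (form_sym y e sX) -/c form_delta.
rewrite [X in _ -> 0 <= X](_ : _ = form X y y - (X i i)^-1 * c ^+ 2); last first.
  rewrite form_pair pairBl pairZl -form_pair; congr (_ - _ * _).
  rewrite -form_pair /form !mulmxA -mulmxA mxE big_ord1 expr2.
  have cE : ((col i X)^T *m y) 0 0 = c.
    by rewrite /c /form trmx_delta -rowE -[in RHS]sX; congr ((_ *m _) 0 0); apply/rowP => j; rewrite !mxE.
  have yE : (y^T *m col i X) 0 0 = c.
    transitivity ((((col i X)^T *m y)^T) 0 0); first by rewrite trmx_mul trmxK.
    by rewrite mxE cE.
  by rewrite cE yE.
by congr (0 <= _); field.
Qed.

(* Gaussian elimination: successive rank-one reductions clear the rows of X. *)
Lemma psd_sum_rank1 X : psd X ->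
  exists r : seq 'cV[K]_n, X = \sum_(v <- r) v *m v^T.
Proof.
suff H (j : nat) Y : psd Y -> (forall i k : 'I_n, (j <= i)%N -> Y i k = 0) ->
    exists r : seq 'cV[K]_n, Y = \sum_(v <- r) v *m v^T.
  by move=> pX; apply: (H n) => // i k; rewrite leqNgt ltn_ord.
elim: j Y => [|j IH] Y pY Y0.
  by exists [::]; rewrite big_nil; apply/matrixP => i k; rewrite mxE Y0.
have [nj|jn] := leqP n j.
  by apply: IH => // i k ji; have := leq_trans nj ji; rewrite leqNgt ltn_ord.
pose i0 := Ordinal jn; have sY := pY.1.
have Yii : 0 <= Y i0 i0.
  by have := pY.2 (delta_mx i0 0); rewrite -/(form Y _ _) form_delta.
have [Y00|Y00] := eqVneq (Y i0 i0) 0.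
  apply: IH => // i k; rewrite leq_eqVlt => /predU1P[ji|]; last exact: Y0.
  have -> : i = i0 by apply: val_inj; rewrite /= ji.
  exact: psd_diag0.
have a0 : 0 < Y i0 i0 by rewrite lt_neqAle eq_sym Y00.
have symY i k : Y i k = Y k i by rewrite -[in LHS]sY mxE.
have [r er] : exists r : seq 'cV[K]_n,
    Y - (Y i0 i0)^-1 *: (col i0 Y *m (col i0 Y)^T) = \sum_(v <- r) v *m v^T.
  apply: IH; first exact: psd_sub_rank1.
  move=> i k; rewrite !mxE big_ord1 !mxE leq_eqVlt => /predU1P[ji|ji].
    have -> : i = i0 by apply: val_inj; rewrite /= ji.
    by rewrite mulrA mulVf// mul1r symY subrr.
  by rewrite !(Y0 i)// mul0r mulr0 subrr.
exists ((Num.sqrt (Y i0 i0))^-1 *: col i0 Y :: r).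
rewrite big_cons -er linearZ/= -scalemxAl -scalemxAr scalerA -expr2 exprVn.
by rewrite sqr_sqrtr// addrC subrK.
Qed.

(** Pairing X with a rank-one term v v^T of Y gives the form of X at v. *)
Lemma psd_pair X Y : psd X -> psd Y -> 0 <= pair X Y.
Proof.
move=> [_ pX] /psd_sum_rank1[r ->]; rewrite pairC pair_suml.
by apply: sumr_ge0 => v _; rewrite pairC -form_pair; exact: pX.
Qed.

(** |X|^2 <= <X, Y> <= |X| |Y|, the first inequality by [psd_pair] applied to X and Y - X. *)
Lemma psd_frobenius_le X Y : psd X -> psd (Y - X) -> frobenius X <= frobenius Y.
Proof.
move=> pX pYX; have := psd_pair pX pYX; rewrite pairBr subr_ge0 -sqr_frobenius.
move=> /le_trans/(_ (pair_CauchySchwarz _ _)); rewrite expr2.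
have [->|X0] := eqVneq (frobenius X) 0; first by rewrite frobenius_ge0.
by rewrite ler_pM2l// lt_neqAle eq_sym X0 frobenius_ge0.
Qed.

End positive_semidefinite.

(** * One-dimensional integral and differential inequalities *)

Section interval_integrals.
Context {K : realType}.
Local Notation mu := (@lebesgue_measure K).
Implicit Types (a b c t u s r M : K) (f g : K -> K).

Lemma integrable_itv_sub a b c t f : t <= a -> b <= c ->
  mu.-integrable `[t, c] (EFin \o f) -> mu.-integrable `[a, b] (EFin \o f).
Proof.
move=> ta bc; apply: integrableS => //.
by apply: subset_itv; rewrite bnd_simp.
Qed.

Lemma Rintegral_split a b c f : a <= c -> c <= b ->
  mu.-integrable `[a, b] (EFin \o f) ->
  \int[mu]_(u in `[a, b]) f u =
  \int[mu]_(u in `[a, c]) f u + \int[mu]_(u in `[c, b]) f u.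
Proof.
move=> ac cb jf; rewrite -(@Rintegral_itv_obnd_cbnd _ c (BRight b)); last first.
  by apply: integrableS jf => //; apply: subset_itvr; rewrite bnd_simp.
by rewrite -(Rintegral_itvB jf) ?bnd_simp// subrKC.
Qed.

Lemma integrable_cst_itv a b M : mu.-integrable `[a, b] (EFin \o (fun=> M)).
Proof.
have -> : EFin \o (fun=> M) = cst M%:E :> (K -> \bar K) by [].
apply/integrableP; split; first exact: measurable_cst.
rewrite integral_cst//= lebesgue_measure_itv/=.
by case: ifP => _; rewrite -?EFinB -?EFinM ?mule0 ltry.
Qed.

Lemma Rintegral_cst_itv a b M : a <= b -> \int[mu]_(_ in `[a, b]) M = M * (b - a).
Proof.
move=> ab; rewrite Rintegral_cst//= lebesgue_measure_itv/= lte_fin.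
case: ltP => [_|ba]; first by rewrite -EFinB.
by have -> : a = b; [apply/le_anti; rewrite ab ba|rewrite subrr].
Qed.

Lemma Rintegral_le_cst a b M f : a <= b -> mu.-integrable `[a, b] (EFin \o f) ->
  (forall u, a <= u <= b -> f u <= M) -> \int[mu]_(u in `[a, b]) f u <= M * (b - a).
Proof.
move=> ab jf fM; rewrite -Rintegral_cst_itv//; apply: le_Rintegral => //.
exact: integrable_cst_itv.
Qed.

Lemma Rintegral_norm_le_cst a b M f : a <= b -> mu.-integrable `[a, b] (EFin \o f) ->
  (forall u, a <= u <= b -> `|f u| <= M) ->
  `|\int[mu]_(u in `[a, b]) f u| <= M * (b - a).
Proof.
move=> ab jf fM; apply: le_trans (le_normr_Rintegral _ jf) _ => //.
by apply: Rintegral_le_cst => //; exact: (integrable_abse jf).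
Qed.

Lemma Rintegral_ge0_itv a b f : (forall u, a <= u <= b -> 0 <= f u) ->
  0 <= \int[mu]_(u in `[a, b]) f u.
Proof. by move=> f0; apply: Rintegral_ge0 => u; rewrite /= in_itv/=; exact: f0. Qed.

(** f is merely integrable, so the argument iterates instead of differentiating: on a window of
    length h with c h <= 1/2, after a stretch where f vanishes, each use of the inequality halves
    the bound M. Finitely many windows cover [t, T]; c + 1 in h allows c = 0. *)
Lemma gronwall_zero t T c f : t <= T -> 0 <= c ->
  mu.-integrable `[t, T] (EFin \o f) -> (forall s, t <= s <= T -> 0 <= f s) ->
  (forall s, t <= s <= T -> f s <= c * \int[mu]_(u in `[t, s]) f u) ->
  forall s, t <= s <= T -> f s = 0.
Proof.
move=> tT c0 jf f0 fc.
pose h := (2 * (c + 1))^-1; have c1 : 0 < 2 * (c + 1) by lra.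
have h0 : 0 < h by rewrite invr_gt0.
have ch : c * h <= 2^-1.
  rewrite /h ler_pdivrMr//; lra.
pose M := c * \int[mu]_(u in `[t, T]) f u.
have M0 : 0 <= M by rewrite mulr_ge0// Rintegral_ge0_itv.
have fM s : t <= s <= T -> f s <= M.
  move=> tsT; apply: le_trans (fc s tsT) _; have /andP[ts sT] := tsT.
  rewrite ler_wpM2l// (@Rintegral_split t T s)// lerDl.
  by apply: Rintegral_ge0_itv => u /andP[su uT]; rewrite f0// uT (le_trans ts).
have claim j s : t <= s <= T -> s <= t + j%:R * h -> f s = 0.
  elim: j s => [|j IH] s tsT sj; have /andP[ts sT] := tsT.
    have -> : s = t by apply/le_anti; rewrite ts andbT; move: sj; rewrite mul0r addr0.
    have tt : t <= t <= T by rewrite lexx.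
    by apply/le_anti; rewrite f0// andbT (le_trans (fc t tt))// set_itv1 Rintegral_set1 mulr0.
  have small k r : t <= r <= T -> r <= t + j.+1%:R * h -> f r <= M / 2 ^+ k.
    elim: k r => [|k IHk] r trT rj; have /andP[tr rT] := trT.
      by rewrite expr0 divr1 fM.
    have [rj'|/ltW jr] := leP r (t + j%:R * h).
      by rewrite IH// divr_ge0// exprn_ge0.
    pose a := t + j%:R * h; have ta : t <= a by rewrite lerDl mulr_ge0// ltW.
    apply: le_trans (fc r trT) _.
    have jfr : mu.-integrable `[t, r] (EFin \o f) by exact: integrable_itv_sub jf.
    rewrite (@Rintegral_split t r a)//.
    have -> : \int[mu]_(u in `[t, a]) f u = 0.
      rewrite -[RHS](mul0r (a - t)) -Rintegral_cst_itv//; apply: eq_Rintegral => u.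
      rewrite inE/= in_itv/= => /andP[tu ua]; apply: IH => //.
      by rewrite tu (le_trans ua (le_trans jr rT)).
    rewrite add0r.
    have : \int[mu]_(u in `[a, r]) f u <= (M / 2 ^+ k) * (r - a).
      apply: Rintegral_le_cst => //; first exact: integrable_itv_sub jfr.
      move=> u /andP[au ur]; apply: IHk; last exact: le_trans ur rj.
      by rewrite (le_trans ta au) (le_trans ur rT).
    have ra : r - a <= h.
      by rewrite /a lerBlDl; apply: le_trans rj _; rewrite -natr1 mulrDl mul1r addrA.
    have Mk : 0 <= M / 2 ^+ k by rewrite divr_ge0// exprn_ge0.
    move=> I1; apply: (@le_trans _ _ (c * (M / 2 ^+ k * h))).
      by rewrite ler_wpM2l//; apply: le_trans I1 _; rewrite ler_wpM2l.
    by rewrite mulrCA [leRHS](_ : _ = M / 2 ^+ k * 2^-1) ?ler_wpM2l// exprSr invfM mulrA.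
  apply/le_anti; rewrite f0// andbT.
  apply/ler_addgt0Pr => e e0; rewrite add0r.
  have [k kM] : exists k : nat, M / 2 ^+ k <= e.
    exists (Num.bound (M / e)); rewrite ler_pdivrMr ?exprn_gt0// mulrC -ler_pdivrMr//.
    exact/ltW/upper_nthrootP.
  exact: le_trans (small k s tsT sj) kM.
move=> s tsT.
have [j js] : exists j : nat, s <= t + j%:R * h.
  exists (Num.bound ((s - t) / h)); rewrite -lerBlDl -ler_pdivrMr//.
  apply/ltW/archi_boundP; apply: divr_ge0; last exact: ltW.
  by rewrite subr_ge0; case/andP: tsT.
exact: claim js.
Qed.

(** The right limit says nothing about f at t, so the estimate is made over ]t, r], which differs
    from [t, r] by a null set. *)
Lemma average_cvg t T f (l : K) : t < T -> mu.-integrable `[t, T] (EFin \o f) ->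
  f u @[u --> t^'+] --> l ->
  (fun r => (r - t)^-1 * \int[mu]_(u in `[t, r]) f u) @ t^'+ --> l.
Proof.
move=> tT jf fl; apply/cvgrPdist_le => e e0.
have /cvgrPdist_le/(_ e e0) := fl.
move=> [del /= del0 Hd]; near=> r.
have tr : t < r by near: r; exact: nbhs_right_gt.
have rT : r <= T by near: r; exact: nbhs_right_le.
have rd : r < t + del by near: r; apply: nbhs_right_lt; rewrite ltrDl.
have rt0 : 0 < r - t by rewrite subr_gt0.
have jr : mu.-integrable `[t, r] (EFin \o f) by exact: integrable_itv_sub jf.
pose g u := if u == t then 0 else l - f u.
have gE : \int[mu]_(u in `]t, r]) (l - f u) = \int[mu]_(u in `]t, r]) g u.
  apply: eq_Rintegral => u; rewrite inE/= in_itv/= => /andP[tu _].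
  by rewrite /g gt_eqF.
have jd : mu.-integrable `[t, r] (EFin \o (fun u => l - f u)).
  have mI : measurable (`[t, r]%classic : set (measurableTypeR K)) by exact: measurable_itv.
  by apply: (integrableB mI (integrable_cst_itv t r l) jr).
have jo : mu.-integrable `]t, r] (EFin \o (fun u => l - f u)).
  by apply: integrableS jd => //; apply: subset_itvr; rewrite bnd_simp.
have E : l - (r - t)^-1 * \int[mu]_(u in `[t, r]) f u =
    (r - t)^-1 * \int[mu]_(u in `]t, r]) (l - f u).
  rewrite Rintegral_itv_obnd_cbnd// RintegralB//; last exact: integrable_cst_itv.
  rewrite Rintegral_cst_itv ?ltW// mulrBr; congr (_ - _).
  by field; rewrite gt_eqF.
rewrite E normrM gtr0_norm ?invr_gt0// mulrC ler_pdivrMr//.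
apply: le_trans (le_normr_Rintegral _ jo) _ => //.
apply: (@le_trans _ _ (\int[mu]_(u in `]t, r]) e)).
  apply: le_Rintegral => //.
  - exact: (integrable_abse jo).
  - by apply: integrableS (integrable_cst_itv t r e) => //; apply: subset_itvr; rewrite bnd_simp.
  - move=> u; rewrite /= in_itv/= => /andP[tu ur]; apply: Hd => //=.
    by rewrite ltr0_norm ?subr_lt0// opprB ltrBlDl (le_lt_trans ur).
rewrite Rintegral_itv_obnd_cbnd; last first.
  by apply: integrableS (integrable_cst_itv t r e) => //; apply: subset_itvr; rewrite bnd_simp.
by rewrite Rintegral_cst_itv// ltW.
Unshelve. all: by end_near. Qed.

(** Allow u to decrease at slope e, and let Z be the set of points up to which this bound holds from
    a. Its supremum belongs to Z by continuity, and the hypothesis there would carry Z further to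
    the right unless the supremum is b. *)
Lemma dini_nondecreasing (a b : K) (u : K -> K) : a <= b ->
  {within `[a, b], continuous u} ->
  (forall t e, a <= t -> t < b -> 0 < e ->
     \forall r \near t^'+, u t - u r <= e * (r - t)) ->
  u a <= u b.
Proof.
rewrite le_eqVlt => /predU1P[-> //|ab] cu du.
apply/ler_addgt0Pr => e0 e0_gt0.
pose e := e0 / (b - a); have ba0 : 0 < b - a by rewrite subr_gt0.
have e_gt0 : 0 < e by rewrite divr_gt0.
suff : u a - u b <= e * (b - a) by rewrite /e divfK ?gt_eqF// lerBlDr addrC.
pose Z := [set s | a <= s <= b /\ forall s', a <= s' <= s -> u a - u s' <= e * (s' - a)].
have Za : Z a.
  split; first by rewrite lexx ltW.
  by move=> s' /le_anti <-; rewrite !subrr mulr0.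
have hsZ : has_sup Z by split; [exists a|exists b => s [/andP[]]].
pose c := sup Z.
have ac : a <= c by apply: ub_le_sup => //; case: hsZ.
have cb : c <= b by apply: ge_sup; [exists a|move=> s [/andP[]]].
have below s : a <= s -> s < c -> u a - u s <= e * (s - a).
  move=> as_ sc; have [s' [_ Zs'] ss'] := sup_gt (ex_intro _ a Za) sc.
  by apply: Zs'; rewrite as_ ltW.
have [cin ca_ cb_] := (continuous_within_itvP u ab).1 cu.
have atc : u a - u c <= e * (c - a).
  have [->|ca] := eqVneq c a; first by rewrite !subrr mulr0.
  have lac : a < c by rewrite lt_neqAle eq_sym ca.
  have uc : u s @[s --> c^'-] --> u c.
    have [->//|cbN] := eqVneq c b.
    apply: cvg_at_left_filter; apply: cin.
    by rewrite in_itv/= lac lt_neqAle cbN.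
  apply: (@ler_cvg_to _ (c^'-) _ _ (fun s => u a - u s) (fun s => e * (s - a))).
  - by apply: cvgB; [exact: cvg_cst|exact: uc].
  - apply: cvgMr; apply: cvgB; last exact: cvg_cst.
    by apply: cvg_at_left_filter; exact: cvg_id.
  - near=> s; apply: below; last by near: s; exact: nbhs_left_lt.
    by near: s; exact: nbhs_left_ge.
have Zc : Z c.
  split; first by rewrite ac cb.
  move=> s' /andP[as']; rewrite le_eqVlt => /predU1P[->//|]; exact: below.
have [cb'|cbN] := eqVneq c b; first by rewrite -cb'.
have lcb : c < b by rewrite lt_neqAle cbN.
have [del /= del0 Hd] := du c e ac lcb e_gt0.
pose r := Order.min b (c + del / 2).
have cr : c < r by rewrite lt_min lcb ltrDl divr_gt0.
have : Z r.
  split; first by rewrite (le_trans ac (ltW cr)) ge_min lexx.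
  move=> s' /andP[as' sr]; have [sc|cs] := leP s' c.
    by have [_] := Zc; apply; rewrite as' sc.
  have : u c - u s' <= e * (s' - c).
    apply: Hd => //=; rewrite ltr0_norm ?subr_lt0// opprB ltrBlDl.
    apply: (le_lt_trans sr); rewrite gt_min; apply/orP; right.
    by rewrite ltrD2l ltr_pdivrMr// ltr_pMr// ltr1n.
  by move=> h; lra.
by move=> /(ub_le_sup hsZ.2); rewrite leNgt -/c cr.
Unshelve. all: by end_near. Qed.

End interval_integrals.

(** * Lyapunov integral equation *)

Section lyapunov.
Context {K : realType}.
Local Notation mu := (@lebesgue_measure K).
Variables (n : nat) (A C : K -> 'M[K]_n).
Hypotheses (bA : bounded_coef A) (bC : bounded_coef C).
Implicit Types (t T u v s r : K) (N X Y : 'M[K]_n).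

Definition lyap_op v (S : 'M[K]_n) : 'M[K]_n :=
  A v *m S + S *m (A v)^T + C v *m S *m (C v)^T.

Lemma lyap_opE v (S : 'M[K]_n) k l : lyap_op v S k l =
  \sum_c A v k c * S c l + \sum_c A v l c * S k c +
  \sum_c \sum_e C v k c * C v l e * S c e.
Proof.
rewrite /lyap_op !mxE; congr (_ + _ + _).
  by apply: eq_bigr => c _; rewrite !mxE mulrC.
rewrite exchange_big/=; apply: eq_bigr => e _; rewrite !mxE big_distrl/=.
by apply: eq_bigr => c _; ring.
Qed.

Lemma lyap_opB v X Y : lyap_op v (X - Y) = lyap_op v X - lyap_op v Y.
Proof.
rewrite /lyap_op !(mulmxBr, mulmxBl) !opprD !addrA.
by apply/matrixP => i j; rewrite !mxE; ring.
Qed.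

Lemma lyap_op_bound : exists c : K, 0 <= c /\ forall v (S : 'M[K]_n) (B : K), 0 <= B ->
  (forall k l, `|S k l| <= B) -> forall k l, `|lyap_op v S k l| <= c * B.
Proof.
have [[_ [a ha]] [_ [g hg]]] := (bA, bC).
(* Absolute values, because for n = 0 the bounds in [bounded_coef] are vacuous and may be
   negative. *)
exists (n%:R * `|a| + n%:R * `|a| + n%:R * (n%:R * (`|g| * `|g|))); split.
  by rewrite !addr_ge0 ?mulr_ge0 ?ler0n.
move=> v S B B0 SB k l; rewrite lyap_opE !mulrDl.
have ha' u i j : `|A u i j| <= `|a| by apply: le_trans (ha u i j) (ler_norm _).
have hg' u i j : `|C u i j| <= `|g| by apply: le_trans (hg u i j) (ler_norm _).
have cst (x : K) : n%:R * x = \sum_(c < n) x by rewrite sumr_const card_ord mulr_natl.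
apply: le_trans (ler_normD _ _) _; apply: lerD.
  apply: le_trans (ler_normD _ _) _; apply: lerD.
    rewrite -mulrA cst; apply: le_trans (ler_norm_sum _ _ _) _; apply: ler_sum => c _.
    by rewrite normrM ler_pM.
  rewrite -mulrA cst; apply: le_trans (ler_norm_sum _ _ _) _; apply: ler_sum => c _.
  by rewrite normrM ler_pM.
rewrite -mulrA cst; apply: le_trans (ler_norm_sum _ _ _) _; apply: ler_sum => c _.
rewrite -mulrA cst; apply: le_trans (ler_norm_sum _ _ _) _; apply: ler_sum => e _.
by rewrite !normrM ler_pM ?mulr_ge0// ler_pM.
Qed.

(** The integral form requires only integrable entries, which is what Fubini gives for second
    moments; [lyapunov_lipschitz] recovers regularity at t. *)
Definition lyapunov t T N (S : K -> 'M[K]_n) : Prop :=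
  (forall k l, mu.-integrable `[t, T] (EFin \o (fun s => S s k l))) /\
  forall s, t <= s <= T -> forall k l,
    S s k l = N k l + \int[mu]_(v in `[t, s]) lyap_op v (S v) k l.

Lemma integrable_lyap_op t T (S : K -> 'M[K]_n) k l :
  (forall k l, mu.-integrable `[t, T] (EFin \o (fun s => S s k l))) ->
  mu.-integrable `[t, T] (EFin \o (fun v => lyap_op v (S v) k l)).
Proof.
move=> jS; rewrite (_ : (fun v => _) = fun v => \sum_c A v k c * S v c l +
  \sum_c A v l c * S v k c + \sum_c \sum_e C v k c * (C v l e * S v c e)); last first.
  apply/funext => v; rewrite lyap_opE; congr (_ + _).
  by apply: eq_bigr => c _; apply: eq_bigr => e _; rewrite mulrA.
have mI : measurable (`[t, T]%classic : set (measurableTypeR K)) by exact: measurable_itv.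
have i1 : mu.-integrable `[t, T] (EFin \o (fun v => \sum_c A v k c * S v c l)).
  by apply: integrable_sumE => // c; exact: (integrable_coef_mul _ _ bA).
have i2 : mu.-integrable `[t, T] (EFin \o (fun v => \sum_c A v l c * S v k c)).
  by apply: integrable_sumE => // c; exact: (integrable_coef_mul _ _ bA).
have i3 : mu.-integrable `[t, T] (EFin \o (fun v =>
    \sum_c \sum_e C v k c * (C v l e * S v c e))).
  apply: integrable_sumE => // c; apply: integrable_sumE => // e.
  by do 2 apply: (integrable_coef_mul _ _ bC).
exact: (integrableD mI (integrableD mI i1 i2) i3).
Qed.

Lemma lyapunov_restart t T N S r : t <= r <= T -> lyapunov t T N S ->
  lyapunov r T (S r) S.
Proof.
move=> /andP[tr rT] [jS eS]; split=> [k l|s /andP[rs sT] k l].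
  exact: integrable_itv_sub (jS k l).
rewrite !eS ?tr ?rT ?sT ?(le_trans tr)//.
rewrite (@Rintegral_split _ t s r)// ?addrA//.
by apply: integrable_itv_sub (integrable_lyap_op k l jS).
Qed.

(** The sum f of the absolute entries of S - S' satisfies the hypothesis of [gronwall_zero] with
    constant n^2 c: each of its n^2 entries is at most c times the integral of f. *)
Lemma lyapunov_unique t T N S S' : t <= T -> lyapunov t T N S -> lyapunov t T N S' ->
  forall s, t <= s <= T -> S s = S' s.
Proof.
move=> tT [jS eS] [jS' eS'].
have mI s : measurable (`[t, s]%classic : set (measurableTypeR K)) by exact: measurable_itv.
have [c [c0 hc]] := lyap_op_bound.
pose D s k l := S s k l - S' s k l.
pose f s := \sum_k \sum_l `|D s k l|.
have jD k l : mu.-integrable `[t, T] (EFin \o (fun s => D s k l)).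
  exact: (integrableB (mI T) (jS k l) (jS' k l)).
have f0 s : 0 <= f s by do 2 apply: sumr_ge0 => ? _.
have jf : mu.-integrable `[t, T] (EFin \o f).
  do 2 (apply: integrable_sumE => // ?).
  exact: (integrable_abse (jD _ _)).
have Df s k l : `|D s k l| <= f s.
  rewrite /f (bigD1 k)//= (bigD1 l)//= -addrA lerDl addr_ge0//.
    exact: sumr_ge0.
  by do 2 apply: sumr_ge0 => ? _.
have Df' s k l : t <= s <= T -> `|D s k l| <= c * \int[mu]_(u in `[t, s]) f u.
  move=> tsT; have /andP[ts sT] := tsT.
  have jo := integrable_itv_sub (lexx t) sT (integrable_lyap_op k l jS).
  have jo' := integrable_itv_sub (lexx t) sT (integrable_lyap_op k l jS').
  have jfs := integrable_itv_sub (lexx t) sT jf.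
  have -> : D s k l = \int[mu]_(v in `[t, s]) (lyap_op v (S v) k l - lyap_op v (S' v) k l).
    by rewrite RintegralB// /D eS// eS'//; ring.
  rewrite -RintegralZl//; apply: le_trans (le_normr_Rintegral _ _) _ => //.
    exact: (integrableB (mI s) jo jo').
  apply: le_Rintegral => //.
  - exact: (integrable_abse (integrableB (mI s) jo jo')).
  - by apply: (integrableZl (mI s) c jfs).
  - move=> v _; have := hc v (S v - S' v) (f v) (f0 v).
    rewrite lyap_opB => /(_ _ k l); rewrite !mxE; apply => i j.
    by rewrite !mxE; exact: Df.
have z := @gronwall_zero _ t T (n%:R * (n%:R * c)) f tT _ jf (fun s _ => f0 s) _.
move=> s tsT; apply/matrixP => k l.
suff fs : f s = 0.
  by apply/eqP; rewrite -subr_eq0 -normr_le0 -fs; exact: Df.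
apply: z => // [|r trT].
  by rewrite !mulr_ge0 ?ler0n.
rewrite -!mulrA; have cst (x : K) : n%:R * x = \sum_(i < n) x by rewrite sumr_const card_ord mulr_natl.
rewrite cst; apply: ler_sum => i _; rewrite cst; apply: ler_sum => j _.
exact: Df'.
Qed.

(** A bootstrap: integrability bounds S through the equation, and then the integrand is bounded, so
    the integral is Lipschitz at t. *)
Lemma lyapunov_lipschitz t T N S : t <= T -> lyapunov t T N S ->
  exists B : K, forall s, t <= s <= T -> forall k l, `|S s k l - N k l| <= B * (s - t).
Proof.
move=> tT [jS eS]; have [c [c0 hc]] := lyap_op_bound.
pose I k l := \int[mu]_(v in `[t, T]) `|lyap_op v (S v) k l|.
pose B := \sum_k \sum_l (`|N k l| + I k l).
have I0 k l : 0 <= I k l by apply: Rintegral_ge0.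
have p0 k l : 0 <= `|N k l| + I k l by rewrite addr_ge0.
have B0 : 0 <= B by do 2 apply: sumr_ge0 => ? _.
have jo k l s : s <= T -> mu.-integrable `[t, s] (EFin \o (fun v => lyap_op v (S v) k l)).
  by move=> sT; exact: integrable_itv_sub (integrable_lyap_op k l jS).
have SB s k l : t <= s <= T -> `|S s k l| <= B.
  move=> tsT; have /andP[ts sT] := tsT.
  apply: (@le_trans _ _ (`|N k l| + I k l)); last first.
    rewrite /B (bigD1 k)//= (bigD1 l)//= -addrA lerDl addr_ge0//.
      by apply: sumr_ge0 => ? _.
    by do 2 apply: sumr_ge0 => ? _.
  rewrite eS//; apply: le_trans (ler_normD _ _) _; rewrite lerD2l.
  apply: le_trans (le_normr_Rintegral _ (jo k l s sT)) _ => //.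
  rewrite /I (@Rintegral_split _ t T s)// ?lerDl ?Rintegral_ge0//.
  exact: (integrable_abse (jo k l T (lexx T))).
exists (c * B) => s tsT k l; have /andP[ts sT] := tsT.
rewrite eS// addrAC subrr add0r; apply: Rintegral_norm_le_cst => //; first exact: jo.
move=> v /andP[tv vs]; apply: hc => // i j.
by apply: SB; rewrite tv (le_trans vs).
Qed.

End lyapunov.

(** Lets coefficients be replaced by ones that are bounded on the whole line and agree with them on
    the time interval only. *)
Lemma ito_integral_ext (K : realType) (d : measure_display) (Omega : measurableType d)
    (Pr : probability Omega K) (F : K -> set (set Omega)) (W : K -> Omega -> K)
    (a b : K) (X X' : K -> Omega -> K) (J : Omega -> K) :
  (forall r w, a <= r <= b -> X r w = X' r w) ->
  ito_integral Pr F W a b X J -> ito_integral Pr F W a b X' J.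
Proof.
move=> XX' [[mX aX fX] mJ [H [sH cX cJ]]].
have n2 (Y Y' : K -> Omega -> K) : (forall r w, a <= r <= b -> Y r w = Y' r w) ->
    L2_norm2 Pr a b Y = L2_norm2 Pr a b Y'.
  move=> YY'; apply: eq_integral => w _; apply: eq_integral => r.
  by rewrite inE/= in_itv/= => hr; rewrite YY'.
have cX' : L2_norm2 Pr a b (fun r w => step_fun (H k) r w - X' r w)
    @[k --> \oo] --> (0 : \bar K)%E.
  rewrite -(_ : (fun k => L2_norm2 Pr a b (fun r w => step_fun (H k) r w - X r w)) =
    (fun k => L2_norm2 Pr a b (fun r w => step_fun (H k) r w - X' r w))); first exact: cX.
  by apply/funext => k; apply: n2 => r w hr; rewrite XX'.
split; [|exact: mJ|by exists H; split; [exact: sH|exact: cX'|exact: cJ]].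
split; last by rewrite -(n2 _ _ XX').
  apply: eq_measurable_fun mX => -[r w]; rewrite inE => -[/= hr _].
  by apply: XX'; rewrite in_itv/= in hr.
move=> r hr; rewrite (_ : X' r = X r); first exact: aX.
by apply/funext => w; rewrite XX'.
Qed.

Lemma Rintegral_sum {d : measure_display} {U : measurableType d} {K : realType}
    (mu : {measure set U -> \bar K}) (D : set U) (I : finType) (f : I -> U -> K) :
  measurable D -> (forall i, mu.-integrable D (EFin \o f i)) ->
  \int[mu]_(v in D) \sum_i f i v = \sum_i \int[mu]_(v in D) f i v.
Proof.
move=> mD jf.
have jsum q : mu.-integrable D (EFin \o (fun v => \sum_(i <- q) f i v)).
  elim: q => [|i q IH].
    by rewrite (_ : _ \o _ = cst 0%E) ?integrable0//; apply/funext => v /=; rewrite big_nil.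
  have := integrableD mD (jf i) IH; congr (integrable _ _ _).
  by apply/funext => v /=; rewrite big_cons.
elim: (index_enum I) => [|i q IH].
  by rewrite big_nil; under eq_Rintegral do rewrite big_nil; rewrite /Rintegral integral0.
rewrite big_cons -IH -RintegralD//.
by apply: eq_Rintegral => v _; rewrite big_cons.
Qed.

Section lyap_op_linear.
Context {K : realType}.
Variables (n : nat) (A C : K -> 'M[K]_n) (v : K).
Implicit Types X Y : 'M[K]_n.

Lemma lyap_opD X Y : lyap_op A C v (X + Y) = lyap_op A C v X + lyap_op A C v Y.
Proof.
rewrite /lyap_op !(mulmxDr, mulmxDl); apply/matrixP => i j; rewrite !mxE; ring.
Qed.

Lemma lyap_opZ c X : lyap_op A C v (c *: X) = c *: lyap_op A C v X.
Proof. by rewrite /lyap_op -!(scalemxAr, scalemxAl) !scalerDr. Qed.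

Lemma lyap_op_sum (I : finType) (X : I -> 'M[K]_n) :
  lyap_op A C v (\sum_i X i) = \sum_i lyap_op A C v (X i).
Proof.
elim: (index_enum I) => [|i q IH]; last by rewrite !big_cons lyap_opD IH.
by rewrite !big_nil /lyap_op !(mulmx0, mul0mx) !addr0.
Qed.

End lyap_op_linear.

(** * Second moments of the matrix solution and duality with the cost *)

Section moment_matrix.
Context {K : realType} {d : measure_display} {Omega : measurableType d}.
Variables (Pr : probability Omega K) (W : K -> Omega -> K).
Local Notation F := (augmented_filtration Pr W).
Hypothesis W_bm : brownian_motion Pr F W.
Local Notation mu := (@lebesgue_measure K).
Local Notation nu := (mu \x Pr)%E.
Variables (t T : K) (t0 : 0 <= t) (tT : t <= T) (n : nat).
Variables (A C A' C' : K -> 'M[K]_n).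
Hypotheses (bA : bounded_coef A') (bC : bounded_coef C').
Hypotheses (AA' : forall s, t <= s <= T -> A s = A' s)
  (CC' : forall s, t <= s <= T -> C s = C' s).
Variable Phi : K -> Omega -> 'M[K]_n.
Hypothesis sPhi : linear_sde_solution Pr F W t T A C Phi.
Implicit Types (r s u v : K) (N M : 'M[K]_n).

Let col j k s w := Phi s w k j.

Lemma column_sde j : vector_sde Pr W t T A' C' (col j) (fun k => (k == j)%:R).
Proof.
have [pP _ eP] := sPhi; split=> [k|s tsT]; first exact: pP.
have [J [iJ eJ]] := eP s tsT; have /andP[ts sT] := tsT.
have hT r : t <= r <= s -> t <= r <= T by move=> /andP[-> /le_trans]; exact.
exists (fun k w => J w k j); split=> k.
  apply: ito_integral_ext (iJ k j) => r w hr.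
  by rewrite mxE; apply: eq_bigr => c _; rewrite CC' ?hT.
apply: filterS eJ => w e; rewrite /col e !mxE; congr (_ + _ + _).
apply: eq_Rintegral => r; rewrite inE/= in_itv/= => hr.
by rewrite mxE; apply: eq_bigr => c _; rewrite AA' ?hT.
Qed.

Definition moment k i l j s := ip Pr (col i k s) (col j l s).

(** The matrix E[Phi(s) N Phi(s)^T], expanded in moments of pairs of columns; it is linear in N, and
    N may be arbitrary. *)
Definition moment_mx N s : 'M[K]_n :=
  \matrix_(k, l) \sum_i \sum_j N i j * moment k i l j s.

Lemma integrable_moment4 k i l j :
  mu.-integrable `[t, T] (EFin \o (fun s => moment k i l j s)).
Proof. exact: (integrable_moment (column_sde i) (column_sde j) k l). Qed.

Let S i j v : 'M[K]_n := \matrix_(k, l) moment k i l j v.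

Let moment_mxE N v : moment_mx N v = \sum_i \sum_j N i j *: S i j v.
Proof.
apply/matrixP => k l; rewrite mxE summxE; apply: eq_bigr => i _.
by rewrite summxE; apply: eq_bigr => j _; rewrite !mxE.
Qed.

(** By linearity in N it suffices to treat columns i and j, where [second_moment] applies and the
    initial value is the matrix unit at (i, j). *)
Lemma moment_mx_lyapunov N : lyapunov A' C' t T N (moment_mx N).
Proof.
have mI s : measurable (`[t, s]%classic : set (measurableTypeR K)) by exact: measurable_itv.
have jS i j k l : mu.-integrable `[t, T] (EFin \o (fun s => S i j s k l)).
  have := integrable_moment4 k i l j.
  by congr (integrable _ _ _); apply/funext => v /=; rewrite mxE.
have jN k l : mu.-integrable `[t, T] (EFin \o (fun s => moment_mx N s k l)).
  rewrite (_ : (fun s => _) = fun s => \sum_i \sum_j N i j * moment k i l j s).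
    apply: integrable_sumE => // i; apply: integrable_sumE => // j.
    exact: (integrableZl (mI T) (N i j) (integrable_moment4 k i l j)).
  by apply/funext => s; rewrite mxE.
split=> // s tsT k l; have /andP[ts sT] := tsT.
pose h i j v := lyap_op A' C' v (S i j v) k l.
have jh i j : mu.-integrable `[t, s] (EFin \o h i j).
  exact: integrable_itv_sub (integrable_lyap_op bA bC k l (jS i j)).
have mE i j : moment k i l j s = (k == i)%:R * (l == j)%:R + \int[mu]_(v in `[t, s]) h i j v.
  rewrite /moment (second_moment W_bm t0 bA bC (column_sde i) (column_sde j) k l tsT).
  congr (_ + _); apply: eq_Rintegral => v _; rewrite /h lyap_opE; congr (_ + _ + _).
  - by apply: eq_bigr => c _; rewrite mxE.
  - by apply: eq_bigr => c _; rewrite mxE.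
  - by apply: eq_bigr => c _; apply: eq_bigr => e _; rewrite mxE.
have jNh i j : mu.-integrable `[t, s] (EFin \o (fun v => N i j * h i j v)).
  exact: (integrableZl (mI s) (N i j) (jh i j)).
transitivity (\sum_i \sum_j (N i j * ((k == i)%:R * (l == j)%:R) +
    \int[mu]_(v in `[t, s]) (N i j * h i j v))).
  rewrite mxE; apply: eq_bigr => i _; apply: eq_bigr => j _.
  by rewrite mE mulrDr RintegralZl.
under eq_bigr do rewrite big_split/=.
rewrite big_split/=; congr (_ + _).
  rewrite (bigD1 k)//= [X in _ + X]big1 ?addr0; last first.
    by move=> i ik; apply: big1 => j _; rewrite eq_sym (negbTE ik) mul0r mulr0.
  rewrite (bigD1 l)//= [X in _ + X]big1 ?addr0; last first.
    by move=> j jl; rewrite [l == j]eq_sym (negbTE jl) !mulr0.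
  by rewrite !eqxx !mulr1.
under eq_bigr do rewrite -Rintegral_sum//.
rewrite -Rintegral_sum//; last by move=> i; exact: integrable_sumE.
apply: eq_Rintegral => v _; rewrite moment_mxE lyap_op_sum summxE.
apply: eq_bigr => i _; rewrite lyap_op_sum summxE.
by apply: eq_bigr => j _; rewrite lyap_opZ mxE.
Qed.

Lemma L2_col k j s : t <= s <= T -> L2 Pr (col j k s).
Proof. by move=> ts; exact: (L2_sol_at W_bm t0 bA (column_sde j)). Qed.

(** With M and N decomposed into terms w w^T and v v^T, each contribution is the second moment of
    the scalar Z = w^T Phi v. *)
Lemma moment_mx_psd M N s : t <= s <= T -> psd M -> psd N ->
  0 <= pair M (moment_mx N s).
Proof.
move=> tsT /psd_sum_rank1[rM ->] /psd_sum_rank1[rN ->].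
rewrite pair_suml; apply: sumr_ge0 => w _.
have -> : moment_mx (\sum_(v <- rN) v *m v^T) s = \sum_(v <- rN) moment_mx (v *m v^T) s.
  apply/matrixP => k l; rewrite summxE mxE.
  under [RHS]eq_bigr do rewrite mxE.
  rewrite [RHS]exchange_big/=; apply: eq_bigr => i _.
  rewrite [RHS]exchange_big/=; apply: eq_bigr => j _.
  by rewrite summxE big_distrl.
rewrite pairC pair_suml; apply: sumr_ge0 => v _.
pose Z := fun om => \sum_k \sum_i (w k 0 * v i 0) * col i k s om.
rewrite (_ : pair _ _ = ip Pr Z Z); first exact: ip_ge0.
have lc k i : L2 Pr (fun om => (w k 0 * v i 0) * col i k s om).
  by apply: L2Z; exact: L2_col.
have lZ : L2 Pr Z by do 2 (apply: L2_sum => ?); exact: lc.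
rewrite {1}/Z ip_suml//; last by move=> k; apply: L2_sum => i; exact: lc.
rewrite /pair; apply: eq_bigr => k _.
rewrite ip_suml//.
under [LHS]eq_bigr => l _.
  rewrite mxE big_distrl/=; under eq_bigr do rewrite big_distrl/=.
  over.
rewrite /= exchange_big/=; apply: eq_bigr => i _.
rewrite ipZl//; last exact: L2_col.
rewrite /Z ip_sumr//; [|by move=> l; apply: L2_sum => j; exact: lc|exact: L2_col].
rewrite mulr_sumr; apply: eq_bigr => l _; rewrite ip_sumr//; last exact: L2_col.
rewrite mulr_sumr; apply: eq_bigr => j _; rewrite ipZr//; try exact: L2_col.
rewrite /moment !mxE !big_ord1 !mxE; ring.
Qed.

Section quadratic_cost.
Variables (G P : 'M[K]_n) (q q' : K -> 'M[K]_n).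
Hypotheses (bq : bounded_coef q') (qq' : forall s, t <= s <= T -> q s = q' s).
Hypothesis P_cost : forall i j, (P i j)%:E = 'E_Pr[fun w =>
  (((Phi T w)^T *m G *m Phi T w +
   mx_Rintegral `[t, T] (fun s => (Phi s w)^T *m q s *m Phi s w)) i j)%R]%E.

Let quadE (X Y : 'M[K]_n) i j :
  (X^T *m Y *m X) i j = \sum_k \sum_l Y k l * (X k i * X l j).
Proof.
rewrite mxE exchange_big/=; apply: eq_bigr => l _.
rewrite mxE big_distrl/=; apply: eq_bigr => k _; rewrite mxE; ring.
Qed.

Let running i j k l (z : measurableTypeR K * Omega) : K :=
  on_itv t T (fun u w => q' u k l * col i k u w) z * on_itv t T (col j l) z.

Let L2_running i k l : L2 nu (on_itv t T (fun u w => q' u k l * col i k u w)).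
Proof.
have [mq [M bM]] := bq.
apply: (@L2_on_itv_mul _ _ _ _ _ _ (fun u => q' u k l) M (col i k)) => //.
exact: (L2_sol (column_sde i)).
Qed.

Let integrable_running i j k l : nu.-integrable setT (EFin \o running i j k l).
Proof. by apply: L2_mul; [exact: L2_running|exact: (L2_sol (column_sde j))]. Qed.

(** Each term of the running cost is a product of two square-integrable processes, hence integrable
    for time and chance jointly, so expectation and time integral commute. *)
Lemma cost_entry i j : P i j = \sum_k \sum_l G k l * moment k i l j T +
  \int[mu]_(s in `[t, T]) \sum_k \sum_l q' s k l * moment k i l j s.
Proof.
have tTT : t <= T <= T by rewrite tT lexx.
pose g z := \sum_k \sum_l running i j k l z.
have jg : nu.-integrable setT (EFin \o g).
  by do 2 (apply: integrable_sumE => // ?); exact: integrable_running.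
pose Z w := \sum_k \sum_l G k l * (col i k T w * col j l T w).
have jZ : Pr.-integrable setT (EFin \o Z).
  do 2 (apply: integrable_sumE => // ?).
  by apply: integrableZE; apply: L2_mul; exact: L2_col.
have gE s w : t <= s <= T -> g (s, w) = ((Phi s w)^T *m q s *m Phi s w) i j.
  move=> hs; rewrite quadE; apply: eq_bigr => k _; apply: eq_bigr => l _.
  by rewrite /running !on_itvE// qq'// mulrA.
have g0 s w : ~~ (t <= s <= T) -> g (s, w) = 0.
  by move=> hs; do 2 (apply: big1 => ? _); rewrite /running on_itv_out// mul0r.
have -> : P i j = \int[Pr]_w (Z w + \int[mu]_s g (s, w)).
  apply: EFin_inj; rewrite P_cost expectation.unlock.
  have jt := integrableDE jZ (Rintegrable_inner2 jg).
  rewrite /Rintegral fineK; last exact: integrable_fin_num.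
  apply: eq_integral => w _; congr EFin; rewrite mxE quadE; congr (_ + _).
  rewrite mxE [LHS]Rintegral_mkcond; apply: eq_Rintegral => s _.
  rewrite patchE mem_setE in_itv/=; case: ifPn => hs; first by rewrite gE.
  by rewrite g0.
rewrite RintegralD//; last exact: (Rintegrable_inner2 jg).
congr (_ + _).
  rewrite Rintegral_sum// => [|k]; last first.
    apply: integrable_sumE => // l.
    by apply: integrableZE; apply: L2_mul; exact: L2_col.
  apply: eq_bigr => k _; rewrite Rintegral_sum// => [|l]; last first.
    by apply: integrableZE; apply: L2_mul; exact: L2_col.
  apply: eq_bigr => l _; rewrite RintegralZl//.
  by apply: L2_mul; exact: L2_col.
rewrite (Rintegral21 jg) -(Rintegral12 jg) [RHS]Rintegral_mkcond.
apply: eq_Rintegral => s _; rewrite patchE mem_setE in_itv/=; case: ifPn => hs; last first.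
  by rewrite /Rintegral integral0_eq// => w _; rewrite g0.
rewrite (_ : (fun w => g (s, w)) = fun w => \sum_k \sum_l q' s k l *
    (col i k s w * col j l s w)); last first.
  by apply/funext => w; rewrite gE// quadE qq'.
rewrite Rintegral_sum// => [|k]; last first.
  apply: integrable_sumE => // l.
  by apply: integrableZE; apply: L2_mul; exact: L2_col.
apply: eq_bigr => k _; rewrite Rintegral_sum// => [|l]; last first.
  by apply: integrableZE; apply: L2_mul; exact: L2_col.
apply: eq_bigr => l _; rewrite RintegralZl//.
by apply: L2_mul; exact: L2_col.
Qed.

Lemma integrable_cost N :
  mu.-integrable `[t, T] (EFin \o (fun s => pair (q s) (moment_mx N s))).
Proof.
have j0 : mu.-integrable `[t, T]
    (EFin \o (fun s => \sum_k \sum_l q' s k l * moment_mx N s k l)).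
  do 2 (apply: integrable_sumE => // ?); apply: integrable_coef_mul => //.
  by have [jN _] := moment_mx_lyapunov N; exact: jN.
apply: eq_integrable j0 => // s; rewrite inE/= in_itv/= => hs.
by rewrite /pair qq'.
Qed.

(** Duality <Phi^T Y Phi, N> = <Y, Phi N Phi^T>, that is, an exchange of the sums over (i, j) and
    (k, l). *)
Lemma pair_cost N : pair P N = pair G (moment_mx N T) +
  \int[mu]_(s in `[t, T]) pair (q s) (moment_mx N s).
Proof.
have mI : measurable (`[t, T]%classic : set (measurableTypeR K)) by exact: measurable_itv.
have jc i j k l : mu.-integrable `[t, T] (EFin \o (fun s => q' s k l * moment k i l j s)).
  by apply: integrable_coef_mul => //; exact: integrable_moment4.
have jc2 i j : mu.-integrable `[t, T]
    (EFin \o (fun s => \sum_k \sum_l q' s k l * moment k i l j s)).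
  by do 2 (apply: integrable_sumE => // ?); exact: jc.
have swap (Y : 'M[K]_n) s : \sum_i \sum_j (\sum_k \sum_l Y k l * moment k i l j s) * N i j =
    pair Y (moment_mx N s).
  rewrite /pair; under [RHS]eq_bigr => k _.
    under eq_bigr => l _.
      rewrite mxE mulr_sumr; under eq_bigr do rewrite mulr_sumr.
      over.
    rewrite exchange_big/=; under eq_bigr do rewrite exchange_big/=.
    over.
  rewrite /= [RHS]exchange_big/=; apply: eq_bigr => i _.
  rewrite [RHS]exchange_big/=; apply: eq_bigr => j _.
  rewrite mulr_suml; apply: eq_bigr => k _; rewrite mulr_suml; apply: eq_bigr => l _.
  ring.
transitivity (\sum_i \sum_j ((\sum_k \sum_l G k l * moment k i l j T) * N i j +
    \int[mu]_(s in `[t, T]) ((\sum_k \sum_l q' s k l * moment k i l j s) * N i j))).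
  apply: eq_bigr => i _; apply: eq_bigr => j _.
  by rewrite cost_entry mulrDl RintegralZr.
under eq_bigr do rewrite big_split/=.
rewrite big_split/= swap; congr (_ + _).
have jN i j : mu.-integrable `[t, T]
    (EFin \o (fun s => (\sum_k \sum_l q' s k l * moment k i l j s) * N i j)).
  exact: (integrableZr mI (N i j) (jc2 i j)).
under eq_bigr do rewrite -Rintegral_sum//.
rewrite -Rintegral_sum//; last by move=> i; exact: integrable_sumE.
apply: eq_Rintegral => s; rewrite inE/= in_itv/= => hs.
by rewrite swap qq'.
Qed.

End quadratic_cost.

End moment_matrix.

(** * Continuity on [0, T] *)

Section continuous_entries.
Context {K : realType}.
Variable T : K.
Local Notation I := (`[0, T]%classic : set K).

(** Continuity is handled entrywise with scalars: sums and products suffice for the matrix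
    operations, and Cramer's rule reduces the inverse to determinants and one division. *)
Definition icont (f : K -> K) : Prop :=
  forall s, I s -> f u @[u --> within I (nbhs s)] --> f s.

Definition mx_icont (p q : nat) (M : K -> 'M[K]_(p, q)) : Prop :=
  forall i j, icont (fun s => M s i j).

Lemma icontP (f : K -> K) : icont f <-> {within I, continuous f}.
Proof. by split => h; apply/subspace_continuousP. Qed.

Lemma icont_cst (c : K) : icont (fun=> c).
Proof. by move=> s _; exact: cvg_cst. Qed.

Lemma icontD (f g : K -> K) : icont f -> icont g -> icont (fun s => f s + g s).
Proof. by move=> cf cg s Is; apply: cvgD; [exact: cf|exact: cg]. Qed.

Lemma icontM (f g : K -> K) : icont f -> icont g -> icont (fun s => f s * g s).
Proof. by move=> cf cg s Is; apply: cvgM; [exact: cf|exact: cg]. Qed.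

Lemma icont_sum (J : Type) (r : seq J) (P : pred J) (f : J -> K -> K) :
  (forall j, icont (f j)) -> icont (fun s => \sum_(j <- r | P j) f j s).
Proof.
move=> cf; elim: r => [|j r IH].
  by under eq_fun do rewrite big_nil; exact: icont_cst.
under eq_fun do rewrite big_cons.
by case: (P j) => //; exact: icontD.
Qed.

Lemma icont_prod (J : Type) (r : seq J) (P : pred J) (f : J -> K -> K) :
  (forall j, icont (f j)) -> icont (fun s => \prod_(j <- r | P j) f j s).
Proof.
move=> cf; elim: r => [|j r IH].
  by under eq_fun do rewrite big_nil; exact: icont_cst.
under eq_fun do rewrite big_cons.
by case: (P j) => //; exact: icontM.
Qed.

Lemma icontV (f : K -> K) : (forall s, I s -> f s != 0) -> icont f ->
  icont (fun s => (f s)^-1).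
Proof. by move=> f0 cf s Is; apply: cvgV; [exact: f0|exact: cf]. Qed.

Lemma icont_sqrt (f : K -> K) : icont f -> icont (fun s => Num.sqrt (f s)).
Proof.
move=> cf s Is; apply: (cvg_comp _ Num.sqrt (cf s Is)).
exact: sqrt_continuous.
Qed.

Lemma icont_eq (f g : K -> K) : (forall s, I s -> f s = g s) -> icont f -> icont g.
Proof.
move=> fg cf s Is; rewrite -fg//; apply: cvg_trans (cf s Is).
apply: near_eq_cvg; near=> u; apply: fg; near: u; exact: withinT.
Unshelve. all: by end_near. Qed.

Lemma icont_within (D : set (K * K)) (phi : K -> K * K) (f : K * K -> K) :
  {within D, continuous f} -> continuous phi -> (forall s, I s -> D (phi s)) ->
  icont (fun s => f (phi s)).
Proof.
move=> /subspace_continuousP cf cphi Dphi s Is.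
have := cf _ (Dphi s Is).
move=> h; apply: (@cvg_comp _ _ _ phi f (within I (nbhs s)) (within D (nbhs (phi s)))) => //.
move=> U; rewrite /within/= => DU.
have := cphi s _ DU; rewrite /nbhs/= => hU.
near=> u => Iu; have : D (phi u) -> U (phi u) by near: u; exact: hU.
by apply; exact: Dphi.
Unshelve. all: by end_near. Qed.

Lemma mx_icont_entries (p q : nat) (M : K -> 'M[K]_(p, q)) :
  {within I, continuous M} -> mx_icont M.
Proof.
move=> /subspace_continuousP cM i j s Is.
apply: (cvg_comp _ (fun N : 'M[K]_(p, q) => N i j) (cM s Is)).
exact: coord_continuous.
Qed.

Lemma mx_icont_within (p q : nat) (D : set (K * K)) (phi : K -> K * K)
    (M : K * K -> 'M[K]_(p, q)) :
  {within D, continuous M} -> continuous phi -> (forall s, I s -> D (phi s)) ->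
  mx_icont (fun s => M (phi s)).
Proof.
move=> /subspace_continuousP cM cphi Dphi i j.
apply: (@icont_within D phi (fun z => M z i j)) => //.
apply/subspace_continuousP => z Dz.
apply: (cvg_comp _ (fun N : 'M[K]_(p, q) => N i j) (cM z Dz)).
exact: coord_continuous.
Qed.

Lemma mx_icontD (p q : nat) (M N : K -> 'M[K]_(p, q)) : mx_icont M -> mx_icont N ->
  mx_icont (fun s => M s + N s).
Proof.
by move=> cM cN i j; under eq_fun do rewrite mxE; exact: icontD.
Qed.

Lemma mx_icontN (p q : nat) (M : K -> 'M[K]_(p, q)) : mx_icont M ->
  mx_icont (fun s => - M s).
Proof.
move=> cM i j; under eq_fun do rewrite mxE -mulN1r.
by apply: icontM => //; exact: icont_cst.
Qed.

Lemma mx_icont_tr (p q : nat) (M : K -> 'M[K]_(p, q)) : mx_icont M ->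
  mx_icont (fun s => (M s)^T).
Proof. by move=> cM i j; under eq_fun do rewrite mxE; exact: cM. Qed.

Lemma mx_icontM (p q r : nat) (M : K -> 'M[K]_(p, q)) (N : K -> 'M[K]_(q, r)) :
  mx_icont M -> mx_icont N -> mx_icont (fun s => M s *m N s).
Proof.
move=> cM cN i j; under eq_fun do rewrite mxE.
by apply: icont_sum => k; exact: icontM.
Qed.

Lemma icont_det (p : nat) (M : K -> 'M[K]_p) : mx_icont M -> icont (fun s => \det (M s)).
Proof.
move=> cM; rewrite /determinant; apply: icont_sum => g.
by apply: icontM; [exact: icont_cst|exact: icont_prod].
Qed.

Lemma mx_icont_inv (p : nat) (M : K -> 'M[K]_p) : (forall s, I s -> M s \in unitmx) ->
  mx_icont M -> mx_icont (fun s => invmx (M s)).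
Proof.
move=> uM cM i j.
apply: (@icont_eq (fun s => (\det (M s))^-1 * cofactor (M s) j i)).
  by move=> u /uM Mu; rewrite /invmx Mu !mxE.
apply: icontM.
  by apply: icontV (icont_det cM) => u /uM; rewrite unitmxE unitfE.
rewrite /cofactor; apply: icontM; first exact: icont_cst.
apply: icont_det => k l; under eq_fun do rewrite !mxE; exact: cM.
Qed.

Lemma icont_frobenius (p q : nat) (M : K -> 'M[K]_(p, q)) : mx_icont M ->
  icont (fun s => frobenius (M s)).
Proof.
move=> cM; apply: icont_sqrt; apply: icont_sum => i; apply: icont_sum => j.
by under eq_fun do rewrite expr2; exact: icontM.
Qed.

Lemma icont_integrable (f : K -> K) : icont f ->
  (@lebesgue_measure K).-integrable I (EFin \o f).
Proof.
move=> /icontP cf; apply: continuous_compact_integrable => //.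
exact: segment_compact.
Qed.

Hypothesis T0 : 0 <= T.

Lemma icont_right (f : K -> K) t : 0 <= t -> t < T -> icont f ->
  f u @[u --> t^'+] --> f t.
Proof.
move=> t0 tT /icontP cf; have T_gt0 : 0 < T by exact: le_lt_trans tT.
have [cin c0 _] := (continuous_within_itvP f T_gt0).1 cf.
move: t0; rewrite le_eqVlt => /predU1P[<-//|t0].
by apply: cvg_at_right_filter; apply: cin; rewrite in_itv/= t0.
Qed.

Lemma icont_bounded (f : K -> K) : icont f -> exists M : K, forall s, I s -> `|f s| <= M.
Proof.
move=> cf; have cf2 : icont (fun s => f s * f s) by exact: icontM.
have [c cI hc] := EVT_max T0 ((icontP _).1 cf2).
exists (Num.sqrt (f c * f c)) => s Is.
rewrite -sqrtr_sqr ler_wsqrtr// expr2; apply: hc.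
by move: Is; rewrite /= .
Qed.

Lemma bounded_coef_icont (n : nat) (M : K -> 'M[K]_n) : mx_icont M ->
  bounded_coef (fun s => if 0 <= s <= T then M s else 0).
Proof.
move=> cM; split=> [k c|].
  have mI : measurable (`[0, T]%classic : set K) by exact: measurable_itv.
  have := (subspace_continuous_measurable_fun mI ((icontP _).1 (cM k c))).
  move=> /(measurable_restrictT _ mI).1; congr measurable_fun.
  apply/funext => s; rewrite patchE mem_setE in_itv/=.
  by case: ifP => //; rewrite mxE.
have hb i j := icont_bounded (cM i j).
pose B i j := projT1 (cid (hb i j)).
have hB i j s : I s -> `|M s i j| <= `|B i j|.
  move=> Is; apply: le_trans (ler_norm _).
  by rewrite /B; case: cid => b /= h; exact: h.
exists (\sum_i \sum_j `|B i j|) => s k c.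
have p0 : 0 <= \sum_i \sum_j `|B i j| by do 2 (apply: sumr_ge0 => ? _).
case: ifP => hs; last by rewrite mxE normr0.
apply: le_trans (hB k c s _) _; first by rewrite /= in_itv.
rewrite (bigD1 k)//= (bigD1 c)//= -addrA lerDl addr_ge0//.
  by apply: sumr_ge0.
by do 2 (apply: sumr_ge0 => ? _).
Qed.

End continuous_entries.

Lemma cvg_sumr {K : realType} {X : Type} (FF : set_system X) {fFF : Filter FF}
    (J : Type) (q : seq J) (f : J -> X -> K) (l : J -> K) :
  (forall j, f j x @[x --> FF] --> l j) ->
  \sum_(j <- q) f j x @[x --> FF] --> \sum_(j <- q) l j.
Proof.
by move=> fl; apply: cvg_big => //; exact: add_continuous.
Qed.

(** * Behaviour of Lyapunov solutions at the initial time *)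

Section lyapunov_right_derivative.
Context {K : realType}.
Variables (n : nat) (A C : K -> 'M[K]_n).
Hypotheses (bA : bounded_coef A) (bC : bounded_coef C).

Lemma lyapunov_start (t T : K) N S : t <= T -> lyapunov A C t T N S -> S t = N.
Proof.
move=> tT [_ eS]; apply/matrixP => k l.
by rewrite eS ?lexx// set_itv1 Rintegral_set1 addr0.
Qed.

Lemma lyapunov_right_cvg (t T : K) N S k l : t < T -> lyapunov A C t T N S ->
  S u k l @[u --> t^'+] --> N k l.
Proof.
move=> tT lS; have [B hB] := lyapunov_lipschitz bA bC (ltW tT) lS.
apply/cvgrPdist_le => e e0; near=> r.
have tr : t < r by near: r; exact: nbhs_right_gt.
have rT : r <= T by near: r; exact: nbhs_right_le.
rewrite distrC; apply: le_trans (hB r _ k l) _; first by rewrite (ltW tr).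
apply: (@le_trans _ _ ((`|B| + 1) * (r - t))).
  by rewrite ler_wpM2r ?subr_ge0 ?(ltW tr)// (le_trans (ler_norm _))// lerDl.
rewrite mulrC -ler_pdivlMr; last by rewrite ltr_wpDl.
rewrite lerBlDl; near: r; apply: nbhs_right_le.
by rewrite ltrDl divr_gt0// ltr_wpDl.
Unshelve. all: by end_near. Qed.

Lemma lyapunov_right_derivative (t T : K) N S k l : t < T -> lyapunov A C t T N S ->
  (forall k l, A u k l @[u --> t^'+] --> A t k l) ->
  (forall k l, C u k l @[u --> t^'+] --> C t k l) ->
  (fun r => (r - t)^-1 * (S r k l - N k l)) @ t^'+ --> lyap_op A C t N k l.
Proof.
move=> tT lS cA cC; have [jS eS] := lS.
have jo := integrable_lyap_op bA bC k l jS.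
have cS i j : S u i j @[u --> t^'+] --> N i j by apply: lyapunov_right_cvg tT _; exact: lS.
have co : lyap_op A C u (S u) k l @[u --> t^'+] --> lyap_op A C t N k l.
  under eq_fun do rewrite lyap_opE.
  rewrite lyap_opE; apply: cvgD; first apply: cvgD.
  - by apply: cvg_sumr => c; apply: cvgM; [exact: cA|exact: cS].
  - by apply: cvg_sumr => c; apply: cvgM; [exact: cA|exact: cS].
  - apply: cvg_sumr => c; apply: cvg_sumr => e; apply: cvgM; last exact: cS.
    by apply: cvgM; exact: cC.
apply: cvg_trans (average_cvg tT jo co); apply: near_eq_cvg; near=> r.
have tr : t < r by near: r; exact: nbhs_right_gt.
have rT : r <= T by near: r; exact: nbhs_right_le.
by rewrite eS ?(ltW tr)// addrAC subrr add0r.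
Unshelve. all: by end_near. Qed.

End lyapunov_right_derivative.

Lemma pair_mulmxr {K : realType} (p q r : nat) (X : 'M[K]_(p, q)) (Z : 'M[K]_(p, r))
    (Y : 'M[K]_(r, q)) : pair X (Z *m Y) = pair (X *m Y^T) Z.
Proof. by rewrite -pair_tr trmx_mul pair_mulmx trmxK -pair_tr trmx_mul !trmxK. Qed.

(** A vector in the left kernel has form 0, hence norm 0 by coercivity. *)
Lemma unitmx_form {K : realType} (p : nat) (M : 'M[K]_p) (delta : K) : 0 < delta ->
  (forall x, delta * pair x x <= form M x x) -> M \in unitmx.
Proof.
move=> d0 hM; rewrite -row_free_unit; apply: inj_row_free => v vM.
have := hM v^T; rewrite /form trmxK vM mul0mx mxE pmulr_rle0// => h.
have v0 : v^T = 0 by apply: pair_eq0; apply/le_anti; rewrite h pair_ge0.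
by rewrite -[v]trmxK v0 trmx0.
Qed.

(** * The value of the closed loop *)

(** With the integrating factor E(s) = exp of the integral of a over [0, s], the function u(s) =
    f(s) E(s) + b E(T) s is nondecreasing, and E >= 1 turns u(t) <= u(T) into the bound. Using b
    E(T), at least b E(s), keeps the correction linear in s. *)
Lemma gronwall_dini {K : realType} (T b : K) (a f : K -> K) : 0 < T -> 0 <= b ->
  icont T a -> icont T f ->
  (forall s : K, 0 <= s <= T -> 0 <= a s) -> (forall s : K, 0 <= s <= T -> 0 <= f s) ->
  (forall t : K, 0 <= t -> t < T -> 0 < f t -> exists (chi : K -> K) (l : K),
    [/\ chi @ t^'+ --> l, l <= a t * f t + b
      & \forall r \near t^'+, f t - f r <= (r - t) * chi r]) ->
  forall t : K, 0 <= t <= T ->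
    f t <= (f T + T * b) * expR (\int[lebesgue_measure]_(s in `[0, T]) a s).
Proof.
move=> T0 b0 ca cf a0 f0 step t0 /andP[t00 t0T].
pose J s := \int[@lebesgue_measure K]_(u in `[0, s]) a u.
pose E s := expR (J s).
have ja : (@lebesgue_measure K).-integrable `[0, T] (EFin \o a) by exact: icont_integrable.
have split_J (s r : K) : 0 <= s -> s <= r -> r <= T ->
    J r = J s + \int[@lebesgue_measure K]_(u in `[s, r]) a u.
  by move=> s0 sr rT; apply: Rintegral_split => //; exact: integrable_itv_sub ja.
have E_le (s r : K) : 0 <= s -> s <= r -> r <= T -> E s <= E r.
  move=> s0 sr rT; rewrite ler_expR (split_J s r)// lerDl; apply: Rintegral_ge0_itv.
  by move=> u /andP[su ur]; rewrite a0// (le_trans s0)//= (le_trans ur).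
have E1 (s : K) : 0 <= s -> s <= T -> 1 <= E s.
  move=> s0 sT; rewrite -(@expR0 K) ler_expR; apply: Rintegral_ge0_itv.
  by move=> u /andP[u0 us]; rewrite a0// u0 (le_trans us).
have cE : icont T E.
  have cJ := (icontP T _).2 (parameterized_integral_continuous (ltW T0) ja).
  move=> s Is; apply: (cvg_comp _ expR (cJ s Is)).
  exact: continuous_expR.
pose u s := f s * E s + b * E T * s.
have cu : icont T u.
  apply: icontD; first exact: icontM.
  by apply: icontM; [exact: icont_cst|move=> s _; exact: cvg_within].
have : u t0 <= u T.
  apply: dini_nondecreasing => //.
    apply: continuous_subspaceW ((icontP T _).1 cu).
    by apply: subset_itv; rewrite bnd_simp.
  move=> t e tt tT e0; have t_0 : 0 <= t := le_trans t00 tt.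
  (* The hypothesis [step] is silent where f vanishes; there f E cannot go below its value 0 and the
     linear term grows. *)
  have [ft0|] := eqVneq (f t) 0.
    near=> r; have tr : t < r by near: r; exact: nbhs_right_gt.
    have rT : r <= T by near: r; exact: nbhs_right_le.
    have r0 : 0 <= r := le_trans t_0 (ltW tr).
    apply: (@le_trans _ _ 0); last by rewrite mulr_ge0 ?subr_ge0 ?ltW.
    have h1 : 0 <= f r * E r by rewrite mulr_ge0 ?expR_ge0// f0// r0.
    have h2 : 0 <= b * E T * (r - t) by rewrite !mulr_ge0 ?expR_ge0// subr_ge0 ltW.
    rewrite /u ft0 mul0r add0r; move: h1 h2; rewrite mulrBr.
    by move: (f r * _) (b * _ * r) (b * _ * t) => x1 x2 x3 h1 h2; lra.
  move=> ft; have {ft}ft : 0 < f t by rewrite lt_neqAle eq_sym ft f0// t_0 ltW.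
  have [chi [l [chil la chir]]] := step t t_0 tT ft.
  pose av r := (r - t)^-1 * \int[@lebesgue_measure K]_(v in `[t, r]) a v.
  have avl : av @ t^'+ --> a t.
    apply: (average_cvg tT (integrable_itv_sub t_0 (lexx T) ja)).
    exact: (icont_right t_0 tT ca).
  have fl : f @ t^'+ --> f t by exact: (icont_right t_0 tT cf).
  (* This expression times r - t bounds u(t) - u(r): E is not differentiated but bounded below by 1
     + x <= exp x. Its limit is at most b E(t) - b E(T) <= 0. *)
  have gl : (fun r => E t * (chi r - f r * av r) - b * E T) @ t^'+ -->
      (E t * (l - f t * a t) - b * E T : K).
    apply: cvgB; last exact: cvg_cst.
    by apply: cvgM; [exact: cvg_cst|apply: cvgB => //; exact: cvgM].
  have ge : E t * (l - f t * a t) - b * E T < e.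
    apply: le_lt_trans e0; rewrite subr_le0.
    apply: (@le_trans _ _ (E t * b)).
      by rewrite ler_wpM2l ?expR_ge0// lerBlDr addrC [f t * _]mulrC.
    rewrite [b * E T]mulrC; apply: (ler_wpM2r b0).
    exact: (E_le _ _ t_0 (ltW tT) (lexx T)).
  have gn := cvgr_le _ gl _ ge; near=> r.
  have tr : t < r by near: r; exact: nbhs_right_gt.
  have rT : r <= T by near: r; exact: nbhs_right_le.
  have r0 : 0 <= r := le_trans t_0 (ltW tr).
  have h0 : 0 < r - t by rewrite subr_gt0.
  have hchi : f t - f r <= (r - t) * chi r by near: r; exact: chir.
  have hg : E t * (chi r - f r * av r) - b * E T <= e by near: r; exact: gn.
  have Er : E t * (1 + (r - t) * av r) <= E r.
    rewrite /E (split_J t r)// ?(ltW tr)// expRD ler_wpM2l ?expR_ge0//.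
    apply: le_trans (expR_ge1Dx _); rewrite lerD2l /av mulrA mulfV ?mul1r//.
    by rewrite gt_eqF.
  have fr0 : 0 <= f r by rewrite f0// r0.
  have Et : 0 <= E t by exact: expR_ge0.
  have h1 : f r * (E t * (1 + (r - t) * av r)) <= f r * E r by exact: (ler_wpM2l fr0 Er).
  have h2 : E t * (f t - f r) <= E t * ((r - t) * chi r).
    exact: (ler_wpM2l Et hchi).
  have h3 : (r - t) * (E t * (chi r - f r * av r) - b * E T) <= (r - t) * e.
    by rewrite ler_wpM2l// ltW.
  rewrite /u; move: h1 h2 h3; move: (E r) (E t) (E T) (av r) (chi r) (f t) (f r).
  by clear => x1 x2 x3 x4 x5 x6 x7 h1 h2 h3; lra.
rewrite /u => h; have E10 := E1 _ t00 t0T; have ft0 : 0 <= f t0 by rewrite f0// t00.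
have h4 : f t0 * 1 <= f t0 * E t0 by rewrite ler_wpM2l.
have h5 : 0 <= b * E T * t0 by exact: mulr_ge0 (mulr_ge0 b0 (expR_ge0 _)) t00.
rewrite -/(J T) -/(E T); move: (E T) (E t0) (f t0) (f T) h h4 h5.
by clear => x1 x2 x3 x4 h h4 h5; lra.
Unshelve. all: by end_near. Qed.

Lemma psd_add {K : realType} (n : nat) (X Y : 'M[K]_n) : psd X -> psd Y -> psd (X + Y).
Proof.
move=> [sX pX] [sY pY]; split; first by rewrite /mx_symmetric linearD/= sX sY.
by move=> x; rewrite mulmxDr mulmxDl mxE addr_ge0.
Qed.

Lemma psd_congr {K : realType} (n m : nat) (X : 'M[K]_m) (Y : 'M[K]_(m, n)) :
  psd X -> psd (Y^T *m X *m Y).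
Proof.
move=> [sX pX]; split; first by rewrite /mx_symmetric !trmx_mul trmxK sX mulmxA.
by move=> x; have := pX (Y *m x); rewrite trmx_mul !mulmxA.
Qed.

(* Completing the square with respect to the feedback. *)
Lemma feedback_energy {K : realType} (n m : nat) (A C P Q : 'M[K]_n)
    (B D : 'M[K]_(n, m)) (R : 'M[K]_m) (Theta : 'M[K]_(m, n)) :
  P^T = P -> R^T = R ->
  (R + D^T *m P *m D) *m Theta = - (B^T *m P + D^T *m P *m C) ->
  let A' := A + B *m Theta in let C' := C + D *m Theta in
  pair P (A' *m P + P *m A'^T + C' *m P *m C'^T) +
    pair (Q + Theta^T *m R *m Theta) P =
  pair (A^T *m P + P *m A + C^T *m P *m C + Q) P -
    pair (Theta^T *m (R + D^T *m P *m D) *m Theta) P.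
Proof.
move=> sP sR hTheta A' C'.
have sL : (R + D^T *m P *m D)^T = R + D^T *m P *m D.
  by rewrite [LHS]raddfD/= sR !trmx_mul trmxK sP mulmxA.
have sM : (B^T *m P + D^T *m P *m C)^T = P *m B + C^T *m P *m D.
  by rewrite [LHS]raddfD/= !trmx_mul !trmxK sP mulmxA.
have hTheta' : Theta^T *m (R + D^T *m P *m D) = - (P *m B + C^T *m P *m D).
  by have := congr1 trmx hTheta; rewrite trmx_mul sL => ->; rewrite raddfN/= sM.
rewrite !pairDr pair_mulmx pair_mulmxr trmxK pair_mulmxr trmxK pair_mulmx.
rewrite -!pairDl -pairBl; congr (pair _ P).
(* The equation for [Theta] and its transpose show that each cross term, with its sign, equals the
   square itself; the identity is x = x + x - x, written so that the terms linear in [Theta]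
   cancel. *)
have e : Theta^T *m (R + D^T *m P *m D) *m Theta =
    - (Theta^T *m (B^T *m P + D^T *m P *m C)) - (P *m B + C^T *m P *m D) *m Theta -
    Theta^T *m (R + D^T *m P *m D) *m Theta.
  by rewrite -[X in _ = X - _ - _]mulmxN -hTheta -mulNmx -hTheta' !mulmxA addrK.
rewrite {}e /A' /C' !raddfD/= !trmx_mul !(mulmxDl, mulmxDr, mulmxA, opprD, opprK).
by apply/matrixP => i j; rewrite !mxE; ring.
Qed.

Lemma energy_bound {K : realType} (n : nat) (A C P Q : 'M[K]_n) :
  pair (A^T *m P + P *m A + C^T *m P *m C + Q) P <=
  (2 * frobenius A + frobenius C ^+ 2) * frobenius P ^+ 2 + frobenius Q * frobenius P.
Proof.
rewrite !pairDl; apply: lerD; last exact: pair_CauchySchwarz.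
have P0 := frobenius_ge0 P.
have h1 : pair (A^T *m P) P <= frobenius A * frobenius P * frobenius P.
  apply: le_trans (pair_CauchySchwarz _ _) _; apply: (ler_wpM2r P0).
  by rewrite -(frobenius_tr A); exact: frobenius_mul.
have h2 : pair (P *m A) P <= frobenius A * frobenius P * frobenius P.
  apply: le_trans (pair_CauchySchwarz _ _) _; apply: (ler_wpM2r P0).
  by rewrite mulrC; exact: frobenius_mul.
have h3 : pair (C^T *m P *m C) P <= frobenius C * frobenius P * frobenius C * frobenius P.
  apply: le_trans (pair_CauchySchwarz _ _) _; apply: (ler_wpM2r P0).
  apply: le_trans (frobenius_mul _ _) _; apply: (ler_wpM2r (frobenius_ge0 C)).
  by rewrite -(frobenius_tr C); exact: frobenius_mul.
by move: h1 h2 h3; move: (frobenius A) (frobenius C) (frobenius P) => a c p; clear=> *; lra.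
Qed.

Section closed_loop.
Context {K : realType} {d : measure_display} {Omega : measurableType d}.
Variables (Pr : probability Omega K) (W : K -> Omega -> K).
Local Notation F := (augmented_filtration Pr W).
Local Notation mu := (@lebesgue_measure K).
Hypothesis W_bm : brownian_motion Pr F W.
Variables (n m : nat) (T : K) (T_gt0 : 0 < T).
Variables (A C : K -> 'M[K]_n) (B D : K -> 'M[K]_(n, m)) (G : K -> 'M[K]_n).
Variables (Q : K -> K -> 'M[K]_n) (R : K -> K -> 'M[K]_m).
Hypotheses (A_cont : {within `[0, T], continuous A})
  (C_cont : {within `[0, T], continuous C})
  (B_cont : {within `[0, T], continuous B})
  (D_cont : {within `[0, T], continuous D})
  (Q_cont : {within `[0, T] `*` `[0, T], continuous (fun z : K * K => Q z.1 z.2)})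
  (R_cont : {within `[0, T] `*` `[0, T], continuous (fun z : K * K => R z.1 z.2)})
  (R_sym : forall t s : K, 0 <= t <= T -> 0 <= s <= T -> mx_symmetric (R t s)).
Variables (delta : K) (Qhat Ghat : 'M[K]_n).
Hypotheses (delta_gt0 : 0 < delta)
  (QRG_lower : forall t s : K, 0 <= t -> t <= s -> s <= T ->
     [/\ psd (Q t s), psd (R t s - delta%:M) & psd (G t)])
  (QRG_mono : forall t r s : K, 0 <= t -> t <= r -> r <= s -> s <= T ->
     [/\ psd (Q r s - Q t s), psd (R r s - R t s) & psd (G r - G t)])
  (QG_upper : forall t s : K, 0 <= t -> t <= s -> s <= T ->
     psd (Qhat - Q t s) /\ psd (Ghat - G t)).
Variables (P : K -> 'M[K]_n) (Phi : K -> K -> Omega -> 'M[K]_n).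
Hypotheses (P_cont : {within `[0, T], continuous P})
  (P_psd : forall t : K, 0 <= t <= T -> psd (P t))
  (P_sol : volterra_solution Pr F W T A C B D G Q R P Phi).
Implicit Types (t r s u : K) (N : 'M[K]_n).

Let Theta := feedback B D C R P.
Let A1 s := A s + B s *m Theta s.
Let C1 s := C s + D s *m Theta s.
Let q t s := Q t s + (Theta s)^T *m R t s *m Theta s.
Let Lam s := R s s + (D s)^T *m P s *m D s.
(* [bounded_coef] asks for a bound and measurability on the whole line. *)
Let cut (M : K -> 'M[K]_n) s := if 0 <= s <= T then M s else 0.
Let A' := cut A1.
Let C' := cut C1.

Let T_ge0 : 0 <= T := ltW T_gt0.

Let psd_scalar (c : K) : 0 <= c -> psd (c%:M : 'M[K]_m).
Proof.
move=> c0; split; first by rewrite /mx_symmetric tr_scalar_mx.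
move=> x; rewrite mul_mx_scalar -scalemxAl mxE mulr_ge0// mxE.
by apply: sumr_ge0 => i _; rewrite mxE -expr2 sqr_ge0.
Qed.

Let psd_R t s : 0 <= t -> t <= s -> s <= T -> psd (R t s).
Proof.
move=> t0 ts sT; have [_ hR _] := QRG_lower t0 ts sT.
by rewrite -[R t s](subrK delta%:M); apply: psd_add => //; exact: psd_scalar (ltW _).
Qed.

Let psd_Lam s : 0 <= s <= T -> psd (Lam s).
Proof.
move=> /[dup] hs /andP[s0 sT]; apply: psd_add; first exact: psd_R.
by apply: psd_congr; exact: P_psd.
Qed.

Let unit_Lam s : 0 <= s <= T -> Lam s \in unitmx.
Proof.
move=> /[dup] hs /andP[s0 sT]; apply: (unitmx_form delta_gt0) => x.
have [_ [_ hR] _] := QRG_lower s0 (lexx s) sT.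
have [_ hP] := psd_congr (D s) (P_psd hs).
have := addr_ge0 (hR x) (hP x); rewrite mulmxBr mulmxBl mul_mx_scalar -scalemxAl.
rewrite (_ : pair x x = (x^T *m x) 0 0); last first.
  by rewrite mxE /pair; apply: eq_bigr => i _; rewrite big_ord1 mxE.
rewrite /form /Lam mulmxDr mulmxDl !mxE; move: (_ _ 0) => *; lra.
Qed.

Let Lam_Theta s : 0 <= s <= T ->
  Lam s *m Theta s = - ((B s)^T *m P s + (D s)^T *m P s *m C s).
Proof. by move=> hs; rewrite /Theta /feedback mulmxN mulKVmx// unit_Lam. Qed.

Let cA := mx_icont_entries A_cont.
Let cB := mx_icont_entries B_cont.
Let cC := mx_icont_entries C_cont.
Let cD := mx_icont_entries D_cont.
Let cP := mx_icont_entries P_cont.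

Let cpair t : continuous (fun s : K => (t, s)).
Proof. by move=> s; exact: (@cvg_pair _ _ _ (nbhs s) (nbhs t) (nbhs s) _ _ _ (fun=> t) id (cvg_cst t) cvg_id). Qed.

Let cdiag : continuous (fun s : K => (s, s)).
Proof. by move=> s; exact: (@cvg_pair _ _ _ (nbhs s) (nbhs s) (nbhs s) _ _ _ id id cvg_id cvg_id). Qed.

Let cTheta : mx_icont T Theta.
Proof.
have cR : mx_icont T (fun s => R s s).
  by apply: (mx_icont_within R_cont cdiag) => s.
apply: mx_icontN; apply: mx_icontM; last first.
  apply: mx_icontD; first by apply: mx_icontM => //; exact: mx_icont_tr.
  by apply: mx_icontM => //; apply: mx_icontM => //; exact: mx_icont_tr.
apply: mx_icont_inv => [s|]; first by rewrite /= in_itv; exact: unit_Lam.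
apply: mx_icontD => //; apply: mx_icontM => //; apply: mx_icontM => //.
exact: mx_icont_tr.
Qed.

Let cA1 : mx_icont T A1.
Proof. by apply: mx_icontD => //; exact: mx_icontM. Qed.

Let cC1 : mx_icont T C1.
Proof. by apply: mx_icontD => //; exact: mx_icontM. Qed.

Let cq t : 0 <= t <= T -> mx_icont T (q t).
Proof.
move=> ht; apply: mx_icontD.
  by apply: (mx_icont_within Q_cont (@cpair t)) => s Is; split=> //=; rewrite in_itv.
apply: mx_icontM => //; apply: mx_icontM; first exact: mx_icont_tr.
by apply: (mx_icont_within R_cont (@cpair t)) => s Is; split=> //=; rewrite in_itv.
Qed.

Let bA : bounded_coef A' := bounded_coef_icont T_ge0 cA1.
Let bC : bounded_coef C' := bounded_coef_icont T_ge0 cC1.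
Let bq t (ht : 0 <= t <= T) : bounded_coef (cut (q t)) :=
  bounded_coef_icont T_ge0 (cq ht).

Let cutE M t s : 0 <= t -> t <= s <= T -> M s = cut M s.
Proof. by move=> t0 /andP[ts sT]; rewrite /cut (le_trans t0 ts) sT. Qed.

Let S t N := moment_mx Pr (Phi t) N.

Let sde t (ht : 0 <= t <= T) :
  linear_sde_solution Pr F W t T A1 C1 (Phi t) := (P_sol ht).1.

Let lyapunov_S t N : 0 <= t <= T -> lyapunov A' C' t T N (S t N).
Proof.
move=> /[dup] ht /andP[t0 tT].
by apply: (moment_mx_lyapunov W_bm t0 bA bC _ _ (sde ht)) => s; exact: cutE.
Qed.

Let S_psd t M N s : 0 <= t -> t <= s <= T -> psd M -> psd N -> 0 <= pair M (S t N s).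
Proof.
move=> t0 /[dup] hs /andP[ts sT]; have ht : 0 <= t <= T by rewrite t0 (le_trans ts).
by apply: (moment_mx_psd W_bm t0 bA _ _ (sde ht) hs) => u; exact: cutE.
Qed.

Let integrable_S t N : 0 <= t <= T ->
  mu.-integrable `[t, T] (EFin \o (fun s => pair (q t s) (S t N s))).
Proof.
move=> /[dup] ht /andP[t0 tT].
by apply: (integrable_cost W_bm t0 bA bC _ _ (sde ht) (bq ht)) => s; exact: cutE.
Qed.

Let costE t N : 0 <= t <= T -> pair (P t) N =
  pair (G t) (S t N T) + \int[mu]_(s in `[t, T]) pair (q t s) (S t N s).
Proof.
move=> /[dup] ht /andP[t0 tT].
apply: (pair_cost W_bm t0 tT bA _ _ (sde ht) (bq ht)); last exact: (P_sol ht).2.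
all: by move=> s; exact: cutE.
Qed.

(** Both sides solve the same Lyapunov equation on [r, T] with the same value at r, although they
    come from different solutions [Phi t] and [Phi r]. *)
Let flow t r N s : 0 <= t -> t <= r -> r <= s <= T -> S t N s = S r (S t N r) s.
Proof.
move=> t0 tr /[dup] hs /andP[rs sT]; have rT := le_trans rs sT.
have ht : 0 <= t <= T by rewrite t0 (le_trans tr).
have hr : 0 <= r <= T by rewrite (le_trans t0).
apply: (lyapunov_unique bA bC rT _ (lyapunov_S _ hr)) => //.
by apply: (lyapunov_restart bA bC) (lyapunov_S N ht); rewrite tr rT.
Qed.

(* The weights in force at the later time r are larger than those at t. *)
Let pair_le t r N : 0 <= t -> t <= r -> r <= T -> psd N -> pair (P t) N <=
  pair (P r) (S t N r) + \int[mu]_(s in `[t, r]) pair (q t s) (S t N s).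
Proof.
move=> t0 tr rT pN.
have ht : 0 <= t <= T by rewrite t0 (le_trans tr).
have hr : 0 <= r <= T by rewrite (le_trans t0).
have hT : t <= T <= T by rewrite lexx (le_trans tr).
have jt := integrable_S N ht.
(* Moments restarted at r are written back as moments from t, so positivity is needed only for the
   initial matrix N. *)
rewrite (costE _ ht) (costE _ hr) -flow ?rT ?lexx// (Rintegral_split tr rT jt).
rewrite [X in _ + X]addrC addrA lerD2r; apply: lerD.
  rewrite -subr_ge0 -pairBl; apply: S_psd => //.
  by have [] := QRG_mono t0 tr rT (lexx T).
apply: le_Rintegral => //.
- exact: integrable_itv_sub jt.
- exact: integrable_S.
move=> s; rewrite /= in_itv/= => /[dup] hs /andP[rs sT].
rewrite -flow// -subr_ge0 -pairBl; apply: S_psd => //; first by rewrite (le_trans tr).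
have [hQ hR _] := QRG_mono t0 tr rs sT.
rewrite /q opprD addrACA; apply: psd_add => //.
by rewrite -mulmxBl -mulmxBr; exact: psd_congr.
Qed.

(** At t = T the integral vanishes and the moment matrix is its initial value, so N = [P T] gives
    |[P T]|^2 = <[G T], [P T]>; then Cauchy-Schwarz and [psd_frobenius_le]. *)
Let frobenius_T : frobenius (P T) <= frobenius Ghat.
Proof.
have hT : 0 <= T <= T by rewrite T_ge0 lexx.
have [_ _ pG] := QRG_lower T_ge0 (lexx T) (lexx T).
have [_ hG] := QG_upper T_ge0 (lexx T) (lexx T).
apply: le_trans (psd_frobenius_le pG hG).
have := costE (P T) hT; rewrite set_itv1 Rintegral_set1 addr0.
rewrite (lyapunov_start (lexx T) (lyapunov_S (P T) hT)) -sqr_frobenius.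
have [->|P0] := eqVneq (frobenius (P T)) 0; first by rewrite frobenius_ge0.
move=> e; have := pair_CauchySchwarz (G T) (P T); rewrite -e expr2 ler_pM2r//.
by rewrite lt_neqAle eq_sym P0 frobenius_ge0.
Qed.

(** After the square is completed, the subtracted term pairs two positive semidefinite matrices, so
    dropping it only enlarges the right-hand side. *)
Let dissipation t : 0 <= t <= T ->
  pair (P t) (lyap_op A' C' t (P t)) + pair (q t t) (P t) <=
  (2 * frobenius (A t) + frobenius (C t) ^+ 2) * frobenius (P t) ^+ 2 +
  frobenius Qhat * frobenius (P t).
Proof.
move=> /[dup] ht /andP[t0 tT].
have tt : t <= t <= T by rewrite lexx.
rewrite /lyap_op /A' /C' -!(cutE _ t0 tt) /A1 /C1 /q.
rewrite (feedback_energy _ _ (P_psd ht).1 (R_sym ht ht) (Lam_Theta ht)).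
have h1 : 0 <= pair ((Theta t)^T *m Lam t *m Theta t) (P t).
  by apply: psd_pair (P_psd ht); apply: psd_congr; exact: psd_Lam.
have h2 := energy_bound (A t) (C t) (P t) (Q t t).
have h3 : frobenius (Q t t) * frobenius (P t) <= frobenius Qhat * frobenius (P t).
  apply: (ler_wpM2r (frobenius_ge0 _)).
  have [pQ _ _] := QRG_lower t0 (lexx t) tT.
  by apply: psd_frobenius_le pQ _; have [] := QG_upper t0 (lexx t) tT.
apply: le_trans (_ : _ <= pair ((A t)^T *m P t + P t *m A t +
  (C t)^T *m P t *m C t + Q t t) (P t)) _; first by rewrite gerBl.
by apply: le_trans h2 _; rewrite lerD2l.
Qed.

Lemma value_bound t : 0 <= t <= T -> frobenius (P t) <=
  (frobenius Ghat + T * frobenius Qhat) *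
  expR (\int[mu]_(s in `[0, T]) (2 * frobenius (A s) + frobenius (C s) ^+ 2)).
Proof.
move=> ht; pose f s := frobenius (P s).
pose a s := 2 * frobenius (A s) + frobenius (C s) ^+ 2.
have ca : icont T a.
  apply: icontD; first by apply: icontM; [exact: icont_cst|exact: icont_frobenius].
  by under eq_fun do rewrite expr2; apply: icontM; exact: icont_frobenius.
have a0 s : 0 <= s <= T -> 0 <= a s.
  by rewrite addr_ge0 ?mulr_ge0 ?sqr_ge0 ?frobenius_ge0.
have f0 s : 0 <= s <= T -> 0 <= f s by rewrite frobenius_ge0.
apply: (@le_trans _ _ ((f T + T * frobenius Qhat) * expR (\int[mu]_(s in `[0, T]) a s))).
  apply: (gronwall_dini T_gt0 (frobenius_ge0 Qhat) ca (icont_frobenius cP) a0 f0) ht.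
  move=> {}t t0 tT ft; have ht : 0 <= t <= T by rewrite t0 ltW.
  have lS := lyapunov_S (P t) ht.
  have right_P k l : P u k l @[u --> t^'+] --> P t k l.
    exact: (icont_right t0 tT (@cP k l)).
  have right_cut M k l : mx_icont T M -> cut M u k l @[u --> t^'+] --> cut M t k l.
    move=> cM; rewrite -(@cutE M t t t0) ?lexx ?ltW//.
    apply: cvg_trans (icont_right t0 tT (cM k l)).
    apply: near_eq_cvg; near=> u; rewrite -(@cutE M t u)//; apply/andP; split.
      by near: u; exact: nbhs_right_ge.
    by near: u; exact: nbhs_right_le.
  (* The right-hand side of [pair_le] minus <[P r], [P t]>, divided by r - t. [P] enters at time r
     and outside the difference quotient, so its right-continuity at t is enough. *)
  pose psi r := pair (P r) ((r - t)^-1 *: (S t (P t) r - P t)) +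
    (r - t)^-1 * \int[mu]_(s in `[t, r]) pair (q t s) (S t (P t) s).
  exists (fun r => (f t)^-1 * psi r).
  exists ((f t)^-1 * (pair (P t) (lyap_op A' C' t (P t)) + pair (q t t) (P t))); split.
  - apply: cvgM; first exact: cvg_cst.
    apply: cvgD.
      apply: cvg_sumr => k; apply: cvg_sumr => l; apply: cvgM; first exact: right_P.
      have entry c (X Y : 'M[K]_n) : (c *: (X - Y)) k l = c * (X k l - Y k l).
        by rewrite !mxE.
      under eq_fun do rewrite entry.
      by apply: (lyapunov_right_derivative bA bC tT lS) => i j; exact: right_cut.
    apply: (average_cvg tT (integrable_S _ ht)).
    apply: cvg_sumr => k; apply: cvg_sumr => l; apply: cvgM.
      exact: (icont_right t0 tT (@cq t ht k l)).
    exact: (lyapunov_right_cvg bA bC tT lS).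
  - rewrite ler_pdivrMl//; apply: le_trans (dissipation ht) _.
    by rewrite le_eqVlt; apply/orP; left; apply/eqP; rewrite -/(f t) -/(a t); ring.
  near=> r.
  have tr : t < r by near: r; exact: nbhs_right_gt.
  have rT : r <= T by near: r; exact: nbhs_right_le.
  have h0 : r - t != 0 by rewrite subr_eq0 gt_eqF.
  (* Multiplied by f(t) > 0, the claim reads f(t)^2 - f(t) f(r) <= (r - t) psi(r): this is [pair_le]
     with N = [P t], combined with <[P r], [P t]> <= f(r) f(t). *)
  rewrite mulrCA ler_pdivlMl// mulrBr.
  have h1 := pair_CauchySchwarz (P r) (P t).
  have h2 := pair_le t0 (ltW tr) rT (P_psd ht).
  rewrite -sqr_frobenius -/(f t) in h2.
  rewrite /psi pairZr mulrDr !mulrA divff// !mul1r pairBr.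
  rewrite addrAC -expr2 [f t * f r]mulrC; exact: lerB h2 h1.
by rewrite ler_wpM2r ?expR_ge0// lerD2r; exact: frobenius_T.
Unshelve. all: by end_near. Qed.

End closed_loop.

Unset Implicit Arguments.
Set Strict Implicit.
Set Printing Implicit Defensive.

Theorem proposition3p1 (K : realType) (d : measure_display)
    (Omega : measurableType d) (Pr : probability Omega K)
    (Pr_complete : measure_is_complete Pr)
    (F : K -> set (set Omega)) (W : K -> Omega -> K)
    (F_def : F = augmented_filtration Pr W)
    (W_bm : brownian_motion Pr F W)
    (n m : nat) (T : K) (T_gt0 : 0 < T)
    (A C : K -> 'M[K]_n) (B D : K -> 'M[K]_(n, m)) (G : K -> 'M[K]_n)
    (Q : K -> K -> 'M[K]_n) (R : K -> K -> 'M[K]_m)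
    (A_cont : {within `[0, T], continuous A})
    (C_cont : {within `[0, T], continuous C})
    (B_cont : {within `[0, T], continuous B})
    (D_cont : {within `[0, T], continuous D})
    (G_cont : {within `[0, T], continuous G})
    (Q_cont : {within `[0, T] `*` `[0, T],
                continuous (fun z : K * K => Q z.1 z.2)})
    (R_cont : {within `[0, T] `*` `[0, T],
                continuous (fun z : K * K => R z.1 z.2)})
    (G_sym : forall t : K, 0 <= t <= T -> mx_symmetric (G t))
    (Q_sym : forall t s : K, 0 <= t <= T -> 0 <= s <= T -> mx_symmetric (Q t s))
    (R_sym : forall t s : K, 0 <= t <= T -> 0 <= s <= T -> mx_symmetric (R t s))
    (delta : K) (delta_gt0 : 0 < delta)
    (QRG_lower : forall t s : K, 0 <= t -> t <= s -> s <= T ->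
       [/\ loewner_le 0 (Q t s), loewner_le delta%:M (R t s)
         & loewner_le 0 (G t)])
    (Qhat : 'M[K]_n) (Rhat : 'M[K]_m) (Ghat : 'M[K]_n)
    (Qhat_pd : posdef Qhat) (Rhat_pd : posdef Rhat) (Ghat_pd : posdef Ghat)
    (QRG_mono : forall t r s : K, 0 <= t -> t <= r -> r <= s -> s <= T ->
       [/\ loewner_le (Q t s) (Q r s) /\ loewner_le (Q r s) Qhat,
           loewner_le (R t s) (R r s) /\ loewner_le (R r s) Rhat
         & loewner_le (G t) (G r) /\ loewner_le (G r) Ghat])
    (G_C1 : C1_on T G)
    (Q_C1 : C1_fst_on_triangle T Q)
    (R_C1 : C1_fst_on_triangle T R)
    (* P t stands for P(t, t) *)
    (P : K -> 'M[K]_n) (Phi : K -> K -> Omega -> 'M[K]_n)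
    (P_cont : {within `[0, T], continuous P})
    (P_psd : forall t : K, 0 <= t <= T -> psd (P t))
    (P_sol : volterra_solution Pr F W T A C B D G Q R P Phi) :
  (ereal_sup [set (frobenius (P t))%:E | t in `[0%R, T]] <=
   ((frobenius Ghat + T * frobenius Qhat) *
    expR (\int[lebesgue_measure]_(s in `[0, T])
            (2 * frobenius (A s) + frobenius (C s) ^+ 2)))%:E)%E.
Proof.
subst F; apply: ge_ereal_sup => y [t]; rewrite /= in_itv/= => ht <-; rewrite lee_fin.
apply: (value_bound W_bm T_gt0 A_cont C_cont B_cont D_cont Q_cont R_cont R_sym
  delta_gt0 _ _ _ P_cont P_psd P_sol ht).
- move=> r s r0 rs sT; have [pQ pR pG] := QRG_lower r s r0 rs sT.
  by move: pQ pR pG; rewrite /loewner_le !subr0.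
- move=> r u s r0 ru us sT.
  by have [[? _] [? _] [? _]] := QRG_mono r u s r0 ru us sT.
- move=> r s r0 rs sT.
  by have [[_ ?] _ [_ ?]] := QRG_mono r r s r0 (lexx r) rs sT.
Qed.
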